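(* Let $\Xi$ be a translation invariant point process on $\mathbb{R}^d$ or $\mathbb{Z}^d$ with intensity $\rho>0$ which is stealthy hyperuniform, i.e. whose structure function $S$ vanishes in a neighbourhood of the origin of the wave space. Let $B(x;r)$ denote the ball with centre $x$ and radius $r$. Then there exists a positive number $r_0$ such that, for every $x$ (in $\mathbb{R}^d$, respectively $\mathbb{Z}^d$), $$\mathbb{P}\big[\,|\Xi\cap B(x;r_0)|=0\,\big]=0.$$
   Context: A point process on $\mathbb{R}^d$ (resp. $\mathbb{Z}^d$) is a random locally finite point configuration $\Xi$, identified with its counting measure; $|\Xi\cap A|$ is the number of points in $A$. It is assumed that $\mathbb{E}[|\Xi\cap K|^2]<\infty$ for every bounded $K$. The process is translation invariant if its law is invariant under all translations by elements of $\mathbb{R}^d$ (resp. $\mathbb{Z}^d$); then $\mathbb{E}[\mathrm{d}\Xi]=\rho\,\mathrm{d}u$ with $\mathrm{d}u$ Lebesgue measure (resp. counting measure), and $\rho$ is the intensity. The covariance functional $\beta$ of $\Xi$ is defined by $$\mathrm{Cov}\Big[\int\varphi\,\mathrm{d}\Xi,\int\psi\,\mathrm{d}\Xi\Big]=\iint\varphi(s)\,\overline{\psi(t)}\,\beta(s-t)\,\mathrm{d}s\,\mathrm{d}t$$ for test functions $\varphi,\psi$ (sums replace integrals on $\mathbb{Z}^d$; in general $\beta$ may be a measure or distribution; for a simple point process on $\mathbb{R}^d$ with two-point correlation function $\rho_2$ one has $\beta(x)=\rho_2(x)-\rho^2+\rho\,\delta(x)$). The structure function $S$ is the Fourier transform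 $\hat\beta$, with convention $\hat f(k)=\int f(x)e^{-i\langle k,x\rangle}\mathrm{d}x$; it lives on the wave space, which is $\mathbb{R}^d$ when the physical space is $\mathbb{R}^d$ and the torus $\mathbb{T}^d=\mathbb{R}^d/(2\pi\mathbb{Z})^d$ when the physical space is $\mathbb{Z}^d$. In general $S$ may be a nonnegative measure, in which case ''vanishes on $U$'' means $S(U)=0$. *)

(* Defs.v *)
From HB Require Import structures.
From mathcomp Require Import all_boot all_order all_algebra.
From mathcomp Require Import all_classical all_reals all_analysis.
From mathcomp Require Import measurable_realfun complex.
Set Implicit Arguments.
Unset Strict Implicit.
Unset Printing Implicit Defensive.
Import Order.TTheory GRing.Theory Num.Theory.
Import numFieldNormedType.Exports.
Local Open Scope classical_set_scope.
Local Open Scope complex_scope.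
Local Open Scope ring_scope.

(* The product sigma-algebra on row vectors: the Borel sigma-algebra on
   'rV[R]_n, and all subsets on the countable type 'rV[int]_n. *)
Definition measure_row_display : measure_display -> measure_display.
Proof. exact. Qed.

Section measurable_row.
Context {d : measure_display} {T : measurableType d} (n : nat).

Let coor (i : 'I_n) (x : 'rV[T]_n) : T := x ord0 i.

Let row_set0 : g_sigma_preimage coor set0.
Proof. exact: sigma_algebra0. Qed.

Let row_setC A : g_sigma_preimage coor A -> g_sigma_preimage coor (~` A).
Proof. exact: sigma_algebraC. Qed.

Let row_bigcup (F : (set 'rV[T]_n)^nat) :
  (forall i, g_sigma_preimage coor (F i)) ->
  g_sigma_preimage coor (\bigcup_i (F i)).
Proof. exact: sigma_algebra_bigcup. Qed.

HB.instance Definition _ := @isMeasurable.Build (measure_row_display d)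
  'rV[T]_n (g_sigma_preimage coor) row_set0 row_setC row_bigcup.

Lemma measurable_coor (i : 'I_n) :
  measurable_fun setT (fun x : 'rV[T]_n => x ord0 i).
Proof.
move=> _ Y mY; rewrite setTI; apply: sub_sigma_algebra.
rewrite (bigD1 i) //=; left; exists Y => //.
by rewrite setTI.
Qed.

Lemma measurable_rowP d' (U : measurableType d') (f : U -> 'rV[T]_n) :
  (forall i, measurable_fun setT (fun x => f x ord0 i)) ->
  measurable_fun setT f.
Proof.
move=> mf.
apply: (@measurability _ _ _ _ _ _
  (\big[setU/set0]_(i < n) preimage_set_system setT (coor i) measurable)).
  by [].
move=> _ [B + <-].
elim/big_ind : _ => //=.
- by move=> X Y HX HY [/HX|/HY].
- move=> i _ [Y mY <-].
  have := mf i measurableT Y mY.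
  by rewrite !setTI.
Qed.

End measurable_row.

HB.instance Definition _ := isPointed.Build int 0.
HB.instance Definition _ := @isMeasurable.Build default_measure_display
  int discrete_measurable discrete_measurable0
  discrete_measurableC discrete_measurableU.


Lemma measurable_row_int n (A : set 'rV[int]_n) : measurable A.
Proof.
have m1 (x : 'rV[int]_n) : measurable [set x].
  rewrite (_ : [set x] = \bigcap_(i in [set: 'I_n])
     ((fun y : 'rV[int]_n => y ord0 i) @^-1` [set x ord0 i])).
    apply: fin_bigcap_measurable => // i _.
    by rewrite -[X in measurable X]setTI; exact: measurable_coor.
  apply/seteqP; split => [y /= -> //|y yx].
  by apply/rowP => i; exact: (yx i).
rewrite (_ : A = \bigcup_k
    (if unpickle k is Some x then [set x] `&` A else set0)).
  apply: bigcupT_measurable => k; case: (unpickle k) => // x.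
  have [Ax|Ax] := pselect (A x).
    by rewrite setIidl// => _ ->.
  rewrite (_ : _ `&` _ = set0)//; apply/seteqP; split => y //.
  by move=> [-> /Ax].
apply/seteqP; split => [x Ax|x [k _]].
  by exists (pickle x) => //; rewrite pickleK.
by case: (unpickle k) => // y [].
Qed.

Section lebesgue_row.
Context {R : realType}.

Definition row_cons n (p : measurableTypeR R * 'rV[R]_n) : 'rV[R]_n.+1 :=
  row_mx (const_mx p.1 : 'rV_1) p.2.

Lemma measurable_row_cons n : measurable_fun setT (@row_cons n).
Proof.
apply: measurable_rowP => i.
case: (split_ordP (i : 'I_(1 + n))) => j ->.
- rewrite (_ : (fun _ => _) = (fun p => p.1)); first exact: measurable_fst.
  by apply/funext => p; rewrite (row_mxEl (const_mx p.1 : 'rV_1)) mxE.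
- rewrite (_ : (fun _ => _) =
    (fun x : 'rV[R]_n => x ord0 j) \o snd); last first.
    by apply/funext => p; rewrite (row_mxEr (const_mx p.1 : 'rV_1)).
  by apply: measurableT_comp; [exact: measurable_coor|exact: measurable_snd].
Qed.

Definition row_uncons n (x : 'rV[R]_n.+1) : measurableTypeR R * 'rV[R]_n :=
  (x ord0 ord0, \row_j x ord0 (rshift 1 j)).

Lemma row_consK n : cancel (@row_cons n) (@row_uncons n).
Proof.
move=> [a v]; congr pair.
  rewrite (_ : ord0 = lshift n (ord0 : 'I_1)); last exact/val_inj.
  by rewrite (row_mxEl (const_mx a : 'rV_1)) mxE.
by apply/rowP => j; rewrite mxE (row_mxEr (const_mx a : 'rV_1)).
Qed.

Lemma measurable_row_uncons n : measurable_fun setT (@row_uncons n).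
Proof.
apply/measurable_fun_pairP; split; first exact: measurable_coor.
apply: measurable_rowP => j.
rewrite (_ : (fun _ => _) = (fun x : 'rV[R]_n.+1 => x ord0 (rshift 1 j))).
  exact: measurable_coor.
by apply/funext => x; rewrite /= mxE.
Qed.

Lemma row_unconsK n : cancel (@row_uncons n) (@row_cons n).
Proof.
move=> x; apply/rowP => i.
case: (split_ordP (i : 'I_(1 + n))) => j ->.
- rewrite (row_mxEl (const_mx _ : 'rV_1)) mxE/=.
  by congr (x _ _); apply/val_inj; rewrite [j]ord1.
- by rewrite (row_mxEr (const_mx _ : 'rV_1)) mxE.
Qed.

Section step.
Variables (n : nat) (m : {sigma_finite_measure set 'rV[R]_n -> \bar R}).

Definition lebesgue_row_step : set 'rV[R]_n.+1 -> \bar R :=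
  pushforward (lebesgue_measure \x m)%E (@row_cons n).

Let step0 : lebesgue_row_step set0 = 0%E.
Proof. by rewrite /lebesgue_row_step /pushforward preimage_set0 measure0. Qed.

Let step_ge0 A : (0 <= lebesgue_row_step A)%E.
Proof. exact: (measure_ge0 (lebesgue_measure \x m)%E). Qed.

Let step_sigma_additive : semi_sigma_additive lebesgue_row_step.
Proof.
have mcons (B : set 'rV[R]_n.+1) :
    measurable B -> measurable (@row_cons n @^-1` B).
  by move=> mB; rewrite -[X in measurable X]setTI; exact: measurable_row_cons.
move=> F mF tF mUF; rewrite /lebesgue_row_step /pushforward preimage_bigcup.
apply: measure_semi_sigma_additive.
- by move=> i; exact: mcons.
- apply/trivIsetP => /= i j _ _ ij; rewrite -preimage_setI.
  by move/trivIsetP : tF => /(_ _ _ _ _ ij) ->//; rewrite preimage_set0.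
- by rewrite -preimage_bigcup; exact: mcons.
Qed.

HB.instance Definition _ := isMeasure.Build _ _ _ lebesgue_row_step
  step0 step_ge0 step_sigma_additive.

Let step_sigma_finite : sigma_finite setT lebesgue_row_step.
Proof.
have [F FT mF] : sigma_finite setT (lebesgue_measure \x m)%E.
  have /sigma_finiteP[F [TF ndF Foo]] := sigma_finiteT (@lebesgue_measure R).
  have /sigma_finiteP[G [TG ndG Goo]] := sigma_finiteT m.
  exists (fun i => F i `*` G i).
    rewrite -setXTT TF TG predeqE => -[x y]; split.
      move=> [/= [i _ Fix] [k _ Gky]]; exists (maxn i k) => //; split.
        by move: x Fix; exact/subsetPset/ndF/leq_maxl.
      by move: y Gky; exact/subsetPset/ndG/leq_maxr.
    by move=> [i _ []/= ? ?]; split; exists i.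
  move=> k; have [? ?] := Foo k; have [? ?] := Goo k.
  split; first exact: measurableX.
  by rewrite product_measure1E// lte_mul_pinfty// ge0_fin_numE.
exists (fun i => @row_uncons n @^-1` F i).
  by rewrite -preimage_bigcup -FT preimage_setT.
move=> i; have [mFi Fioo] := mF i; split.
  by rewrite -[X in measurable X]setTI; exact: measurable_row_uncons.
rewrite /lebesgue_row_step /pushforward -comp_preimage.
by rewrite (_ : @row_uncons n \o _ = id)//; apply/funext => p; exact: row_consK.
Qed.

HB.instance Definition _ := @Measure_isSigmaFinite.Build _ _ _
  lebesgue_row_step step_sigma_finite.

End step.

Fixpoint lebesgue_row n : {sigma_finite_measure set 'rV[R]_n -> \bar R} :=
  match n with
  | 0 => (\d_(0 : 'rV[R]_0) : set _ -> \bar R)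
  | n'.+1 => lebesgue_row_step (lebesgue_row n')
  end.

Lemma lebesgue_row_box n (A : 'I_n -> set (measurableTypeR R)) :
  (forall i, measurable (A i)) ->
  lebesgue_row n [set x | forall i, A i (x ord0 i)] =
  (\prod_(i < n) lebesgue_measure (A i))%E.
Proof.
elim: n A => [|n IHn] A mA /=.
  by rewrite big_ord0 diracE mem_set// => -[].
rewrite /lebesgue_row_step /pushforward.
rewrite (_ : _ @^-1` _ = A ord0 `*`
  [set x : 'rV[R]_n | forall i, A (lift ord0 i) (x ord0 i)]); last first.
  apply/seteqP; split => [[a v] /= Av|[a v] /= [Aa Av] i].
    split; first by have /(congr1 fst) /= <- := row_consK (a, v); exact: Av.
    move=> i; have := Av (lift ord0 i).
    rewrite (_ : lift ord0 i = rshift 1 i); last exact/val_inj.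
    by rewrite (row_mxEr (const_mx a : 'rV_1)).
  case: (unliftP ord0 i) => [j|] ->.
    rewrite (_ : row_cons _ _ _ = v ord0 j)//.
    rewrite (_ : lift ord0 j = rshift 1 j); last exact/val_inj.
    by rewrite (row_mxEr (const_mx a : 'rV_1)).
  by have /(congr1 fst) /= -> := row_consK (a, v).
have mB : measurable
    [set x : 'rV[R]_n | forall i, A (lift ord0 i) (x ord0 i)].
  rewrite (_ : [set _ | _] = \bigcap_(i in [set: 'I_n])
     ((fun x : 'rV[R]_n => x ord0 i) @^-1` A (lift ord0 i))); last first.
    by apply/seteqP; split => [x /= Ax i _|x Ax i]; [exact: Ax|exact: (Ax i)].
  apply: fin_bigcap_measurable => // i _.
  by rewrite -[X in measurable X]setTI; apply: measurable_coor => //; exact: mA.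
rewrite product_measure1E// big_ord_recl; congr (_ * _)%E.
by apply: (IHn (fun i => A (lift ord0 i))) => i; exact: mA.
Qed.

End lebesgue_row.
Arguments lebesgue_row : clear implicits.

Definition cintegral d (T : measurableType d) (R : realType)
    (mu : {measure set T -> \bar R}) (D : set T) (f : T -> R[i]) : R[i] :=
  (\int[mu]_(x in D) complex.Re (f x))%R +i*
  (\int[mu]_(x in D) complex.Im (f x))%R.

Definition ccov d (T : measurableType d) (R : realType) (P : probability T R)
    (X Y : T -> R[i]) : R[i] :=
  let E := cintegral P setT in
  E (fun w => (X w - E X) * ((Y w - E Y)^*)%C).

Definition dot (R : realType) n (x y : 'rV[R]_n) : R :=
  \sum_i x ord0 i * y ord0 i.

Definition enorm (R : realType) n (x : 'rV[R]_n) : R := Num.sqrt (dot x x).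

(* In the definitions below, iota embeds the physical space X in R^n: it is
   the identity if X = R^n and the inclusion if X = Z^n. *)
Definition introw (R : realType) n (x : 'rV[int]_n) : 'rV[R]_n :=
  map_mx intr x.

Definition eball (R : realType) n (X : Type) (iota : X -> 'rV[R]_n)
    (x : X) (r : R) : set X :=
  [set y | enorm (iota y - iota x) < r].

Definition ebounded (R : realType) n (X : Type) (iota : X -> 'rV[R]_n)
    (K : set X) : Prop :=
  exists M : R, forall x, K x -> enorm (iota x) <= M.

(* A point configuration is given by its counting measure: Xi w A is the
   number of points in A, counted with multiplicity. *)
Definition point_process (R : realType) n
    dX (X : measurableType dX)
    dT (T : measurableType dT) (P : probability T R)
    (Xi : R.-ker T ~> X) (iota : X -> 'rV[R]_n) : Prop :=
  (forall w K, measurable K -> ebounded iota K ->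
     exists m : nat, Xi w K = m%:R%:E) /\
  (forall K, measurable K -> ebounded iota K ->
     \int[P]_w (Xi w K ^+ 2) < +oo)%E.

(* The sigma-algebra on set functions generated by the evaluations
   m |-> m A, on which the law of a point process lives. *)
Definition config_measurable dX (X : measurableType dX) (R : realType) :
    set (set (set X -> \bar R)) :=
  <<s [set E | exists (A : set X) (B : set (\bar R)),
        [/\ measurable A, @measurable _ (\bar R) B & E = [set m | B (m A)]]] >>.

Definition translation_invariant dX (X : measurableType dX) (R : realType)
    dT (T : measurableType dT) (P : probability T R)
    (Xi : R.-ker T ~> X) (add : X -> X -> X) : Prop :=
  forall (t : X) (E : set (set X -> \bar R)), config_measurable E ->
    P [set w | E (pushforward (Xi w) (add t))] = P [set w | E (Xi w)].

Definition has_intensity dX (X : measurableType dX) (R : realType)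
    dT (T : measurableType dT) (P : probability T R)
    (Xi : R.-ker T ~> X) (mu : set X -> \bar R) (rho : R) : Prop :=
  forall A, measurable A -> (\int[P]_w Xi w A = rho%:E * mu A)%E.

Definition pderiv (R : realType) n (s : seq 'I_n) (u : 'rV[R]_n -> R) :
    'rV[R]_n -> R :=
  foldr (fun i v x => 'D_(delta_mx ord0 i) v x) u s.

Definition rsmooth (R : realType) n (u : 'rV[R]_n -> R) : Prop :=
  forall s x, differentiable (pderiv s u) x.

Definition smooth (R : realType) n (f : 'rV[R]_n -> R[i]) : Prop :=
  rsmooth (fun x => complex.Re (f x)) /\ rsmooth (fun x => complex.Im (f x)).

Definition test_function (R : realType) n (f : 'rV[R]_n -> R[i]) : Prop :=
  smooth f /\ compact (closure [set x | f x != 0]).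

(* M bounds (1 + |x|)^N |D^s f(x)| for all x and all |s| <= N *)
Definition schwartz_bound (R : realType) n (N : nat) (f : 'rV[R]_n -> R[i])
    (M : R) : Prop :=
  forall (s : seq 'I_n) x, (size s <= N)%N ->
    (1 + enorm x) ^+ N * `|pderiv s (fun y => complex.Re (f y)) x| <= M /\
    (1 + enorm x) ^+ N * `|pderiv s (fun y => complex.Im (f y)) x| <= M.

Definition schwartz (R : realType) n (f : 'rV[R]_n -> R[i]) : Prop :=
  smooth f /\ forall N, exists M, schwartz_bound N f M.

Definition tempered_distribution (R : realType) n
    (beta : ('rV[R]_n -> R[i]) -> R[i]) : Prop :=
  (forall (a : R[i]) f g, schwartz f -> schwartz g ->
     beta (fun x => a * f x + g x) = a * beta f + beta g) /\
  (exists (N : nat) (C : R), forall f M, schwartz f -> schwartz_bound N f M ->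
     `|beta f| <= (C * M)%:C).

Definition expi (R : realType) (t : R) : R[i] := cos t +i* sin t.

Definition fourier (R : realType) n (f : 'rV[R]_n -> R[i]) (k : 'rV[R]_n) :
    R[i] :=
  cintegral (lebesgue_row R n) setT (fun x => f x * expi (- dot k x)).

Definition tempered_measure (R : realType) n
    (S : {measure set 'rV[R]_n -> \bar R}) : Prop :=
  exists N : nat,
    S.-integrable setT (fun k => (((1 + enorm k) ^+ N)^-1)%:E).

(* x |-> int phi (x + t) conj(psi t) dt, so that
   iint phi(s) conj(psi t) beta(s - t) ds dt is the pairing of beta with it *)
Definition cross_correlation (R : realType) n (phi psi : 'rV[R]_n -> R[i])
    (x : 'rV[R]_n) : R[i] :=
  cintegral (lebesgue_row R n) setT (fun t => phi (x + t) * ((psi t)^*)%C).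

Definition is_covariance_functional (R : realType) n
    dT (T : measurableType dT) (P : probability T R)
    (Xi : R.-ker T ~> 'rV[R]_n) (beta : ('rV[R]_n -> R[i]) -> R[i]) : Prop :=
  tempered_distribution beta /\
  forall phi psi, test_function phi -> test_function psi ->
    ccov P (fun w => cintegral (Xi w) setT phi)
           (fun w => cintegral (Xi w) setT psi) =
    beta (cross_correlation phi psi).

(* S is the Fourier transform of beta as a tempered distribution:
   <S, f> = <beta, fourier f>. *)
Definition is_structure_function (R : realType) n
    (beta : ('rV[R]_n -> R[i]) -> R[i])
    (S : {measure set 'rV[R]_n -> \bar R}) : Prop :=
  tempered_measure S /\
  forall f, schwartz f -> cintegral S setT f = beta (fourier f).

Definition vanishes_near0 (R : realType) n
    (S : {measure set 'rV[R]_n -> \bar R}) : Prop :=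
  exists U : set 'rV[R]_n, [/\ measurable U, nbhs (0 : 'rV[R]_n) U & S U = 0%E].

Definition stealthy_hyperuniform (R : realType) n
    dT (T : measurableType dT) (P : probability T R)
    (Xi : R.-ker T ~> 'rV[R]_n) : Prop :=
  exists (beta : ('rV[R]_n -> R[i]) -> R[i])
         (S : {measure set 'rV[R]_n -> \bar R}),
    [/\ is_covariance_functional P Xi beta, is_structure_function beta S &
        vanishes_near0 S].

Definition is_covariance_functional_lattice (R : realType) n
    dT (T : measurableType dT) (P : probability T R)
    (Xi : R.-ker T ~> 'rV[int]_n) (beta : 'rV[int]_n -> R[i]) : Prop :=
  forall phi psi : 'rV[int]_n -> R[i],
    finite_set [set x | phi x != 0] -> finite_set [set x | psi x != 0] ->
    ccov P (fun w => cintegral (Xi w) setT phi)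
           (fun w => cintegral (Xi w) setT psi) =
    \sum_(s \in [set: 'rV[int]_n]) \sum_(t \in [set: 'rV[int]_n])
      phi s * ((psi t)^*)%C * beta (s - t).

(* The torus T^n is identified with its fundamental domain [-pi, pi[^n,
   which contains the origin in its interior: a measure on T^n is a measure
   on R^n carried by this cell, and a function on T^n is a (2 pi Z)^n-periodic
   function on R^n. *)
Definition torus_cell (R : realType) n : set 'rV[R]_n :=
  [set k | forall i, - pi <= k ord0 i < pi].

Definition torus_periodic (R : realType) n (f : 'rV[R]_n -> R[i]) : Prop :=
  forall (m : 'rV[int]_n) k, f (k + (2 * pi) *: introw R m) = f k.

Definition torus_fourier (R : realType) n (f : 'rV[R]_n -> R[i])
    (x : 'rV[int]_n) : R[i] :=
  cintegral (lebesgue_row R n) (@torus_cell R n)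
    (fun k => f k * expi (- dot (introw R x) k)).

(* The same duality on T^n: <S, f> = sum_x beta(x) fhat(x). *)
Definition is_structure_function_lattice (R : realType) n
    (beta : 'rV[int]_n -> R[i])
    (S : {measure set 'rV[R]_n -> \bar R}) : Prop :=
  [/\ S (~` @torus_cell R n) = 0%E, (S setT < +oo)%E &
   forall f, smooth f -> torus_periodic f ->
     cintegral S setT f =
     cintegral (@counting 'rV[int]_n R) setT
       (fun x => beta x * torus_fourier f x)].

Definition stealthy_hyperuniform_lattice (R : realType) n
    dT (T : measurableType dT) (P : probability T R)
    (Xi : R.-ker T ~> 'rV[int]_n) : Prop :=
  exists (beta : 'rV[int]_n -> R[i])
         (S : {measure set 'rV[R]_n -> \bar R}),
    [/\ is_covariance_functional_lattice P Xi beta,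
        is_structure_function_lattice beta S & vanishes_near0 S].

(* Main.v *)
(* Let u >= 0 be a band-limited Schwartz function: its Fourier transform is
   supported in a small interval around 0. The same holds for (1 + t^2) u(t), and
   for phi(x) = prod_i u(x_i) and psi(x) = prod_i (1 + x_i^2) u(x_i) the variance
   of the integral against Xi is an integral over the support of the Fourier
   transform against S, hence is 0 by stealthiness. So the integrals of phi and
   psi against Xi are almost surely equal to their means, which are positive
   multiples of rho. Outside the cube |x_i| < L one has phi <= psi / (1 + L^2): if
   Xi has no point in a ball containing this cube, then
   (mean of phi) <= (mean of psi) / (1 + L^2), which is false for L large.
   Since phi is not compactly supported, its variance is computed as a limit over
   truncations: smooth ones on R^d, where the covariance functional is only known
   to be continuous on Schwartz functions, and sharp ones on Z^d, where
   sum_t u(t) cos(t k) = 0 away from the band of u by a Fejer kernel argument. *)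

Require Import Defs.
From mathcomp Require Import all_boot all_order all_algebra.
From mathcomp Require Import all_classical all_reals all_analysis.
From mathcomp Require Import measurable_realfun complex ring lra zify.
Import Order.TTheory GRing.Theory Num.Theory.
Import numFieldNormedType.Exports.
Local Open Scope classical_set_scope.
Local Open Scope ring_scope.
Set Implicit Arguments.
Unset Strict Implicit.
Unset Printing Implicit Defensive.

(** * Rapidly decreasing families of smooth functions *)

(** All the analysis takes place on the line: the windows are products over the coordinates, and so
    are their transforms, autocorrelations and lattice sums. The windows are even, so their Fourier
    transforms are real cosine transforms. The basic window is the square of such a transform:
    squaring makes it nonnegative and, by Fourier inversion, only doubles the band. Inversion is
    needed only up to a positive constant. The factor 1 + t^2 preserves the band because in
    frequency it acts as the identity minus a second derivative, which is a local operator. On R^d,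
    stealthiness is used by writing the autocorrelation of the window as the Fourier transform of a
    Schwartz function that vanishes where [S] has mass. This autocorrelation is not compactly
    supported, so the covariance functional reaches it only as a limit in the Schwartz topology.
    That limit requires bounds on every derivative of a whole sequence of functions, which is why
    smoothness is treated for families with a common rate, closed under products and
    correlations. *)

Section smooth_families.
Context {R : realType}.
Local Open Scope classical_set_scope.
Implicit Types (F G : nat -> R -> R) (f g : R -> R) (w : nat -> R).

(* Coinductive definition: every iterated derivative of F satisfies bd. *)
Definition smooth_in (bd : (nat -> R -> R) -> Prop) F : Prop :=
  exists2 C : (nat -> R -> R) -> Prop, C F &
    forall G, C G -> bd G /\
      exists2 G', C G' & forall n x, is_derive x (1 : R) (G n) (G' n x).

Definition rapid w F : Prop :=
  forall N, exists M : R, forall n x, `|F n x| * (1 + `|x|) ^+ N <= M * w n.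

(** Under [smooth_in] the exponent [a] may change from one derivative to the next: these are the
    multipliers of the Schwartz space, with a rate. *)
Definition slow w F : Prop :=
  exists a (M : R), forall n x, `|F n x| <= M * w n * (1 + `|x|) ^+ a.

Lemma smooth_in_bd bd F : smooth_in bd F -> bd F.
Proof. by case=> C CF /(_ _ CF)[]. Qed.

Lemma smooth_inP bd F : smooth_in bd F ->
  exists2 F', smooth_in bd F' & forall n x, is_derive x (1 : R) (F n) (F' n x).
Proof.
by case=> C CF cC; have [_ [F' CF' dF]] := cC _ CF; exists F' => //; exists C.
Qed.

Lemma smooth_in_derivable bd F n x : smooth_in bd F -> derivable (F n) x 1.
Proof. by case/smooth_inP => F' _ dF; have := dF n x; case. Qed.

Lemma smooth_in_continuous bd F n : smooth_in bd F -> continuous (F n).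
Proof.
move=> sF x; apply: differentiable_continuous; apply/derivable1_diffP.
exact: smooth_in_derivable sF.
Qed.

Lemma is_derive_derive1 f f' : (forall x, is_derive x (1 : R) f (f' x)) ->
  f^`() = f'.
Proof. by move=> df; apply/funext => x; rewrite derive1E; apply: derive_val. Qed.

Lemma smooth_in_derive1 bd F : smooth_in bd F ->
  smooth_in bd (fun n => (F n)^`()).
Proof.
move=> /smooth_inP[F' sF' dF].
suff -> : (fun n => (F n)^`()) = F' by [].
by apply/funext => n; exact: is_derive_derive1.
Qed.

Lemma smooth_in_derive1n bd F k : smooth_in bd F ->
  smooth_in bd (fun n => (F n)^`(k)).
Proof.
by move=> sF; elim: k => [//|k IH]; exact: smooth_in_derive1 IH.
Qed.

Lemma smooth_in_is_derive bd F n x : smooth_in bd F ->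
  is_derive x (1 : R) (F n) ((F n)^`() x).
Proof.
by move=> sF; rewrite derive1E; apply: derivableP; exact: smooth_in_derivable sF.
Qed.

Lemma smooth_inW (bd bd' : (nat -> R -> R) -> Prop) F :
  (forall G, bd G -> bd' G) -> smooth_in bd F -> smooth_in bd' F.
Proof.
move=> bb [C CF cC]; exists C => // G /cC[bG dG]; split => //; exact: bb.
Qed.

Lemma smooth_inD (bd : (nat -> R -> R) -> Prop) F G :
  (forall F1 F2, bd F1 -> bd F2 -> bd (fun n x => F1 n x + F2 n x)) ->
  smooth_in bd F -> smooth_in bd G -> smooth_in bd (fun n x => F n x + G n x).
Proof.
move=> bdD sF sG.
exists (fun H => exists F1 F2, [/\ smooth_in bd F1, smooth_in bd F2 &
  H = fun n x => F1 n x + F2 n x]); first by exists F, G.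
move=> _ [F1 [F2 [s1 s2 ->]]]; split.
  by apply: bdD; exact: smooth_in_bd.
have [F1' s1' d1] := smooth_inP s1; have [F2' s2' d2] := smooth_inP s2.
exists (fun n x => F1' n x + F2' n x); first by exists F1', F2'.
move=> n x; have ? := d1 n x; have ? := d2 n x.
exact: is_deriveD.
Qed.

(** Products alone are not stable under derivation, since the Leibniz rule gives a sum of two
    products; their finite sums are. *)
Inductive sum_of_products (P Q : (nat -> R -> R) -> Prop) :
    (nat -> R -> R) -> Prop :=
| sum_of_products_mul F G : P F -> Q G ->
    sum_of_products P Q (fun n x => F n x * G n x)
| sum_of_products_add F G : sum_of_products P Q F -> sum_of_products P Q G ->
    sum_of_products P Q (fun n x => F n x + G n x).

Lemma is_derive_mul f g x df dg :
  is_derive x (1 : R) f df -> is_derive x (1 : R) g dg ->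
  is_derive x (1 : R) (fun y => f y * g y) (df * g x + f x * dg).
Proof.
move=> hf hg; have := is_deriveM hf hg.
by rewrite /GRing.scale /= addrC [g x * _]mulrC.
Qed.

Lemma smooth_inM (bd1 bd2 bd : (nat -> R -> R) -> Prop) F G :
  (forall F1 F2, bd F1 -> bd F2 -> bd (fun n x => F1 n x + F2 n x)) ->
  (forall F1 F2, bd1 F1 -> bd2 F2 -> bd (fun n x => F1 n x * F2 n x)) ->
  smooth_in bd1 F -> smooth_in bd2 G -> smooth_in bd (fun n x => F n x * G n x).
Proof.
move=> bdD bdM sF sG.
exists (sum_of_products (smooth_in bd1) (smooth_in bd2)).
  exact: sum_of_products_mul.
move=> H; elim => {F G H sF sG} [F G sF sG|F G _ [bF [F' cF dF]] _ [bG [G' cG dG]]].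
  split; first by apply: bdM; exact: smooth_in_bd.
  have [F' sF' dF] := smooth_inP sF; have [G' sG' dG] := smooth_inP sG.
  exists (fun n x => F' n x * G n x + F n x * G' n x).
    by apply: sum_of_products_add; exact: sum_of_products_mul.
  move=> n x; have ? := dF n x; have ? := dG n x.
  exact: is_derive_mul.
split; first exact: bdD.
exists (fun n x => F' n x + G' n x); first exact: sum_of_products_add.
move=> n x; have ? := dF n x; have ? := dG n x; exact: is_deriveD.
Qed.

Lemma onePnorm_ge1 (x : R) : 1 <= 1 + `|x|.
Proof. by rewrite lerDl. Qed.

Lemma onePnormX_gt0 (x : R) N : 0 < (1 + `|x|) ^+ N.
Proof. by rewrite exprn_gt0// (lt_le_trans _ (onePnorm_ge1 x)). Qed.

Lemma onePnormX_ge1 (x : R) N : 1 <= (1 + `|x|) ^+ N.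
Proof. by rewrite exprn_ege1// onePnorm_ge1. Qed.

Lemma rapidD w F G : rapid w F -> rapid w G -> rapid w (fun n x => F n x + G n x).
Proof.
move=> rF rG N; have [M1 h1] := rF N; have [M2 h2] := rG N.
exists (M1 + M2) => n x; rewrite mulrDl.
apply: le_trans (lerD (h1 n x) (h2 n x)).
by rewrite -mulrDl; apply: ler_wpM2r; [exact/ltW/onePnormX_gt0|exact: ler_normD].
Qed.

Lemma slow_pos w F : (forall n, 0 <= w n) -> slow w F ->
  exists a (M : R), 0 <= M /\ forall n x, `|F n x| <= M * w n * (1 + `|x|) ^+ a.
Proof.
move=> w0 [a [M h]]; exists a, `|M|; split => // n x.
apply: le_trans (h n x) _; apply: ler_wpM2r; first exact/ltW/onePnormX_gt0.
by rewrite ler_wpM2r// ler_norm.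
Qed.

Lemma slowD w F G : (forall n, 0 <= w n) ->
  slow w F -> slow w G -> slow w (fun n x => F n x + G n x).
Proof.
move=> w0 /(slow_pos w0)[a [M [M0 h]]] /(slow_pos w0)[b [K [K0 k]]].
exists (a + b)%N, (M + K) => n x.
apply: le_trans (ler_normD _ _) _; rewrite !mulrDl; apply: lerD.
  apply: le_trans (h n x) _; apply: ler_wpM2l; first exact: mulr_ge0.
  by rewrite exprD ler_peMr// ?onePnormX_ge1// ltW// onePnormX_gt0.
apply: le_trans (k n x) _; apply: ler_wpM2l; first exact: mulr_ge0.
by rewrite exprD ler_peMl// ?onePnormX_ge1// ltW// onePnormX_gt0.
Qed.

Lemma rapidM w w' F G : (forall n, 0 <= w n) -> (forall n, 0 <= w' n) ->
  rapid w F -> slow w' G -> rapid (fun n => w n * w' n) (fun n x => F n x * G n x).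
Proof.
move=> w0 w0' rF /(slow_pos w0')[a [M [M0 h]]] N.
(* The [a] additional powers of decay of [F] pay for the growth of [G]. *)
have [K k] := rF (N + a)%N; exists (K * M) => n x.
rewrite normrM mulrAC; apply: le_trans (ler_wpM2l _ (h n x)) _.
  by rewrite mulr_ge0// ltW// onePnormX_gt0.
have := k n x; rewrite exprD mulrA => {}k.
have -> : `|F n x| * (1 + `|x|) ^+ N * (M * w' n * (1 + `|x|) ^+ a) =
  (`|F n x| * (1 + `|x|) ^+ N * (1 + `|x|) ^+ a) * (M * w' n) by ring.
have -> : K * M * (w n * w' n) = K * w n * (M * w' n) by ring.
by apply: ler_wpM2r => //; rewrite mulr_ge0.
Qed.

Lemma slowM w w' F G : (forall n, 0 <= w n) -> (forall n, 0 <= w' n) ->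
  slow w F -> slow w' G -> slow (fun n => w n * w' n) (fun n x => F n x * G n x).
Proof.
move=> w0 w0' /(slow_pos w0)[a [M [M0 h]]] /(slow_pos w0')[b [K [K0 k]]].
exists (a + b)%N, (M * K) => n x.
rewrite normrM exprD; apply: le_trans (ler_pM _ _ (h n x) (k n x)) _ => //.
by rewrite le_eqVlt; apply/orP; left; apply/eqP; ring.
Qed.

Lemma rapid_slow w F : rapid w F -> slow w F.
Proof.
move=> /(_ 0)[M h]; exists 0, M => n x; have := h n x.
by rewrite !expr0 !mulr1.
Qed.

End smooth_families.

Notation unit_rate := (fun=> 1).
Definition inv_rate {R : realType} (n : nat) : R := n.+1%:R^-1.
(* Uniformly Schwartz families, and families with uniformly moderate growth;
   the rate w measures the size of the n-th member. *)
Notation rapidly w := (smooth_in (rapid w)).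
Notation slowly w := (smooth_in (slow w)).

Section smooth_families_closure.
Context {R : realType}.
Local Open Scope classical_set_scope.
Implicit Types (F G : nat -> R -> R) (f g : R -> R) (w : nat -> R).

Lemma rapidlyD w F G : rapidly w F -> rapidly w G ->
  rapidly w (fun n x => F n x + G n x).
Proof. by apply: smooth_inD => F1 F2; exact: rapidD. Qed.

Lemma rapidlyM w w' F G : (forall n, 0 <= w n) -> (forall n, 0 <= w' n) ->
  rapidly w F -> slowly w' G ->
  rapidly (fun n => w n * w' n) (fun n x => F n x * G n x).
Proof.
move=> w0 w0'; apply: smooth_inM => F1 F2; first exact: rapidD.
exact: rapidM.
Qed.

Lemma slowlyM w w' F G : (forall n, 0 <= w n) -> (forall n, 0 <= w' n) ->
  slowly w F -> slowly w' G ->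
  slowly (fun n => w n * w' n) (fun n x => F n x * G n x).
Proof.
move=> w0 w0'; apply: smooth_inM => [F1 F2|F1 F2].
  by apply: slowD => n; rewrite mulr_ge0.
exact: slowM.
Qed.

Lemma rapidly_slowly w F : rapidly w F -> slowly w F.
Proof. by apply: smooth_inW => G; exact: rapid_slow. Qed.

Let ones_ge0 (n : nat) : 0 <= unit_rate n :> R. Proof. by []. Qed.

Lemma rapidlyM1 w F G : (forall n, 0 <= w n) -> rapidly w F ->
  slowly unit_rate G -> rapidly w (fun n x => F n x * G n x).
Proof.
move=> w0 rF sG; have := rapidlyM w0 ones_ge0 rF sG.
by congr smooth_in; congr rapid; apply/funext => n; rewrite mulr1.
Qed.

Lemma slowlyM1 F G : slowly unit_rate F ->
  slowly unit_rate G -> slowly unit_rate (fun n x => F n x * G n x).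
Proof.
move=> rF sG; have := slowlyM ones_ge0 ones_ge0 rF sG.
by congr smooth_in; congr slow; apply/funext => n; rewrite mulr1.
Qed.

Lemma slowly_cst (c : R) : slowly unit_rate (fun _ _ => c).
Proof.
exists (fun F => exists c, F = fun _ _ => c); first by exists c.
move=> _ [{}c ->]; split.
  by exists 0, `|c| => n x; rewrite expr0 !mulr1.
exists (fun _ _ => 0); first by exists 0.
by move=> n x; exact: is_derive_cst.
Qed.

Lemma slowly_id : slowly unit_rate (fun _ (x : R) => x).
Proof.
(* Derivation leads from the identity to a constant, which is already known to be slow; hence the
   disjunction. *)
exists (fun F => F = (fun _ x => x) \/ slowly unit_rate F); first by left.
move=> F0 [->|sF0]; last first.
  split; first exact: smooth_in_bd sF0.
  by have [F' sF' dF] := smooth_inP sF0; exists F' => //; right.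
split; first by exists 1, 1 => n x; rewrite expr1 !mul1r lerDr.
exists (fun _ _ => 1); first by right; exact: slowly_cst.
by move=> n x; exact: is_derive_id.
Qed.

Lemma rapidlyZ w (c : R) F : (forall n, 0 <= w n) -> rapidly w F ->
  rapidly w (fun n x => c * F n x).
Proof.
move=> w0 rF; have := rapidlyM1 w0 rF (slowly_cst c).
by congr smooth_in; apply/funext => n; apply/funext => x; rewrite mulrC.
Qed.

End smooth_families_closure.

(** * A smooth bump *)

Section bump.
Context {R : realType}.
Local Open Scope classical_set_scope.
Implicit Types (p : {poly R}) (f g : R -> R) (w : nat -> R).

Lemma exprn_mul_expRN_le (y : R) n : 0 <= y -> y ^+ n * expR (- y) <= n`!%:R.
Proof.
move=> y0; rewrite expRN ler_pdivrMr ?expR_gt0//.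
case: n => [|n].
  by rewrite expr0 fact0 mul1r -expR0 ler_expR.
have := expR_ge1Dxn n y0.
rewrite -ler_pdivrMl ?ltr0n ?fact_gt0// => h.
by apply: le_trans h; rewrite mulrC lerDr.
Qed.

Lemma horner_mul_expRN_bounded p :
  exists M : R, forall y : R, 0 <= y -> `|p.[y] * expR (- y)| <= M.
Proof.
exists (\sum_(i < size p) `|p`_i| * i`!%:R) => y y0.
rewrite normrM (ger0_norm (expR_ge0 _)) horner_coef.
apply: le_trans (ler_wpM2r (expR_ge0 _) (ler_norm_sum _ _ _)) _.
rewrite mulr_suml; apply: ler_sum => i _.
rewrite normrM -mulrA (ger0_norm (exprn_ge0 _ y0)).
by rewrite ler_wpM2l// exprn_mul_expRN_le.
Qed.

(* The span of these functions is stable under derivation, because p.[1/x]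
   exp(-1/x) vanishes at 0+ to second order for every polynomial p. *)
Definition flat p (x : R) : R := if 0 < x then p.[x^-1] * expR (- x^-1) else 0.

Lemma flat_bounded p : exists M : R, forall x, `|flat p x| <= M.
Proof.
have [M hM] := horner_mul_expRN_bounded p; exists M => x.
rewrite /flat; case: ifPn => [x0|_]; first by apply: hM; rewrite invr_ge0 ltW.
by rewrite normr0 (le_trans _ (hM 0 _)).
Qed.

(** This is the boundedness of [flat ('X^2 * p)], whose additional factor is x^-2. It gives
    derivability at 0. *)
Lemma flat_quadratic p : exists M : R, forall x, `|flat p x| <= M * x ^+ 2.
Proof.
have [M hM] := flat_bounded ('X^2 * p); exists M => x; have := hM x.
rewrite /flat; case: ifPn => [x0|_].
  rewrite hornerM hornerXn -mulrA normrM.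
  have y0 : 0 <= x^-1 by rewrite invr_ge0 ltW.
  by rewrite [`|x^-1 ^+ 2|](ger0_norm (exprn_ge0 2 y0)) exprVn ler_pdivrMl ?exprn_gt0// [_ * M]mulrC.
by rewrite normr0 => M0; rewrite mulr_ge0 ?sqr_ge0.
Qed.

Lemma is_derive_quadratic f (M : R) : (forall x, `|f x| <= M * x ^+ 2) ->
  is_derive (0 : R) (1 : R) f 0.
Proof.
move=> fM.
have f0 : f 0 = 0.
  by apply/eqP; rewrite -normr_le0; have := fM 0; rewrite expr0n/= mulr0.
have M0 : 0 <= M by have := le_trans (normr_ge0 _) (fM 1); rewrite expr1n mulr1.
suff c : h^-1 *: (f (h *: 1 + 0) - f 0) @[h --> 0^'] --> (0 : R).
  apply: DeriveDef; last exact: cvg_lim c.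
  by apply/cvg_ex; exists 0.
rewrite f0; apply/cvgr0Pnorm_le => e e0.
near=> h.
have h0 : h != 0 by near: h; exact: nbhs_dnbhs_neq.
rewrite subr0 addr0 /GRing.scale/= mulr1 normrM normfV ler_pdivrMl ?normr_gt0//.
apply: le_trans (fM h) _.
rewrite -[h ^+ 2]real_normK ?num_real// expr2 mulrCA ler_wpM2l//.
(* [M] may be 0, and the next step divides by the constant. *)
apply: (@le_trans _ _ ((M + 1) * `|h|)); first by rewrite ler_wpM2r// lerDl.
rewrite -ler_pdivlMl ?ltr_wpDl//.
near: h; apply: dnbhs0_le; rewrite mulr_gt0// invr_gt0 ltr_wpDl//.
Unshelve. all: end_near. Qed.

Lemma is_derive_affine (a b x : R) : is_derive x (1 : R) (fun y => a * y + b) a.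
Proof.
have h := is_deriveD (is_deriveM (is_derive_cst a x 1) (is_derive_id x 1))
  (is_derive_cst b x 1).
apply: is_derive_eq h _.
by rewrite /GRing.scale/= mulr1 mulr0 !addr0.
Qed.

Lemma is_derive_comp_affine f (a b x df : R) : is_derive (a * x + b) (1 : R) f df ->
  is_derive x (1 : R) (fun y => f (a * y + b)) (a * df).
Proof.
move=> df'; rewrite mulrC.
exact: (@is_derive1_comp _ f (fun y => a * y + b) _ _ _ df' (is_derive_affine a b x)).
Qed.

(** In the variable y = 1/x the derivation d/dx is - y^2 d/dy, and it maps p(y) exp(-y) to y^2 (p -
    p')(y) exp(-y). *)
Lemma is_derive_flat p x :
  is_derive x (1 : R) (flat p) (flat ('X^2 * (p - deriv p)) x).
Proof.
have [x0|x0|->] := ltgtP x 0.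
- rewrite {2}/flat ltNge (ltW x0)/=.
  apply: (@near_eq_is_derive _ _ _ (cst 0)).
  near=> y; rewrite /flat ltNge (_ : y <= 0)//.
  by near: y; exact: lt_le_nbhsl.
- rewrite {2}/flat x0.
  have dV : is_derive x (1 : R) (fun y => y^-1) (- x ^- 2).
    have xn0 : id x != 0 by rewrite gt_eqF.
    apply: is_derive_eq (is_deriveV xn0 (is_derive_id x 1)) _.
    by rewrite /GRing.scale/= mulr1.
  have d1 : is_derive x (1 : R) (fun y => p.[y^-1]) ((deriv p).[x^-1] * - x ^- 2).
    exact: (@is_derive1_comp _ (horner p) _ _ _ _ (is_derive_poly p _) dV).
  have d2 : is_derive x (1 : R) (fun y => expR (- y^-1)) (expR (- x^-1) * x ^- 2).
    rewrite -[x ^- 2]opprK.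
    exact: (@is_derive1_comp _ expR _ _ _ _ (is_derive_expR _) (is_deriveN dV)).
  apply: near_eq_is_derive (is_derive_eq (is_derive_mul d1 d2) _).
    near=> y; rewrite /flat (_ : 0 < y)//.
    by near: y; exact: lt_nbhsr.
  rewrite hornerM hornerXn hornerD hornerN -exprVn; ring.
- rewrite {2}/flat ltxx; have [M hM] := flat_quadratic p.
  exact: is_derive_quadratic hM.
Unshelve. all: end_near. Qed.

Lemma slowly_flat p : slowly unit_rate (fun _ => flat p).
Proof.
exists (fun F => exists p, F = fun _ => flat p); first by exists p.
move=> _ [{}p ->]; split.
  have [M hM] := flat_bounded p.
  by exists 0, M => _ x; rewrite expr0 !mulr1.
exists (fun _ => flat ('X^2 * (p - deriv p))); first by eexists.
by move=> n x; exact: is_derive_flat.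
Qed.

Lemma slowly_comp_affine w F (a b : R) : (forall n, 0 <= w n) -> slowly w F ->
  slowly w (fun n x => F n (a * x + b)).
Proof.
move=> w0 sF.
exists (fun H => exists c G, slowly w G /\ H = fun n x => c * G n (a * x + b)).
  exists 1, F; split=> //.
  by apply/funext => n; apply/funext => x; rewrite mul1r.
move=> _ [c [G [sG ->]]]; split.
  have [k [M [M0 hM]]] := slow_pos w0 (smooth_in_bd sG).
  exists k, (`|c| * M * (1 + `|a| + `|b|) ^+ k) => n x.
  rewrite normrM; apply: le_trans (ler_wpM2l (normr_ge0 c) (hM n _)) _.
  rewrite [leRHS](_ : _ = `|c| * (M * w n * ((1 + `|a| + `|b|) ^+ k * (1 + `|x|) ^+ k))); last ring.
  rewrite ler_wpM2l// ler_wpM2l ?mulr_ge0// -exprMn.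
  apply: lerXn2r; rewrite ?nnegrE ?mulr_ge0 ?addr_ge0//.
  have := ler_normD (a * x) b; rewrite normrM.
  have := normr_ge0 a; have := normr_ge0 b; have := normr_ge0 x.
  nra.
have [G' sG' dG] := smooth_inP sG.
exists (fun n x => c * a * G' n (a * x + b)); first by exists (c * a), G'.
move=> n x.
have := is_derive_mul (is_derive_cst c x 1) (is_derive_comp_affine (dG n (a * x + b))).
by rewrite mul0r add0r mulrA.
Qed.

Lemma rapidly_support w F (r : R) : slowly w F -> (forall n, 0 <= w n) -> 0 <= r ->
  (forall n x, r < `|x| -> F n x = 0) -> rapidly w F.
Proof.
move=> sF w0 r0 F0.
exists (fun G => slowly w G /\ forall n x, r < `|x| -> G n x = 0) => // G [sG G0].
split=> [N|].
  have [k [M [M0 hM]]] := slow_pos w0 (smooth_in_bd sG).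
  exists (M * (1 + r) ^+ (k + N)) => n x.
  have [rx|xr] := ltP r `|x|.
    by rewrite G0// normr0 mul0r !mulr_ge0// exprn_ge0// addr_ge0.
  apply: le_trans (ler_wpM2r (ltW (onePnormX_gt0 _ _)) (hM n x)) _.
  rewrite -(mulrA (M * w n)) -exprD [leRHS]mulrAC ler_wpM2l ?mulr_ge0//.
  by apply: lerXn2r; rewrite ?nnegrE ?addr_ge0// lerD2l.
have [G' sG' dG] := smooth_inP sG.
exists G' => //; split => // n x rx.
(* The condition r < |x| is open, so [G n] vanishes in a neighbourhood of x. *)
have d0 : is_derive x (1 : R) (G n) 0.
  apply: (@near_eq_is_derive _ _ _ (cst 0)).
  near=> y; rewrite G0//; near: y.
  apply: (@cvgr_gt _ _ _ _ (fun y : R => `|y|) `|x|) => //.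
  exact: norm_continuous.
by case: (dG n x) => _ <-; case: d0.
Unshelve. all: end_near. Qed.

(** On ]-r, r[ this is exp(-2r / (r^2 - x^2)), the usual mollifier. The product form yields its
    smoothness from that of [flat]. *)
Definition bump (r x : R) : R := flat 1 (r + x) * flat 1 (r - x).

Lemma bump_even r x : bump r (- x) = bump r x.
Proof. by rewrite /bump opprK mulrC. Qed.

Lemma bump_ge0 r x : 0 <= bump r x.
Proof.
rewrite /bump /flat mulr_ge0//; case: ifP => // _;
by rewrite hornerC mul1r expR_ge0.
Qed.

Lemma bump_le r x : bump r x <= 1.
Proof.
suff h y : flat 1 y <= 1.
  rewrite /bump mulr_ile1// /flat; case: ifP => // _;
  by rewrite hornerC mul1r expR_ge0.
rewrite /flat; case: ifP => // y0; rewrite hornerC mul1r -expR0 ler_expR.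
by rewrite oppr_le0 invr_ge0 ltW.
Qed.

Lemma bump_gt0 r : 0 < r -> 0 < bump r 0.
Proof.
move=> r0; rewrite /bump /flat addr0 subr0 r0.
by rewrite mulr_gt0// hornerC mul1r expR_gt0.
Qed.

Lemma bump_support r x : r <= `|x| -> bump r x = 0.
Proof.
rewrite /bump /flat; have [x0|x0] := lerP 0 x => rx.
  by rewrite [0 < r - x]ltNge subr_le0 -(ger0_norm x0) rx/= mulr0.
by rewrite [0 < r + x]ltNge -lerBrDr sub0r -(ltr0_norm x0) rx mul0r.
Qed.

Lemma rapidly_bump r : 0 <= r -> rapidly unit_rate (fun _ => bump r).
Proof.
move=> r0; apply: (@rapidly_support _ _ r) => //; last first.
  by move=> _ x /ltW; exact: bump_support.
apply: slowlyM1.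
  have := slowly_comp_affine 1 r (fun=> ler01) (slowly_flat 1).
  by congr smooth_in; apply/funext => n; apply/funext => x; rewrite mul1r addrC.
have := slowly_comp_affine (-1) r (fun=> ler01) (slowly_flat 1).
by congr smooth_in; apply/funext => n; apply/funext => x; rewrite mulN1r addrC.
Qed.

Lemma rapidly_gauss : rapidly unit_rate (fun _ => @gauss_fun R).
Proof.
exists (fun F => exists p, F = fun _ x => p.[x] * gauss_fun x).
  by exists 1; apply/funext => _; apply/funext => x; rewrite hornerC mul1r.
move=> _ [p ->]; split.
  move=> N.
  (* In the variable y = x^2 one has 1 + |x| <= 2 + y, so the weight and every monomial of [p] are
     together bounded by this power of 2 + y. *)
  have [M hM] := horner_mul_expRN_bounded ((2%:P + 'X) ^+ (size p + N)).
  exists (\sum_(i < size p) `|p`_i| * M) => _ x; rewrite mulr1.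
  rewrite normrM -mulrA horner_coef.
  apply: le_trans (ler_wpM2r _ (ler_norm_sum _ _ _)) _.
    by rewrite mulr_ge0// ltW// onePnormX_gt0.
  rewrite mulr_suml; apply: ler_sum => i _.
  rewrite normrM -mulrA ler_wpM2l//.
  apply: le_trans (hM (x ^+ 2) (sqr_ge0 x)).
  rewrite horner_exp hornerD hornerC hornerX normrM [leLHS]mulrC -mulrA mulrC.
  rewrite /gauss_fun; apply: ler_wpM2r => //.
  have x1 : 1 + `|x| <= 2 + x ^+ 2.
    by rewrite -(real_normK (num_real x)); have := sqr_ge0 (`|x| - 1); nra.
  rewrite !normrX [`|2 + x ^+ 2|]ger0_norm ?addr_ge0 ?sqr_ge0// (exprD (2 + x ^+ 2)) mulrC; apply: ler_pM.
  - by rewrite exprn_ge0.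
  - by rewrite ltW// onePnormX_gt0.
  - apply: (@le_trans _ _ ((1 + `|x|) ^+ i)).
      by apply: lerXn2r; rewrite ?nnegrE ?addr_ge0// lerDr.
    apply: (@le_trans _ _ ((2 + x ^+ 2) ^+ i)).
      by apply: lerXn2r; rewrite ?nnegrE ?addr_ge0// sqr_ge0.
    apply: ler_weXn2l; last exact: ltnW.
    by apply: le_trans x1; rewrite lerDl.
  - by apply: lerXn2r; rewrite ?nnegrE ?addr_ge0 ?sqr_ge0.
exists (fun _ x => (deriv p - 'X * p *+ 2).[x] * gauss_fun x).
  by eexists.
move=> _ x.
have d2 : is_derive x (1 : R) (@gauss_fun R) (gauss_fun x * - (x *+ 2)).
  apply: (@is_derive1_comp _ expR (fun x => - x ^+ 2)).
  apply: is_deriveN.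
  apply: is_derive_eq (is_derive_mul (is_derive_id x 1) (is_derive_id x 1)) _.
  by rewrite mul1r mulr1.
apply: is_derive_eq (is_derive_mul (is_derive_poly p x) d2) _.
rewrite hornerD hornerN hornerMn hornerM hornerX; ring.
Qed.

End bump.

(** * Integration on the line *)

Section integrable_real_functions.
Context d (T : measurableType d) {R : realType}.
Local Open Scope classical_set_scope.
Variables (m : {measure set T -> \bar R}) (D : set T).
Hypothesis mD : measurable D.
Implicit Types f g : T -> R.

Lemma integrable_funD f g : m.-integrable D (EFin \o f) ->
  m.-integrable D (EFin \o g) ->
  m.-integrable D (EFin \o (fun x => f x + g x)).
Proof. by move=> itf itg; have := integrableD mD itf itg. Qed.

Lemma integrable_funB f g : m.-integrable D (EFin \o f) ->
  m.-integrable D (EFin \o g) ->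
  m.-integrable D (EFin \o (fun x => f x - g x)).
Proof. by move=> itf itg; have := integrableB mD itf itg. Qed.

Lemma integrable_funZ (c : R) f : m.-integrable D (EFin \o f) ->
  m.-integrable D (EFin \o (fun x => c * f x)).
Proof. by move=> itf; have := integrableZl mD c itf. Qed.

Lemma integrable_measurableR f : m.-integrable D (EFin \o f) ->
  measurable_fun D f.
Proof. by move=> itf; apply/measurable_EFinP; exact: measurable_int itf. Qed.

Lemma integrable_funM f g (M : R) : m.-integrable D (EFin \o f) ->
  measurable_fun D g -> (forall x, `|g x| <= M) ->
  m.-integrable D (EFin \o (fun x => f x * g x)).
Proof.
move=> itf mg gM.
have itf' := integrable_funZ M itf.
apply: (le_integrable mD _ _ itf').
  apply/measurable_EFinP; apply: measurable_funM => //.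
  exact: integrable_measurableR.
move=> x _ /=; rewrite lee_fin !normrM mulrC ler_wpM2r//.
exact: le_trans (gM x) (ler_norm _).
Qed.

Lemma Rintegral_eq0 f : (forall x, D x -> f x = 0) -> \int[m]_(x in D) f x = 0.
Proof. by move=> f0; rewrite /Rintegral integral0_eq// => x Dx; rewrite f0. Qed.

Lemma Rintegral_dominated_cvg (f_ : nat -> T -> R) f g :
  (forall n, measurable_fun D (f_ n)) ->
  (forall x, f_ ^~ x @ \oo --> f x) -> m.-integrable D (EFin \o g) ->
  (forall n x, `|f_ n x| <= g x) ->
  \int[m]_(x in D) f_ n x @[n --> \oo] --> \int[m]_(x in D) f x.
Proof.
move=> mf_ f_f ig f_g.
have mf : measurable_fun D f.
  by apply: (measurable_fun_cvg mf_) => x _; exact: f_f.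
have c : {ae m, forall x, D x -> (fun n => (f_ n x)%:E) @ \oo --> (f x)%:E}.
  by apply: aeW => x _; apply: cvg_EFin; [exact: nearW|exact: f_f].
have b : {ae m, forall x n, D x -> (`|(f_ n x)%:E| <= (EFin \o g) x)%E}.
  by apply: aeW => x n _; rewrite /= lee_fin.
have mfE n : measurable_fun D (fun x => (f_ n x)%:E) by exact/measurable_EFinP.
have mfE' : measurable_fun D (fun x => (f x)%:E) by exact/measurable_EFinP.
have [itf _ h] := dominated_convergence mD mfE mfE' c ig b.
apply: fine_cvg; rewrite fineK; last exact: integrable_fin_num.
exact: h.
Qed.

End integrable_real_functions.

Section integrals_of_real_functions.
Context {R : realType}.

Lemma integrable_finite_measure d (Y : measurableType d) (m : {measure set Y -> \bar R})
    (g : Y -> R) (M : R) : (m setT < +oo)%E -> measurable_fun setT g ->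
  (forall y, `|g y| <= M) -> m.-integrable setT (EFin \o g).
Proof.
move=> mfin mg gM.
apply: (@le_integrable _ _ _ _ setT measurableT _ (EFin \o cst M)).
- exact/measurable_EFinP.
- by move=> y _; rewrite /= lee_fin (le_trans (gM y))// ler_norm.
- apply/integrableP; split; first exact/measurable_EFinP.
  rewrite (eq_integral (cst `|M|%:E))//.
  by rewrite integral_cst//= lte_mul_pinfty.
Qed.

Lemma Rintegral_sum_finite d (Y : measurableType d) (m : {measure set Y -> \bar R})
    (I : Type) (s : seq I) (F : I -> Y -> R) :
  (forall i, m.-integrable setT (EFin \o F i)) ->
  m.-integrable setT (EFin \o (fun y => \sum_(i <- s) F i y)) /\
  \int[m]_y (\sum_(i <- s) F i y) = \sum_(i <- s) \int[m]_y F i y.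
Proof.
move=> iF; elim: s => [|i s [IH1 IH2]].
  under eq_fun do rewrite big_nil; rewrite big_nil; split.
    exact: integrable0.
  exact: Rintegral_eq0.
under eq_fun do rewrite big_cons; rewrite big_cons; split; first exact: integrable_funD.
by rewrite RintegralD// IH2.
Qed.

End integrals_of_real_functions.

Section Fubini_bounded_kernel.
Context d1 d2 (T1 : measurableType d1) (T2 : measurableType d2) {R : realType}.
Local Open Scope classical_set_scope.
Variables (m1 : {sigma_finite_measure set T1 -> \bar R})
  (m2 : {sigma_finite_measure set T2 -> \bar R}).
Variables (f : T1 -> R) (g : T2 -> R) (K : T1 -> T2 -> R) (M : R).
Hypotheses (itf : m1.-integrable setT (EFin \o f))
  (itg : m2.-integrable setT (EFin \o g)).
Hypotheses (mK : measurable_fun setT (fun z : T1 * T2 => K z.1 z.2))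
  (KM : forall x y, `|K x y| <= M).

Let h (z : T1 * T2) := f z.1 * (g z.2 * K z.1 z.2).

Let mf : measurable_fun setT f. Proof. exact: integrable_measurableR itf. Qed.
Let mg : measurable_fun setT g. Proof. exact: integrable_measurableR itg. Qed.

Let mKx x : measurable_fun setT (K x).
Proof. exact: measurableT_comp mK (pair1_measurable x). Qed.

Let mKy y : measurable_fun setT (K ^~ y).
Proof. exact: measurableT_comp mK (pair2_measurable y). Qed.

Let iKx x : m2.-integrable setT (EFin \o (fun y => g y * K x y)).
Proof. exact: integrable_funM. Qed.

Let iKy y : m1.-integrable setT (EFin \o (fun x => f x * K x y)).
Proof. exact: integrable_funM. Qed.

Let mh : measurable_fun setT (EFin \o h).
Proof.
apply/measurable_EFinP; apply: measurable_funM.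
  exact: measurableT_comp mf measurable_fst.
by apply: measurable_funM => //; exact: measurableT_comp mg measurable_snd.
Qed.

Lemma integrable_prod_kernel : (m1 \x m2)%E.-integrable setT (EFin \o h).
Proof.
have [_ H] := integrable12ltyP m1 m2 mh; apply: H.
have [_ ltf] := integrableP _ _ _ itf.
have [_ ltg] := integrableP _ _ _ itg.
apply: (@le_lt_trans _ _ (\int[m1]_x (`|(f x)%:E| *
    (`|M|%:E * \int[m2]_y `|(g y)%:E|)))%E).
  apply: ge0_le_integral => //.
  - by move=> x _; exact: integral_ge0.
  - apply: (measurable_fun_fubini_tonelli_F (abse \o (EFin \o h))) => //.
      exact: measurableT_comp.
    by move=> z /=.
  - apply: emeasurable_funM => //; apply: measurableT_comp => //.
    exact/measurable_EFinP.
  move=> x _; rewrite -!ge0_integralZl//; first last.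
  - by apply: measurableT_comp => //; exact/measurable_EFinP.
  - by apply: measurable_funeM; apply: measurableT_comp => //; exact/measurable_EFinP.
  apply: ge0_le_integral => //.
  - apply: measurableT_comp => //.
    exact: (measurableT_comp mh (pair1_measurable x)).
  - do 2 apply: measurable_funeM.
    by apply: measurableT_comp => //; exact/measurable_EFinP.
  move=> y _; rewrite /h/= lee_fin !normrM ler_wpM2l// mulrC ler_wpM2r//.
  exact: le_trans (KM x y) (ler_norm _).
rewrite ge0_integralZr//; last 2 first.
- by apply: measurableT_comp => //; exact/measurable_EFinP.
- by rewrite mule_ge0 ?integral_ge0.
by rewrite lte_mul_pinfty ?integral_ge0// ?ge0_fin_numE ?integral_ge0// lte_mul_pinfty.
Qed.

Lemma Rintegral_prod_kernel1 :
  \int[(m1 \x m2)%E]_z h z = \int[m1]_x (f x * \int[m2]_y (g y * K x y)).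
Proof.
rewrite /Rintegral -(integral12_prod_meas1 integrable_prod_kernel).
congr fine; apply: eq_integral => x _.
rewrite /fubini_F/= [RHS]EFinM fineK; last exact: (integrable_fin_num measurableT (iKx x)).
by rewrite -(integralZl measurableT (iKx x)).
Qed.

Lemma Rintegral_prod_kernel2 :
  \int[(m1 \x m2)%E]_z h z = \int[m2]_y (g y * \int[m1]_x (f x * K x y)).
Proof.
rewrite /Rintegral -(integral21_prod_meas1 integrable_prod_kernel).
congr fine; apply: eq_integral => y _.
rewrite /fubini_G/= [RHS]EFinM fineK; last exact: (integrable_fin_num measurableT (iKy y)).
rewrite -(integralZl measurableT (iKy y)); apply: eq_integral => x _.
by rewrite /h/= -EFinM mulrCA.
Qed.

Lemma Rintegral_kernel_swap :
  \int[m1]_x (f x * \int[m2]_y (g y * K x y)) =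
  \int[m2]_y (g y * \int[m1]_x (f x * K x y)).
Proof. by rewrite -Rintegral_prod_kernel1 Rintegral_prod_kernel2. Qed.

End Fubini_bounded_kernel.

Section integrals_on_the_line.
Context {R : realType}.
Local Open Scope classical_set_scope.
Local Notation mu := (@lebesgue_measure R).
Implicit Types (f g : R -> R) (w : nat -> R).

Lemma continuous_measurableR f : continuous f -> measurable_fun setT f.
Proof. exact: continuous_measurable_fun. Qed.

(** The function 1 / (1 + x^2) dominates every rapidly decreasing family, with a constant
    proportional to the rate. *)
Lemma integrable_oneDsqrV : mu.-integrable setT (EFin \o (fun x : R => (1 + x ^+ 2)^-1)).
Proof.
have ge0 (x : R) : 0 <= (1 + x ^+ 2)^-1 by rewrite invr_ge0 addr_ge0 ?sqr_ge0.
have cV := @continuous_oneDsqrV R.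
apply/integrableP; split.
  by apply/measurable_EFinP; exact: continuous_measurableR cV.
under eq_integral do rewrite /= ger0_norm//.
rewrite ge0_symfun_integralT//; last by move=> x /=; rewrite sqrrN.
rewrite (_ : [set x | _] = `[0, +oo[%classic); last first.
  by apply/seteqP; split => x/=; rewrite in_itv/= andbT.
by rewrite (@integral0y_oneDsqr R) -EFinM ltry.
Qed.

Lemma integrable_dominated f g : continuous f ->
  mu.-integrable setT (EFin \o g) -> (forall x, `|f x| <= g x) ->
  mu.-integrable setT (EFin \o f).
Proof.
move=> cf ig fg; apply: le_integrable ig => //.
  by apply/measurable_EFinP; exact: continuous_measurableR.
by move=> x _ /=; rewrite lee_fin (le_trans (fg x))// ler_norm.
Qed.

Lemma rapid_oneDsqrV w F : (forall n, 0 <= w n) -> rapid w F ->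
  exists M : R, 0 <= M /\ forall n x, `|F n x| <= M * w n * (1 + x ^+ 2)^-1.
Proof.
move=> w0 /(_ 2)[M hM]; exists `|M|; split => // n x.
rewrite ler_pdivlMr ?ltr_wpDr ?sqr_ge0//.
apply: (@le_trans _ _ (M * w n)); last by rewrite ler_wpM2r// ler_norm.
apply: le_trans (hM n x); rewrite ler_wpM2l//.
by rewrite -(real_normK (num_real x)); have := normr_ge0 x; nra.
Qed.

Lemma rapidly_integrable w F n : (forall n, 0 <= w n) -> rapidly w F ->
  mu.-integrable setT (EFin \o F n).
Proof.
move=> w0 rF; have [M [M0 hM]] := rapid_oneDsqrV w0 (smooth_in_bd rF).
apply: (@integrable_dominated _ (fun x => M * w n * (1 + x ^+ 2)^-1)).
- exact: smooth_in_continuous rF.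
- rewrite (_ : _ \o _ = fun x => (M * w n)%:E * ((1 + x ^+ 2)^-1)%:E)%E.
    by apply: integrableZl => //; exact: integrable_oneDsqrV.
  by apply/funext => x /=; rewrite EFinM.
- exact: hM.
Qed.

(** In f = (f + |f|) - |f| both terms are nonnegative and still continuous, so a change of variable
    known for such functions extends to integrable ones. It serves for affine maps and for the
    reflection. *)
Lemma ge0_transport_integral (T : R -> R) (a : R) : 0 <= a -> continuous T ->
  (forall g, continuous g -> (forall x, 0 <= g x) ->
    (\int[mu]_x (g (T x))%:E = a%:E * \int[mu]_x (g x)%:E)%E) ->
  forall f, continuous f -> mu.-integrable setT (EFin \o f) ->
    mu.-integrable setT (EFin \o (f \o T)) /\
    \int[mu]_x (f (T x)) = a * \int[mu]_x (f x).
Proof.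
move=> a0 cT h f cf itf.
have itn : mu.-integrable setT (EFin \o (fun x => `|f x|)).
  exact: integrable_norm.
have cn : continuous (fun x => `|f x|).
  by move=> x; apply: continuous_comp (cf x) _; exact: norm_continuous.
have cTf g : continuous g -> continuous (g \o T).
  by move=> cg x; exact: continuous_comp (cT x) (cg _).
have itT g : continuous g -> (forall x, 0 <= g x) ->
    mu.-integrable setT (EFin \o g) ->
    mu.-integrable setT (EFin \o (g \o T)) /\
    \int[mu]_x (g (T x)) = a * \int[mu]_x (g x).
  move=> cg g0 ig; have fi : (\int[mu]_x (g x)%:E \is a fin_num)%E.
    exact: integrable_fin_num.
  split; last by rewrite /Rintegral h// fineM.
  apply/integrableP; split.
    by apply/measurable_EFinP; exact: continuous_measurableR (cTf _ cg).
  under eq_integral do rewrite /= ger0_norm//.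
  by rewrite h// -(fineK fi) -EFinM ltry.
have fD : f = fun x => (f x + `|f x|) - `|f x| by apply/funext => x; rewrite addrK.
have c1 : continuous (fun x => f x + `|f x|).
  by move=> x; apply: cvgD; [exact: cf|exact: cn].
have i1 : mu.-integrable setT (EFin \o (fun x => f x + `|f x|)).
  exact: integrable_funD.
have [i1T e1] := itT _ c1 (fun x => ltac:(rewrite -lerBlDr sub0r; exact: lerNnormlW (lexx _))) i1.
have [inT en] := itT _ cn (fun x => normr_ge0 _) itn.
split.
  by rewrite fD; exact: integrable_funB.
rewrite {1}fD RintegralB// e1 en -mulrBr -RintegralB//.
by congr (_ * _); apply: eq_Rintegral => x _; rewrite addrK.
Qed.

Lemma ge0_integral_affine (a b : R) g : 0 < a -> continuous g ->
  (forall x, 0 <= g x) ->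
  (\int[mu]_x (g (a * x + b))%:E = a^-1%:E * \int[mu]_x (g x)%:E)%E.
Proof.
move=> a0 cg g0.
have dF x := is_derive_affine a b x.
have F' : (fun x : R => a * x + b)^`() = cst a by exact: is_derive_derive1.
rewrite [in RHS](@increasing_ge0_integration_by_substitutionT _ (fun x => a * x + b) g)//.
- rewrite F' -ge0_integralZl//.
  + by apply: eq_integral => x _; rewrite -EFinM /= mulrCA mulVf ?gt_eqF// mulr1.
  + apply/measurable_EFinP; apply: continuous_measurableR => x.
    apply: cvgM; last exact: cvg_cst.
    apply: (continuous_comp (f := fun x => a * x + b)); last exact: cg.
    by apply: cvgD; [apply: cvgMr; exact: cvg_id|exact: cvg_cst].
  + by move=> x _; rewrite lee_fin; apply: mulr_ge0; [exact: g0|exact: ltW].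
  + by rewrite lee_fin invr_ge0 ltW.
- by move=> x y xy; rewrite ltrD2r ltr_pM2l.
- by rewrite F' => x; exact: cvg_cst.
- by rewrite F'; exact: is_cvg_cst.
- by rewrite F'; exact: is_cvg_cst.
- apply/cvgrNyPle => A; near=> x.
  have : x <= (A - b) / a by near: x; exact/nbhs_ninfty_le/num_real.
  by rewrite ler_pdivlMr// mulrC lerBrDr.
- apply/cvgryPge => A; near=> x.
  have : (A - b) / a <= x by near: x; exact/nbhs_pinfty_ge/num_real.
  by rewrite ler_pdivrMr// mulrC lerBlDr.
Unshelve. all: end_near. Qed.

Lemma Rintegral_affine (a b : R) f : 0 < a -> continuous f ->
  mu.-integrable setT (EFin \o f) ->
  mu.-integrable setT (EFin \o (fun x => f (a * x + b))) /\
  \int[mu]_x f (a * x + b) = a^-1 * \int[mu]_x f x.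
Proof.
move=> a0 cf itf.
apply: (@ge0_transport_integral (fun x => a * x + b) a^-1) => //.
- by rewrite invr_ge0 ltW.
- move=> x; apply: cvgD; last exact: cvg_cst.
  by apply: cvgMr; exact: cvg_id.
- by move=> g cg g0; exact: ge0_integral_affine.
Qed.

Lemma ge0_integral_reflect g : continuous g -> (forall x, 0 <= g x) ->
  (\int[mu]_x (g (- x))%:E = \int[mu]_x (g x)%:E)%E.
Proof.
move=> cg g0.
have half f : continuous f -> (forall x, 0 <= f x) ->
    (\int[mu]_(x in `]-oo, 0%R]) (f x)%:E = \int[mu]_(x in `[0%R, +oo[) (f (- x))%:E)%E.
  move=> cf f0; rewrite -{1}oppr0 ge0_integration_by_substitutionNy//.
  exact: continuous_subspaceT.
have split0 f : continuous f -> (forall x, 0 <= f x) -> (\int[mu]_x (f x)%:E =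
    \int[mu]_(x in `]-oo, 0%R]) (f x)%:E + \int[mu]_(x in `[0%R, +oo[) (f x)%:E)%E.
  move=> cf f0; have mf := continuous_measurableR cf.
  rewrite -{1}setC0 -(set_itvoc0 0%R) setCitv/= ge0_integral_setU//=; first last.
  - rewrite disj_set2E; apply/eqP; rewrite -subset0 => x []/= /[!in_itv]/=.
    by rewrite leNgt andbT => /negP.
  - by move=> x _; rewrite lee_fin.
  - by apply/measurable_EFinP; rewrite -setCitvr setvU.
  congr (_ + _)%E; rewrite integral_itv_obnd_cbnd//.
  by apply/measurable_EFinP; exact: measurable_funTS.
have cgN : continuous (g \o -%R).
  by move=> x; apply: continuous_comp (cg _); exact: opp_continuous.
rewrite (split0 (fun x => g (- x)) cgN)// (split0 g)// (half (fun x => g (- x)) cgN)// (half g)// addeC.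
by congr (_ + _)%E; apply: eq_integral => x _ /=; rewrite opprK.
Qed.

Lemma Rintegral_reflect f : continuous f -> mu.-integrable setT (EFin \o f) ->
  \int[mu]_x f (- x) = \int[mu]_x f x.
Proof.
move=> cf itf; rewrite -[RHS]mul1r.
apply: (proj2 (@ge0_transport_integral -%R 1 _ _ _ f cf itf)) => //.
  by move=> x; exact: opp_continuous.
by move=> g cg g0; rewrite mul1e ge0_integral_reflect.
Qed.

Lemma Rintegral_odd f : continuous f -> mu.-integrable setT (EFin \o f) ->
  (forall x, f (- x) = - f x) -> \int[mu]_x f x = 0.
Proof.
move=> cf itf oddf; have := Rintegral_reflect cf itf.
under eq_Rintegral do rewrite oddf -mulN1r.
rewrite RintegralZl// mulN1r; lra.
Qed.

Lemma is_derive_Rintegral (K K' : R -> R -> R) (g : R -> R) x :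
  (forall y, mu.-integrable setT (EFin \o K y)) ->
  (forall y t, is_derive y (1 : R) (fun y => K y t) (K' y t)) ->
  mu.-integrable setT (EFin \o g) ->
  (forall y t, `|y - x| < 1 -> `|K' y t| <= g t) ->
  is_derive x (1 : R) (fun y => \int[mu]_t K y t) (\int[mu]_t K' x t).
Proof.
move=> iK dK ig K'g.
have Ix : `]x - 1, x + 1[%classic x by rewrite /= in_itv/= ltrBlDr ltrDl ltr01.
have d1 y t : partial1of2 K y t = K' y t.
  by rewrite /partial1of2 derive1E; case: (dK y t).
have g0 t : 0 <= g t by apply: le_trans (K'g x t _) => //; rewrite subrr normr0.
have bd y t : `]x - 1, x + 1[%classic y -> setT t -> `|partial1of2 K y t| <= g t.
  rewrite /= in_itv/= => /andP[xy yx] _; rewrite d1 K'g// ltr_norml; lra.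
have dr y t : `]x - 1, x + 1[%classic y -> setT t -> derivable (K ^~ t) y 1.
  by move=> _ _; case: (dK y t).
apply: DeriveDef.
  exact: (@derivable_under_integral _ _ _ mu K setT measurableT x _ _ Ix _ dr g).
rewrite -derive1E.
rewrite (@differentiation_under_integral _ _ _ mu K setT measurableT x _ _ Ix _ dr g)//.
by apply: eq_Rintegral => t _; rewrite d1.
Qed.

Lemma onePnorm_submul (x y : R) : 1 + `|x + y| <= (1 + `|x|) * (1 + `|y|).
Proof.
have := ler_normD x y; have := normr_ge0 x; have := normr_ge0 y; nra.
Qed.

(** Peetre's inequality. It distributes a polynomial weight over the two factors of a
    correlation. *)
Lemma onePnorm_submulX (x t : R) N :
  (1 + `|x|) ^+ N <= (1 + `|x + t|) ^+ N * (1 + `|t|) ^+ N.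
Proof.
rewrite -exprMn; apply: lerXn2r; rewrite ?nnegrE ?mulr_ge0 ?addr_ge0//.
by have := onePnorm_submul (x + t) (- t); rewrite addrK normrN.
Qed.

(** A domination that is locally uniform in the translation [y], as required to differentiate an
    integral with respect to [y]. *)
Lemma rapid_translate w F : (forall n, 0 <= w n) -> rapid w F ->
  forall r : R, 0 <= r -> exists M : R, forall n y t, `|y| <= r ->
    `|F n (t + y)| <= M * w n * (1 + t ^+ 2)^-1.
Proof.
move=> w0 /(_ 2)[M hM] r r0; exists (`|M| * (1 + r) ^+ 2) => n y t yr.
rewrite ler_pdivlMr ?ltr_wpDr ?sqr_ge0//.
have h1 : 1 + t ^+ 2 <= (1 + `|t|) ^+ 2.
  by rewrite -(real_normK (num_real t)); have := normr_ge0 t; nra.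
have h2 := onePnorm_submulX t y 2.
have h3 : (1 + `|y|) ^+ 2 <= (1 + r) ^+ 2.
  by apply: lerXn2r; rewrite ?nnegrE ?addr_ge0// lerD2l.
apply: le_trans (ler_wpM2l (normr_ge0 _) (le_trans h1 h2)) _.
rewrite mulrA; apply: le_trans (ler_wpM2r (exprn_ge0 _ _) (hM n _)) _.
  by rewrite addr_ge0.
apply: (@le_trans _ _ (`|M| * w n * (1 + `|y|) ^+ 2)).
  by rewrite ler_wpM2r ?exprn_ge0 ?addr_ge0// ler_wpM2r// ler_norm.
by rewrite [leRHS]mulrAC ler_wpM2l ?mulr_ge0.
Qed.

Lemma integrable_oneDsqrV_scale (M : R) :
  mu.-integrable setT (EFin \o (fun x : R => M * (1 + x ^+ 2)^-1)).
Proof.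
rewrite (_ : _ \o _ = fun x => (M%:E * ((1 + x ^+ 2)^-1)%:E)%E).
  by apply: integrableZl => //; exact: integrable_oneDsqrV.
by apply/funext => x /=; rewrite EFinM.
Qed.

(* The integral of F n (t + y) over t does not depend on y; differentiate. *)
Lemma Rintegral_derive1 w F n : (forall n, 0 <= w n) -> rapidly w F ->
  \int[mu]_x (derive1 (F n) x) = 0.
Proof.
move=> w0 rF.
have rF' := smooth_in_derive1 rF.
have sft a : mu.-integrable setT (EFin \o (fun x => F n (1 * x + a))) /\
    \int[mu]_x F n (1 * x + a) = \int[mu]_x F n x.
  have [h1 h2] := @Rintegral_affine 1 a (F n) ltr01
    (smooth_in_continuous (n := n) rF) (rapidly_integrable n w0 rF).
  by split => //; rewrite h2 invr1 mul1r.
have [M hM] := rapid_translate w0 (smooth_in_bd rF') ler01.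
have := @is_derive_Rintegral (fun y t => F n (1 * t + y))
  (fun y t => derive1 (F n) (1 * t + y)) _ 0 (fun y => (sft y).1) _
  (integrable_oneDsqrV_scale (M * w n)) _.
rewrite (_ : (fun y => _) = cst (\int[mu]_x F n x)); last first.
  by apply/funext => y; rewrite (sft y).2.
move=> h; have [||_] := h _ _.
- move=> y t; have := is_derive_comp_affine (a := 1) (b := 1 * t) (smooth_in_is_derive n (1 * y + 1 * t) rF).
  rewrite mul1r addrC (_ : (fun y => _) = (fun y => F n (1 * t + y)))//.
    by rewrite !mul1r.
  by apply/funext => z; rewrite !mul1r addrC.
- by move=> y t; rewrite subr0 mul1r => /ltW; exact: hM.
- rewrite derive_cst => e; rewrite [RHS]e.
  by apply: eq_Rintegral => t _; rewrite mul1r addr0.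
Qed.

End integrals_on_the_line.

(** * The cosine transform *)

Section cosine_transform.
Context {R : realType}.
Local Open Scope classical_set_scope.
Local Notation mu := (@lebesgue_measure R).
Implicit Types (f g u : R -> R).

Definition schwartzR f : Prop := rapidly unit_rate (fun _ => f).

(* Only even functions are transformed, so that the Fourier transform is costr. *)
Definition costr f (x : R) : R := \int[mu]_k (f k * cos (k * x)).
Definition sintr f (x : R) : R := \int[mu]_k (f k * sin (k * x)).

Let one_ge0 (n : nat) : 0 <= unit_rate n :> R. Proof. by []. Qed.

Lemma schwartzR_continuous f : schwartzR f -> continuous f.
Proof. by move=> sf; exact: (smooth_in_continuous (n := 0) sf). Qed.

Lemma rapidly_schwartzR (F : nat -> R -> R) m : rapidly unit_rate F -> schwartzR (F m).
Proof.
case=> C CF hC; exists (fun G => exists2 H, C H & G = fun=> H m); first by exists F.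
move=> _ [H /hC[rH [H' CH' dH]] ->]; split.
  by move=> N; have [M hM] := rH N; exists M => _ x; exact: hM.
by exists (fun=> H' m); [exists H'|move=> _ x; exact: dH].
Qed.

Lemma schwartzR_measurable f : schwartzR f -> measurable_fun setT f.
Proof. by move=> sf; apply: continuous_measurableR; exact: schwartzR_continuous. Qed.

Lemma schwartzR_integrable f : schwartzR f -> mu.-integrable setT (EFin \o f).
Proof. by move=> sf; exact: (rapidly_integrable 0 one_ge0 sf). Qed.

Lemma schwartzR_derive1 f : schwartzR f -> schwartzR (derive1 f).
Proof. exact: smooth_in_derive1. Qed.

Lemma schwartzR_is_derive f x : schwartzR f -> is_derive x (1 : R) f (derive1 f x).
Proof. exact: (smooth_in_is_derive 0). Qed.

Lemma schwartzRD f g : schwartzR f -> schwartzR g -> schwartzR (fun x => f x + g x).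
Proof. exact: rapidlyD. Qed.

Lemma schwartzRZ (c : R) f : schwartzR f -> schwartzR (fun x => c * f x).
Proof. exact: rapidlyZ. Qed.

Lemma schwartzRN f : schwartzR f -> schwartzR (fun x => - f x).
Proof.
move=> /(schwartzRZ (-1)); congr (schwartzR _).
by apply/funext => x; rewrite mulN1r.
Qed.

Lemma schwartzRM f g : schwartzR f -> schwartzR g -> schwartzR (fun x => f x * g x).
Proof. by move=> sf sg; apply: rapidlyM1 => //; exact: rapidly_slowly. Qed.

Lemma schwartzR_mulid f : schwartzR f -> schwartzR (fun x => x * f x).
Proof.
move=> sf; have := rapidlyM1 one_ge0 sf slowly_id.
by congr smooth_in; apply/funext => _; apply/funext => x; rewrite mulrC.
Qed.

Lemma continuous_cosM (x : R) : continuous (fun k : R => cos (k * x)).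
Proof.
move=> k; apply: (continuous_comp (f := fun k : R => k * x)).
  by apply: cvgMl; exact: cvg_id.
exact: continuous_cos.
Qed.

Lemma continuous_sinM (x : R) : continuous (fun k : R => sin (k * x)).
Proof.
move=> k; apply: (continuous_comp (f := fun k : R => k * x)).
  by apply: cvgMl; exact: cvg_id.
exact: continuous_sin.
Qed.

Lemma norm_cos_le1 (x : R) : `|cos x| <= 1.
Proof. by rewrite ler_norml cos_geN1 cos_le1. Qed.

Lemma norm_sin_le1 (x : R) : `|sin x| <= 1.
Proof. by rewrite ler_norml sin_geN1 sin_le1. Qed.

Lemma integrable_cosM f x : mu.-integrable setT (EFin \o f) ->
  mu.-integrable setT (EFin \o (fun k => f k * cos (k * x))).
Proof.
move=> itf; apply: (integrable_funM (M := 1) measurableT itf).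
  exact: continuous_measurableR (@continuous_cosM x).
by move=> k; exact: norm_cos_le1.
Qed.

Lemma integrable_sinM f x : mu.-integrable setT (EFin \o f) ->
  mu.-integrable setT (EFin \o (fun k => f k * sin (k * x))).
Proof.
move=> itf; apply: (integrable_funM (M := 1) measurableT itf).
  exact: continuous_measurableR (@continuous_sinM x).
by move=> k; exact: norm_sin_le1.
Qed.

Lemma is_derive_cosM (k x : R) :
  is_derive x (1 : R) (fun x => cos (k * x)) (- (k * sin (k * x))).
Proof.
have h := is_derive_comp_affine (a := k) (b := 0) (is_derive_cos (k * x + 0)).
rewrite addr0 in h; rewrite (_ : (fun y => _) = (fun y => cos (k * y + 0))).
  by rewrite -mulrN.
by apply/funext => y; rewrite addr0.
Qed.

Lemma is_derive_sinM (k x : R) :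
  is_derive x (1 : R) (fun x => sin (k * x)) (k * cos (k * x)).
Proof.
have h := is_derive_comp_affine (a := k) (b := 0) (is_derive_sin (k * x + 0)).
rewrite addr0 in h; rewrite (_ : (fun y => _) = (fun y => sin (k * y + 0)))//.
by apply/funext => y; rewrite addr0.
Qed.

Lemma is_derive_costr f x : schwartzR f ->
  is_derive x (1 : R) (costr f) (- sintr (fun k => k * f k) x).
Proof.
move=> sf; have skf := schwartzR_mulid sf.
rewrite -mulN1r -RintegralZl//; last exact/integrable_sinM/schwartzR_integrable.
apply: (@is_derive_Rintegral _ (fun x k => f k * cos (k * x))
    (fun x k => -1 * (k * f k * sin (k * x))) (fun k => `|k * f k|)).
- by move=> y; exact/integrable_cosM/schwartzR_integrable.
- move=> y k; have := is_derive_mul (is_derive_cst (f k) y 1) (is_derive_cosM k y).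
  by rewrite mul0r add0r mulrN mulrA [f k * k]mulrC mulN1r.
- by apply: integrable_norm; exact: schwartzR_integrable.
- by move=> y k _; rewrite mulN1r normrN normrM ler_piMr// norm_sin_le1.
Qed.

Lemma is_derive_sintr f x : schwartzR f ->
  is_derive x (1 : R) (sintr f) (costr (fun k => k * f k) x).
Proof.
move=> sf; have skf := schwartzR_mulid sf.
apply: (@is_derive_Rintegral _ (fun x k => f k * sin (k * x))
    (fun x k => k * f k * cos (k * x)) (fun k => `|k * f k|)).
- by move=> y; exact/integrable_sinM/schwartzR_integrable.
- move=> y k; have := is_derive_mul (is_derive_cst (f k) y 1) (is_derive_sinM k y).
  by rewrite mul0r add0r mulrA [f k * k]mulrC.
- by apply: integrable_norm; exact: schwartzR_integrable.
- by move=> y k _; rewrite normrM ler_piMr// norm_cos_le1.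
Qed.

Lemma slowly_cosM (x : R) : slowly unit_rate (fun _ k => cos (k * x)).
Proof.
exists (fun F => exists c (b : bool), F = fun _ k => c * (if b then cos (k * x) else sin (k * x))).
  by exists 1, true; apply/funext => _; apply/funext => k; rewrite mul1r.
move=> _ [c [b ->]]; split.
  exists 0, `|c| => _ k; rewrite expr0 !mulr1 normrM ler_piMr//.
  by case: b; [exact: norm_cos_le1|exact: norm_sin_le1].
exists (fun _ k => (if b then - c * x else c * x) * (if ~~ b then cos (k * x) else sin (k * x))).
  by eexists; exists (~~ b).
move=> _ k; case: b => /=.
  have := is_derive_mul (is_derive_cst c k 1) (is_derive_cosM x k).
  rewrite mul0r add0r mulrN mulrA !mulNr [x * k]mulrC.
  by under eq_fun do rewrite [x * _]mulrC.
have := is_derive_mul (is_derive_cst c k 1) (is_derive_sinM x k).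
rewrite mul0r add0r mulrA [x * k]mulrC.
by under eq_fun do rewrite [x * _]mulrC.
Qed.

(** For x nonzero, sin(k x) is -1/x times the derivative in k of cos(k x), so the stability of slow
    families under derivation applies. *)
Lemma slowly_sinM (x : R) : slowly unit_rate (fun _ k => sin (k * x)).
Proof.
have [->|x0] := eqVneq x 0.
  have := slowly_cst (0 : R); congr smooth_in; apply/funext => _; apply/funext => k.
  by rewrite mulr0 sin0.
have := slowlyM1 (slowly_cst (- x^-1)) (smooth_in_derive1 (slowly_cosM x)).
congr smooth_in; apply/funext => _; apply/funext => k /=.
have h := is_derive_cosM x k.
rewrite derive1E (_ : (fun y => _) = (fun y => cos (x * y))); last first.
  by apply/funext => y; rewrite mulrC.
by case: h => _ ->; rewrite mulrNN mulrA mulVf// mul1r mulrC.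
Qed.

Lemma Rintegral_derive_schwartz f f' : schwartzR f ->
  (forall x, is_derive x (1 : R) f (f' x)) -> \int[mu]_x f' x = 0.
Proof.
move=> sf df; rewrite -(is_derive_derive1 df).
exact: (Rintegral_derive1 0 one_ge0 sf).
Qed.

(** Integration by parts: the derivative in k of f(k) sin(k x) has integral 0. *)
Lemma mul_costr f x : schwartzR f -> x * costr f x = - sintr (derive1 f) x.
Proof.
move=> sf; have sf' := schwartzR_derive1 sf.
have s : schwartzR (fun k => f k * sin (k * x)).
  by apply: rapidlyM1 => //; exact: slowly_sinM.
have d k : is_derive k (1 : R) (fun k => f k * sin (k * x))
    (derive1 f k * sin (k * x) + x * (f k * cos (k * x))).
  have := is_derive_mul (schwartzR_is_derive k sf) (is_derive_sinM x k).
  rewrite [x * k]mulrC mulrCA.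
  by under eq_fun do rewrite [x * _]mulrC.
have := Rintegral_derive_schwartz s d.
have ic := integrable_cosM x (schwartzR_integrable sf).
rewrite RintegralD//; first last.
- exact: integrable_funZ.
- exact/integrable_sinM/schwartzR_integrable.
by rewrite RintegralZl// addrC => /eqP; rewrite addr_eq0 => /eqP.
Qed.

Lemma mul_sintr f x : schwartzR f -> x * sintr f x = costr (derive1 f) x.
Proof.
move=> sf; have sf' := schwartzR_derive1 sf.
have s : schwartzR (fun k => f k * cos (k * x)).
  by apply: rapidlyM1 => //; exact: slowly_cosM.
have d k : is_derive k (1 : R) (fun k => f k * cos (k * x))
    (derive1 f k * cos (k * x) - x * (f k * sin (k * x))).
  have := is_derive_mul (schwartzR_is_derive k sf) (is_derive_cosM x k).
  rewrite [x * k]mulrC mulrN mulrCA.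
  by under eq_fun do rewrite [x * _]mulrC.
have := Rintegral_derive_schwartz s d.
have ic := integrable_sinM x (schwartzR_integrable sf).
rewrite RintegralB//; first last.
- exact: integrable_funZ.
- exact/integrable_cosM/schwartzR_integrable.
by rewrite RintegralZl// => /eqP; rewrite subr_eq0 eq_sym => /eqP.
Qed.

(** Induction on N for both transforms and all functions at once: up to sign, a factor x turns one
    transform of f into the other transform of f'. *)
Lemma costr_sintr_rapid N : forall f, schwartzR f -> exists M : R, forall x,
  `|costr f x| * (1 + `|x|) ^+ N <= M /\ `|sintr f x| * (1 + `|x|) ^+ N <= M.
Proof.
elim: N => [|N IH] f sf.
  have itf := schwartzR_integrable sf.
  exists (\int[mu]_k `|f k|) => x; rewrite expr0 !mulr1; split.
    apply: le_trans (le_normr_Rintegral _ (integrable_cosM x itf)) _ => //.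
    apply: le_Rintegral => //.
    - exact/integrable_norm/integrable_cosM.
    - exact: integrable_norm.
    - by move=> k _; rewrite normrM ler_piMr// norm_cos_le1.
  apply: le_trans (le_normr_Rintegral _ (integrable_sinM x itf)) _ => //.
  apply: le_Rintegral => //.
  - exact/integrable_norm/integrable_sinM.
  - exact: integrable_norm.
  - by move=> k _; rewrite normrM ler_piMr// norm_sin_le1.
have [M hM] := IH _ sf; have [M' hM'] := IH _ (schwartzR_derive1 sf).
exists (M + M') => x; have [h1 h2] := hM x; have [h1' h2'] := hM' x.
rewrite !exprS !mulrA !(mulrDr `|_|) !mulr1 !mulrDl; split; apply: lerD => //.
  by rewrite -normrM [costr f x * x]mulrC mul_costr// normrN.
by rewrite -normrM [sintr f x * x]mulrC mul_sintr.
Qed.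

(** Cosine and sine transforms of Schwartz functions form together a class stable under derivation:
    up to sign, the derivative exchanges the two transforms and multiplies f by k. *)
Lemma schwartzR_costr f : schwartzR f -> schwartzR (costr f).
Proof.
move=> sf.
exists (fun F => (exists2 f, schwartzR f & F = fun _ => costr f) \/
                 (exists2 f, schwartzR f & F = fun _ => sintr f)).
  by left; exists f.
move=> _ [[{}f {}sf ->]|[{}f {}sf ->]]; have skf := schwartzR_mulid sf.
  split=> [N|].
    by have [M hM] := costr_sintr_rapid N sf; exists M => _ x; rewrite mulr1; case: (hM x).
  exists (fun _ => sintr (fun k => - (k * f k))).
    by right; exists (fun k => - (k * f k)) => //; exact: schwartzRN.
  move=> _ x; have := is_derive_costr x sf; congr is_derive.
  rewrite /sintr -mulN1r -RintegralZl//; last exact/integrable_sinM/schwartzR_integrable.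
  by apply: eq_Rintegral => k _; rewrite mulN1r mulNr.
split=> [N|].
  by have [M hM] := costr_sintr_rapid N sf; exists M => _ x; rewrite mulr1; case: (hM x).
exists (fun _ => costr (fun k => k * f k)).
  by left; exists (fun k => (k * f k)).
by move=> _ x; exact: is_derive_sintr.
Qed.

Lemma costr_even f x : costr f (- x) = costr f x.
Proof. by apply: eq_Rintegral => k _; rewrite mulrN cosN. Qed.

Lemma sintr_even f x : schwartzR f -> (forall k, f (- k) = f k) -> sintr f x = 0.
Proof.
move=> sf ef; apply: Rintegral_odd.
- move=> k; apply: cvgM; first exact: schwartzR_continuous.
  exact: continuous_sinM.
- exact/integrable_sinM/schwartzR_integrable.
- by move=> k; rewrite ef mulNr sinN mulrN.
Qed.

End cosine_transform.

(** * Fourier inversion for even Schwartz functions *)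

Section fourier_inversion.
Context {R : realType}.
Local Open Scope classical_set_scope.
Local Notation mu := (@lebesgue_measure R).
Implicit Types (f g u : R -> R).

Lemma inv_rate_gt0 n : 0 < inv_rate n :> R.
Proof. by rewrite invr_gt0. Qed.

Lemma inv_rate_le1 n : inv_rate n <= 1 :> R.
Proof. by rewrite invf_le1// ler1n. Qed.

Lemma cvg_inv_rate : @inv_rate R @ \oo --> (0 : R).
Proof. exact: cvg_harmonic. Qed.

Lemma schwartzR_gauss : schwartzR (@gauss_fun R).
Proof. exact: rapidly_gauss. Qed.

Lemma is_derive_gauss (x : R) :
  is_derive x (1 : R) (@gauss_fun R) (- 2 * (x * gauss_fun x)).
Proof.
have d : is_derive x (1 : R) (fun x => - x ^+ 2) (- (x *+ 2)).
  apply: is_deriveN.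
  apply: is_derive_eq (is_derive_mul (is_derive_id x 1) (is_derive_id x 1)) _.
  by rewrite mul1r mulr1.
have := @is_derive1_comp _ expR (fun x => - x ^+ 2) _ _ _ (is_derive_expR _) d.
by congr is_derive; rewrite /gauss_fun; ring.
Qed.

(** For the Gaussian g one has g' = -2 k g, so derivation of the transform and integration by parts
    produce the same sine transform. Eliminating it leaves this differential equation. *)
Lemma costr_gauss_ode (x : R) :
  is_derive x (1 : R) (costr (@gauss_fun R)) (- (x / 2) * costr (@gauss_fun R) x).
Proof.
have sg := schwartzR_gauss; have skg := schwartzR_mulid sg.
apply: is_derive_eq; first exact: is_derive_costr.
have : x * costr (@gauss_fun R) x = 2 * sintr (fun k => k * gauss_fun k) x.
  rewrite mul_costr// -mulN1r /sintr -!RintegralZl//; first last.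
  - exact/integrable_sinM/schwartzR_integrable.
  - exact/integrable_sinM/schwartzR_integrable/schwartzR_derive1.
  apply: eq_Rintegral => k _; rewrite (is_derive_derive1 is_derive_gauss); ring.
lra.
Qed.

Lemma costr_gauss (x : R) :
  costr (@gauss_fun R) x = costr (@gauss_fun R) 0 * expR (- x ^+ 2 / 4).
Proof.
have d y : is_derive y (1 : R) (fun y => costr (@gauss_fun R) y * expR (y ^+ 2 / 4)) 0.
  have d1 : is_derive y (1 : R) (fun y => y ^+ 2 / 4) (y / 2).
    have := is_derive_mul (is_derive_mul (is_derive_id y 1)
      (is_derive_id y 1)) (is_derive_cst (4^-1 : R) y 1).
    by congr is_derive; rewrite /cst; field.
  have d2 : is_derive y (1 : R) (fun y => expR (y ^+ 2 / 4)) (expR (y ^+ 2 / 4) * (y / 2)).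
    exact: (@is_derive1_comp _ expR (fun y => y ^+ 2 / 4) _ _ _ (is_derive_expR _) d1).
  apply: is_derive_eq (is_derive_mul (costr_gauss_ode y) d2) _; ring.
have := is_derive_0_is_cst x 0 d.
rewrite expr0n/= mul0r expR0 mulr1 => <-.
by rewrite -mulrA -expRD mulNr addrN expR0 mulr1.
Qed.

Lemma costr_gauss0 : costr (@gauss_fun R) 0 = Num.sqrt pi.
Proof.
rewrite /costr; under eq_Rintegral do rewrite mulr0 cos0 mulr1.
by rewrite /Rintegral integralT_gauss.
Qed.

(* Its value, 2 * pi, is irrelevant. *)
Definition inversion_const : R := \int[mu]_x costr (@gauss_fun R) x.

Lemma schwartzR_ge0_integral_gt0 f : schwartzR f -> (forall x, 0 <= f x) ->
  0 < f 0 -> 0 < \int[mu]_x f x.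
Proof.
move=> sf f0 fpos.
have cf := schwartzR_continuous sf.
have [e e0 he] : exists2 e : R, 0 < e & forall x, `|x| <= e -> f 0 / 2 <= f x.
  have : \forall x \near 0, f 0 / 2 < f x.
    by apply: (cvgr_gt (f 0) (cf 0)); rewrite ltr_pdivrMr// ltr_pMr// ltr1n.
  move=> /nbhs_ballP[e /= e0 he]; exists (e / 2); first by rewrite divr_gt0.
  move=> x xe; apply/ltW/he; rewrite /ball/= sub0r normrN (le_lt_trans xe)//.
  by rewrite ltr_pdivrMr// ltr_pMr// ltr1n.
have itf := schwartzR_integrable sf.
have mA : measurable (`[- e, e]%classic : set R) by exact: measurable_itv.
have muA : mu `[- e, e] = (e - - e)%:E.
  by rewrite lebesgue_measure_itv/= lte_fin ifT//; lra.
have muAy : (mu `[(- e)%R, e%R] < +oo)%E by rewrite muA ltry.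
apply: (@lt_le_trans _ _ (\int[mu]_(x in `[- e, e]) (f 0 / 2))).
  rewrite (Rintegral_cst mu mA) mulr_gt0 ?divr_gt0//.
  by rewrite [X in fine X](_ : _ = (e - - e)%:E)//=; lra.
apply: (@le_trans _ _ (\int[mu]_(x in `[- e, e]) f x)).
  apply: le_Rintegral => //.
  - apply: measurable_bounded_integrable => //.
    exact: bounded_cst.
  - exact: integrableS itf.
  - move=> x; rewrite /= in_itv/= => xe; apply: he.
    by rewrite ler_norml.
rewrite /Rintegral; apply: fine_le.
- exact: integrable_fin_num (integrableS _ _ _ itf).
- exact: integrable_fin_num itf.
- apply: ge0_subset_integral => //.
  + by apply/measurable_EFinP; exact: integrable_measurableR itf.
  + by move=> x _; rewrite lee_fin.
Qed.

Lemma inversion_const_gt0 : 0 < inversion_const.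
Proof.
apply: schwartzR_ge0_integral_gt0.
- exact: schwartzR_costr schwartzR_gauss.
- by move=> x; rewrite costr_gauss costr_gauss0 mulr_ge0 ?expR_ge0.
- by rewrite costr_gauss0 sqrtr_gt0 pi_gt0.
Qed.

Lemma measurable_cos_prod : measurable_fun setT (fun z : R * R => cos (z.1 * z.2)).
Proof.
apply: measurableT_comp.
  by apply: continuous_measurableR; exact: continuous_cos.
by apply: measurable_funM.
Qed.

Lemma continuous_scale f (e : R) : continuous f -> continuous (fun t => f (e * t)).
Proof.
move=> cf t; apply: (continuous_comp (f := fun t => e * t)); last exact: cf.
by apply: cvgMr; exact: cvg_id.
Qed.

(* Fubini against a Gaussian of width 1/e, then rescaling. *)
Lemma Rintegral_costr_gauss f (e : R) : 0 < e -> schwartzR f ->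
  \int[mu]_t (costr f t * gauss_fun (e * t)) =
  \int[mu]_k (f (e * k) * costr (@gauss_fun R) k).
Proof.
move=> e0 sf.
have sg := schwartzR_gauss.
have cg := schwartzR_continuous sg; have ig := schwartzR_integrable sg.
have cf := schwartzR_continuous sf; have itf := schwartzR_integrable sf.
have scg := schwartzR_costr sg.
have aff (h : R -> R) : (fun x => h (e * x + 0)) = (fun x => h (e * x)).
  by apply/funext => x; rewrite addr0.
have [ige _] := Rintegral_affine 0 e0 cg ig.
rewrite aff in ige.
under eq_Rintegral do rewrite mulrC.
have bd (x y : R) : `|cos (y * x)| <= 1 by exact: norm_cos_le1.
have mK : measurable_fun setT (fun z : R * R => cos (z.2 * z.1)).
  by under eq_fun do rewrite mulrC; exact: measurable_cos_prod.
rewrite /costr (@Rintegral_kernel_swap _ _ _ _ _ mu mu _ _ (fun t k => cos (k * t)) 1 ige itf mK bd).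
have inner k : \int[mu]_t (gauss_fun (e * t) * cos (k * t)) =
    e^-1 * costr (@gauss_fun R) (e^-1 * k).
  have s : schwartzR (fun t => gauss_fun t * cos (t * (e^-1 * k))).
    by apply: rapidlyM1 => //; exact: slowly_cosM.
  have [_] := Rintegral_affine 0 e0 (schwartzR_continuous s) (schwartzR_integrable s).
  move=> <-; apply: eq_Rintegral => t _; rewrite addr0; congr (_ * cos _).
  by rewrite mulrACA mulfV ?gt_eqF// mul1r mulrC.
under eq_Rintegral do rewrite inner mulrCA.
have ei0 : 0 < e^-1 by rewrite invr_gt0.
pose F s := f (e * s) * costr (@gauss_fun R) s.
have cF : continuous F.
  move=> s; apply: cvgM; first exact: continuous_scale.
  exact: schwartzR_continuous scg s.
have [Mf hMf] := (smooth_in_bd sf) 0.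
have iF : mu.-integrable setT (EFin \o F).
  rewrite (_ : F = fun s => costr (@gauss_fun R) s * f (e * s)); last first.
    by apply/funext => s; rewrite /F mulrC.
  apply: (integrable_funM (M := Mf) measurableT (schwartzR_integrable scg)).
    by apply: continuous_measurableR; exact: continuous_scale.
  by move=> x; have := hMf 0 (e * x); rewrite expr0 !mulr1.
have [iF' ] := Rintegral_affine 0 ei0 cF iF.
rewrite invrK => eF.
have itF : mu.-integrable setT (EFin \o (fun k => f k * costr (@gauss_fun R) (e^-1 * k))).
  rewrite (_ : (fun k => _) = fun k => F (e^-1 * k + 0))//.
  by apply/funext => k; rewrite addr0 /F mulrA mulfV ?gt_eqF// mul1r.
rewrite (RintegralZl _ measurableT itF).
rewrite (_ : \int[mu]_t (f t * _) = \int[mu]_x F (e^-1 * x + 0)).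
  by rewrite eF mulrA mulVf ?gt_eqF// mul1r.
by apply: eq_Rintegral => k _; rewrite addr0 /F mulrA mulfV ?gt_eqF// mul1r.
Qed.

(** Inversion at the point 0: the dilation [inv_rate n] tends to 0 on both sides of
    [Rintegral_costr_gauss]. *)
Lemma Rintegral_costr f : schwartzR f ->
  \int[mu]_t costr f t = inversion_const * f 0.
Proof.
move=> sf; have scf := schwartzR_costr sf.
have scg := schwartzR_costr schwartzR_gauss.
have cf := schwartzR_continuous sf.
have cg := schwartzR_continuous schwartzR_gauss.
pose A n := \int[mu]_t (costr f t * gauss_fun (inv_rate n * t)).
have e0 (h : R -> R) (x : R) : continuous h -> h (inv_rate n * x) @[n --> \oo] --> h 0.
  move=> ch; apply: (@cvg_comp _ _ _ (fun n => inv_rate n * x) h _ (nbhs (0 : R))).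
    by rewrite -(mul0r x); apply: cvgMl; exact: cvg_inv_rate.
  exact: ch.
have A1 : A n @[n --> \oo] --> \int[mu]_t costr f t.
  apply: (@Rintegral_dominated_cvg _ _ _ mu setT measurableT _ _ (fun t => `|costr f t|)).
  - move=> n; apply: continuous_measurableR => t; apply: cvgM.
      exact: schwartzR_continuous scf t.
    exact: continuous_scale.
  - move=> t; rewrite -[X in _ --> X]mulr1; apply: cvgM; first exact: cvg_cst.
    have <- : gauss_fun 0 = 1 :> R by rewrite /gauss_fun expr0n oppr0 expR0.
    exact: e0.
  - exact/integrable_norm/schwartzR_integrable.
  - move=> n t; rewrite normrM ler_piMr// ger0_norm ?gauss_fun_ge0//.
    exact: gauss_fun_le1.
have [Mf hMf] := (smooth_in_bd sf) 0.
have A2 : A n @[n --> \oo] --> \int[mu]_k (f 0 * costr (@gauss_fun R) k).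
  under eq_fun do rewrite /A Rintegral_costr_gauss ?inv_rate_gt0//.
  apply: (@Rintegral_dominated_cvg _ _ _ mu setT measurableT _ _
    (fun t => Mf * `|costr (@gauss_fun R) t|)).
  - move=> n; apply: continuous_measurableR => t; apply: cvgM.
      exact: continuous_scale.
    exact: schwartzR_continuous scg t.
  - by move=> t; apply: cvgMl; exact: e0.
  - exact/integrable_funZ/integrable_norm/schwartzR_integrable.
  - move=> n t; rewrite normrM ler_wpM2r//.
    by have := hMf 0 (inv_rate n * t); rewrite expr0 !mulr1.
rewrite mulrC -RintegralZl//; last exact: schwartzR_integrable.
exact: (cvg_unique _ A1 A2).
Qed.

Lemma rapidly_translate (w : nat -> R) F (b : R) : (forall n, 0 <= w n) ->
  rapidly w F -> rapidly w (fun n x => F n (x + b)).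
Proof.
move=> w0 rF.
exists (fun H => exists2 G, rapidly w G & H = fun n x => G n (x + b)); first by exists F.
move=> _ [G rG ->]; split=> [N|].
  have [M hM] := smooth_in_bd rG N; exists (M * (1 + `|b|) ^+ N) => n x.
  apply: le_trans (ler_wpM2l (normr_ge0 _) (onePnorm_submulX x b N)) _.
  rewrite mulrA [leRHS]mulrAC; exact: ler_wpM2r.
have [G' rG' dG] := smooth_inP rG.
exists (fun n x => G' n (x + b)); first by exists G'.
move=> n x; have := is_derive_comp_affine (a := 1) (b := b) (x := x) (f := G n) (df := G' n (x + b)).
rewrite !mul1r; under eq_fun do rewrite mul1r; apply; exact: dG.
Qed.

Lemma schwartzR_translate f (b : R) : schwartzR f -> schwartzR (fun x => f (x + b)).
Proof. by move=> sf; apply: (@rapidly_translate unit_rate (fun _ => f)). Qed.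

Lemma Rintegral_translate f (b : R) : continuous f ->
  mu.-integrable setT (EFin \o f) ->
  mu.-integrable setT (EFin \o (fun x => f (x + b))) /\
  \int[mu]_x f (x + b) = \int[mu]_x f x.
Proof.
move=> cf itf; have [] := @Rintegral_affine R 1 b f ltr01 cf itf.
rewrite invr1 mul1r => h <-; split.
  by move: h; congr (_.-integrable _ _); apply/funext => x /=; rewrite mul1r.
by apply: eq_Rintegral => x _; rewrite mul1r.
Qed.

(** Adding the translates by s and -s cancels the sine terms, so the modulation by cos(t s) stays
    within cosine transforms. This is what moves inversion from 0 to s. *)
Lemma costr_translates f (s t : R) : schwartzR f ->
  costr (fun k => f (k + s) + f (k - s)) t = 2 * (costr f t * cos (t * s)).
Proof.
move=> sf.
have tr b : costr (fun k => f (k + b)) t = \int[mu]_k (f k * cos ((k - b) * t)).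
  have ct : continuous (fun k : R => f k * cos ((k - b) * t)).
    move=> k; apply: cvgM; first exact: schwartzR_continuous.
    apply: (continuous_comp (f := fun k : R => (k - b) * t)); last exact: continuous_cos.
    by apply: cvgMl; apply: cvgB; [exact: cvg_id|exact: cvg_cst].
  have it : mu.-integrable setT (EFin \o (fun k : R => f k * cos ((k - b) * t))).
    apply: (integrable_funM (M := 1) measurableT (schwartzR_integrable sf)).
      apply: continuous_measurableR => k.
      apply: (continuous_comp (f := fun k : R => (k - b) * t)); last exact: continuous_cos.
      by apply: cvgMl; apply: cvgB; [exact: cvg_id|exact: cvg_cst].
    by move=> k; exact: norm_cos_le1.
  have [_ <-] := Rintegral_translate b ct it.
  by apply: eq_Rintegral => k _; rewrite addrK.
have itr b : schwartzR (fun k => f (k + b)) by exact: schwartzR_translate.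
rewrite /costr; under eq_Rintegral do rewrite mulrDl.
rewrite RintegralD//; [|exact/integrable_cosM/schwartzR_integrable..].
rewrite -/(costr _ _) -/(costr _ _) !tr.
have it b : mu.-integrable setT (EFin \o (fun k : R => f k * cos ((k - b) * t))).
  apply: (integrable_funM (M := 1) measurableT (schwartzR_integrable sf)).
    apply: continuous_measurableR => k.
    apply: (continuous_comp (f := fun k : R => (k - b) * t)); last exact: continuous_cos.
    by apply: cvgMl; apply: cvgB; [exact: cvg_id|exact: cvg_cst].
  by move=> k; exact: norm_cos_le1.
rewrite -RintegralD// -RintegralZr//; last exact/integrable_cosM/schwartzR_integrable.
rewrite -RintegralZl//.
  apply: eq_Rintegral => k _; rewrite opprK !mulrBl mulrDl cosB cosD [s * t]mulrC; ring.
apply: (integrable_funM (M := 1) measurableT).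
- exact/integrable_cosM/schwartzR_integrable.
- exact: measurable_cst.
- by move=> _; exact: norm_cos_le1.
Qed.

(** Inversion at 0 for the sum of the two translates, whose value there is f(s) + f(-s): the cosine
    transform sees only the even part of f. *)
Lemma costrK_gen f (s : R) : schwartzR f ->
  costr (costr f) s = inversion_const * ((f s + f (- s)) / 2).
Proof.
move=> sf; have s1 : schwartzR (fun k => f (k + s)) by exact: schwartzR_translate.
have s2 : schwartzR (fun k => f (k - s)) by exact: schwartzR_translate.
have := Rintegral_costr (schwartzRD s1 s2); rewrite add0r sub0r.
under eq_Rintegral do rewrite costr_translates//.
rewrite RintegralZl//; last exact/integrable_cosM/schwartzR_integrable/schwartzR_costr.
rewrite -/(costr _ _); lra.
Qed.

Lemma costrK f (s : R) : schwartzR f -> (forall k, f (- k) = f k) ->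
  costr (costr f) s = inversion_const * f s.
Proof.
by move=> sf ef; rewrite costrK_gen// ef; congr (_ * _); lra.
Qed.

End fourier_inversion.

(** * Autocorrelations and cutoffs *)

Section correlation.
Context {R : realType}.
Local Open Scope classical_set_scope.
Local Notation mu := (@lebesgue_measure R).
Implicit Types (f g u h : R -> R) (w : nat -> R).

Definition corr f g (x : R) : R := \int[mu]_t (f (x + t) * g t).

Lemma integrable_corr f g (M x : R) : continuous f -> (forall y, `|f y| <= M) ->
  mu.-integrable setT (EFin \o g) ->
  mu.-integrable setT (EFin \o (fun t => f (x + t) * g t)).
Proof.
move=> cf fM ig; under [X in _.-integrable _ X]eq_fun do rewrite /= mulrC.
apply: (integrable_funM (M := M) measurableT ig) => [|t]; last exact: fM.
apply: continuous_measurableR => t; apply: (continuous_comp (f := fun t => x + t)).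
  by apply: cvgD; [exact: cvg_cst|exact: cvg_id].
exact: cf.
Qed.

Lemma rapidly_bounded w F n : rapidly w F -> exists M : R, forall x, `|F n x| <= M.
Proof.
move=> /smooth_in_bd/(_ 0)[M hM]; exists (M * w n) => x.
by have := hM n x; rewrite expr0 mulr1.
Qed.

(** All derivatives are put on the first factor, so the class is stable with [G] fixed. The weight
    (1 + |x|)^N is shared between the two factors by Peetre's inequality. *)
Lemma rapidly_corr w w' F G : (forall n, 0 <= w n) -> (forall n, 0 <= w' n) ->
  rapidly w F -> rapidly w' G ->
  rapidly (fun n => w n * w' n) (fun n => corr (F n) (G n)).
Proof.
move=> w0 w0' rF rG.
exists (fun H => exists2 F, rapidly w F & H = fun n => corr (F n) (G n)).
  by exists F.
move=> _ [{}F {}rF ->]; split=> [N|].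
  have [M1 hM1] := smooth_in_bd rF N.
  pose GN n t := G n t * (1 + t ^+ 2) ^+ N.
  have rGN : rapid w' (fun n t => G n t * (1 + `|t|) ^+ N).
    move=> K; have [M hM] := smooth_in_bd rG (N + K)%N; exists M => n t.
    by rewrite normrM (ger0_norm (exprn_ge0 _ _)) ?addr_ge0// -mulrA -exprD.
  have [M2 [M20 hM2]] := rapid_oneDsqrV w0' rGN.
  exists (`|M1| * M2 * \int[mu]_t (1 + t ^+ 2)^-1) => n x.
  have iG := rapidly_integrable n w0' rG.
  have [Mf hMf] := rapidly_bounded n rF.
  have ifg := integrable_corr x (smooth_in_continuous (n := n) rF) hMf iG.
  rewrite mulrC -[X in X * _](ger0_norm (ltW (onePnormX_gt0 x N))) -normrM.
  rewrite /corr -(RintegralZl _ measurableT ifg).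
  have ifg' := integrable_funZ measurableT ((1 + `|x|) ^+ N) ifg.
  apply: le_trans (le_normr_Rintegral measurableT ifg') _.
  rewrite -mulrA (mulrC _ (w n * w' n)) -[leRHS]mulrA mulrA.
  rewrite [leRHS](_ : _ = (`|M1| * w n * (M2 * w' n)) * \int[mu]_t (1 + t ^+ 2)^-1); last ring.
  rewrite -(RintegralZl _ measurableT (@integrable_oneDsqrV R)).
  apply: le_Rintegral => //.
  - exact: integrable_norm.
  - exact: integrable_oneDsqrV_scale.
  move=> t _; rewrite !normrM (ger0_norm (ltW (onePnormX_gt0 x N))).
  apply: le_trans (ler_wpM2r _ (onePnorm_submulX x t N)) _; first exact: mulr_ge0.
  have h1 : `|F n (x + t)| * (1 + `|x + t|) ^+ N <= `|M1| * w n.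
    by apply: le_trans (hM1 n (x + t)) _; rewrite ler_wpM2r// ler_norm.
  have h2 : `|G n t| * (1 + `|t|) ^+ N <= M2 * w' n / (1 + t ^+ 2).
    by apply: le_trans (hM2 n t); rewrite normrM (ger0_norm (ltW (onePnormX_gt0 t N))).
  rewrite -mulrA [leLHS](_ : _ = (`|F n (x + t)| * (1 + `|x + t|) ^+ N) *
    (`|G n t| * (1 + `|t|) ^+ N)); last ring.
  apply: le_trans (ler_pM _ _ h1 h2) _.
  - by rewrite mulr_ge0// ltW// onePnormX_gt0.
  - by rewrite mulr_ge0// ltW// onePnormX_gt0.
  - by rewrite !mulrA.
have [F' rF' dF] := smooth_inP rF.
exists (fun n => corr (F' n) (G n)); first by exists F'.
move=> n x.
have iG := rapidly_integrable n w0' rG.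
have [Mf hMf] := rapidly_bounded n rF.
have [Mf' hMf'] := rapidly_bounded n rF'.
have Mf'0 : 0 <= Mf' by exact: le_trans (hMf' 0).
apply: (@is_derive_Rintegral _ (fun x t => F n (x + t) * G n t)
  (fun x t => F' n (x + t) * G n t) (fun t => Mf' * `|G n t|)).
- by move=> y; apply: integrable_corr hMf iG; exact: smooth_in_continuous rF.
- move=> y t.
  have d1 : is_derive y (1 : R) (fun y => F n (y + t)) (F' n (y + t)).
    have := is_derive_comp_affine (a := 1) (b := t) (x := y) (f := F n) (df := F' n (y + t)).
    by rewrite !mul1r; under eq_fun do rewrite mul1r; apply; exact: dF.
  by have := is_derive_mul d1 (is_derive_cst (G n t) y 1); rewrite mulr0 addr0.
- exact/integrable_funZ/integrable_norm.
- by move=> y t _; rewrite normrM ler_wpM2r.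
Qed.

Lemma Rintegral_mul_costr f g : schwartzR f -> schwartzR g ->
  \int[mu]_t (f t * costr g t) = \int[mu]_k (g k * costr f k).
Proof.
move=> sf sg.
have mK : measurable_fun setT (fun z : R * R => cos (z.2 * z.1)).
  by under eq_fun do rewrite mulrC; exact: measurable_cos_prod.
have bd (t k : R) : `|cos (k * t)| <= 1 by exact: norm_cos_le1.
rewrite /costr (@Rintegral_kernel_swap _ _ _ _ _ mu mu f g (fun t k => cos (k * t)) 1
  (schwartzR_integrable sf) (schwartzR_integrable sg) mK bd).
apply: eq_Rintegral => k _; congr (_ * _); apply: eq_Rintegral => t _.
by rewrite [k * t]mulrC.
Qed.

Lemma schwartzR_sqr f : schwartzR f -> schwartzR (fun x => f x ^+ 2).
Proof. by move=> sf; exact: schwartzRM. Qed.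

(* Expand one factor u = (costr (costr u)) / c and integrate it first. *)
Lemma corr_self u (x : R) : schwartzR u -> (forall k, u (- k) = u k) ->
  corr u u x = inversion_const^-1 * costr (fun k => costr u k ^+ 2) x.
Proof.
move=> su eu.
have c0 : @inversion_const R != 0 by rewrite gt_eqF// inversion_const_gt0.
have su' := schwartzR_costr su.
have cE y : u y = inversion_const^-1 * costr (costr u) y by rewrite costrK// mulKf.
have swap : \int[mu]_t (u t * costr (costr u) (x + t)) =
    \int[mu]_k (costr u k * \int[mu]_t (u t * cos (k * (x + t)))).
  have mc : measurable_fun setT (@cos R) := continuous_measurableR (@continuous_cos R).
  have mK : measurable_fun setT (fun z : R * R => cos (z.2 * (x + z.1))).
    apply: (measurableT_comp mc); apply: measurable_funM => //.
    exact: measurable_funD.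
  have bd (t k : R) : `|cos (k * (x + t))| <= 1 by exact: norm_cos_le1.
  exact: (@Rintegral_kernel_swap _ _ _ _ _ mu mu u (costr u)
    (fun t k => cos (k * (x + t))) 1 (schwartzR_integrable su)
    (schwartzR_integrable su') mK bd).
have inner k : \int[mu]_t (u t * cos (k * (x + t))) = cos (k * x) * costr u k.
  have ic := integrable_cosM k (schwartzR_integrable su).
  have is' := integrable_sinM k (schwartzR_integrable su).
  transitivity (\int[mu]_t (cos (k * x) * (u t * cos (t * k)) -
                            sin (k * x) * (u t * sin (t * k)))).
    by apply: eq_Rintegral => t _; rewrite mulrDr cosD [t * k]mulrC; ring.
  rewrite (RintegralB measurableT (integrable_funZ measurableT (cos (k * x)) ic)
    (integrable_funZ measurableT (sin (k * x)) is')).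
  rewrite (RintegralZl _ measurableT ic) (RintegralZl _ measurableT is').
  by rewrite -/(sintr u k) sintr_even// mulr0 subr0.
have icc : mu.-integrable setT (EFin \o (fun t => u t * costr (costr u) (x + t))).
  have [M hM] := rapidly_bounded 0 (schwartzR_costr su').
  have := integrable_corr x (schwartzR_continuous (schwartzR_costr su')) hM (schwartzR_integrable su).
  by under [X in _.-integrable _ X]eq_fun do rewrite /= mulrC.
rewrite /corr.
transitivity (\int[mu]_t (inversion_const^-1 * (u t * costr (costr u) (x + t)))).
  by apply: eq_Rintegral => t _; rewrite {1}cE; ring.
rewrite (RintegralZl _ measurableT icc) swap; congr (_ * _).
by apply: eq_Rintegral => k _; rewrite inner; ring.
Qed.

(** This replaces the convolution theorem. Pair [costr h] with the transform of h(k + s) + h(k - s);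
    moving one transform to the other factor and inverting leaves the integral of (h(k + s) + h(k -
    s)) h(k), where the supports are disjoint. *)
Lemma costr_sqr_support h (r s : R) : schwartzR h -> (forall k, h (- k) = h k) ->
  (forall k, r <= `|k| -> h k = 0) -> 2 * r <= `|s| ->
  costr (fun t => costr h t ^+ 2) s = 0.
Proof.
move=> sh eh h0 rs.
have sh' := schwartzR_costr sh.
have sg : schwartzR (fun k => h (k + s) + h (k - s)).
  by apply: schwartzRD; exact: schwartzR_translate.
have : \int[mu]_t (costr h t * costr (fun k => h (k + s) + h (k - s)) t) = 0.
  rewrite Rintegral_mul_costr//.
  under eq_Rintegral do rewrite (costrK _ sh eh).
  apply: Rintegral_eq0 => k _.
  have [rk|kr] := leP r `|k|; first by rewrite (h0 k)// !mulr0.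
  rewrite (h0 (k + s)) ?(h0 (k - s)) ?addr0 ?mul0r//.
  - by have := ler_normB k (k - s); rewrite subKr; lra.
  - by have := ler_normB (k + s) k; rewrite [k + s]addrC addrK; lra.
under eq_Rintegral do rewrite costr_translates// mulrCA mulrA.
have ic : mu.-integrable setT (EFin \o (fun t => costr h t ^+ 2 * cos (t * s))).
  by apply/integrable_cosM/schwartzR_integrable; exact: schwartzR_sqr.
under eq_Rintegral do rewrite -!mulrA [costr h _ * (costr h _ * _)]mulrA -expr2.
rewrite (RintegralZl _ measurableT ic) => /eqP; rewrite mulf_eq0 pnatr_eq0/=.
by move/eqP.
Qed.

(** The factor t^2 becomes minus a second derivative of the transform, taken in two steps through
    the sine transform. Each derivative still vanishes on the open set r < |s|. *)
Lemma costr_oneDsqr_support u (r s : R) : schwartzR u ->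
  (forall s, r < `|s| -> costr u s = 0) -> r < `|s| ->
  costr (fun t => (1 + t ^+ 2) * u t) s = 0.
Proof.
move=> su u0 rs.
have sku := schwartzR_mulid su; have skku := schwartzR_mulid sku.
have nr (f f' : R -> R) y : r < `|y| -> (forall s, r < `|s| -> f s = 0) ->
    (forall x, is_derive x (1 : R) f (f' x)) -> f' y = 0.
  move=> ry f0 df.
  have d0 : is_derive y (1 : R) f 0.
    apply: (@near_eq_is_derive _ _ _ (cst 0)).
    near=> z; rewrite f0//; near: z.
    apply: (@cvgr_gt _ _ _ _ (fun y : R => `|y|) `|y|) => //.
    exact: norm_continuous.
  by case: (df y) => _ <-; case: d0.
have s0 y : r < `|y| -> sintr (fun k => k * u k) y = 0.
  move=> ry; apply/eqP; rewrite -oppr_eq0; apply/eqP.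
  exact: (nr (costr u) _ y ry u0 (fun x => is_derive_costr x su)).
have c0 := nr _ _ s rs s0 (fun x => is_derive_sintr x sku).
transitivity (costr u s + costr (fun k => k * (k * u k)) s).
  rewrite /costr -RintegralD//; [|exact/integrable_cosM/schwartzR_integrable..].
  by apply: eq_Rintegral => k _; ring.
by rewrite u0// c0 addr0.
Unshelve. all: end_near. Qed.

(** Normalised to be 1 at the origin. As a dilation of a fixed function, it gains a factor 1 / (n +
    1) with each derivative. *)
Definition chi n (x : R) : R := (bump (1 : R) 0)^-1 * bump (1 : R) (inv_rate n * x).

Lemma schwartzR_chi0 : schwartzR (fun x => (bump (1 : R) 0)^-1 * bump (1 : R) x).
Proof. by apply: schwartzRZ; exact: (rapidly_bump ler01). Qed.

Lemma chi_ge0 n x : 0 <= chi n x.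
Proof. by rewrite mulr_ge0 ?invr_ge0// bump_ge0. Qed.

Lemma chi_support n x : n.+1%:R <= `|x| -> chi n x = 0.
Proof.
move=> nx; have b : 1 <= `|inv_rate n * x|.
  by rewrite normrM [`|inv_rate n|]ger0_norm ?invr_ge0// ler_pdivlMl// mulr1.
by rewrite /chi (bump_support b) mulr0.
Qed.

Lemma is_derive_dilate G G' n j x : (forall x, is_derive x (1 : R) G (G' x)) ->
  is_derive x (1 : R) (fun x => inv_rate n ^+ j * G (inv_rate n * x))
    (inv_rate n ^+ j.+1 * G' (inv_rate n * x)).
Proof.
move=> dG.
have d1 : is_derive x (1 : R) (fun x => G (inv_rate n * x)) (inv_rate n * G' (inv_rate n * x)).
  have := is_derive_comp_affine (a := inv_rate n) (b := 0) (dG (inv_rate n * x + 0)).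
  by rewrite addr0; under eq_fun do rewrite addr0.
have := is_derive_mul (is_derive_cst (inv_rate n ^+ j : R) x 1) d1.
by rewrite mul0r add0r mulrA -exprSr.
Qed.

(** Each derivative raises [j], and a higher power of [inv_rate n], which is at most 1, only
    improves the bound. The inequality [i <= j] makes the class stable. *)
Lemma slowly_dilate G (j i : nat) : (i <= j)%N -> schwartzR G ->
  slowly (fun n => (inv_rate n : R) ^+ i) (fun n x => inv_rate n ^+ j * G (inv_rate n * x)).
Proof.
move=> ij sG.
exists (fun F => exists j G, [/\ (i <= j)%N, schwartzR G &
  F = fun n x => inv_rate n ^+ j * G (inv_rate n * x)]); first by exists j, G.
move=> _ [{}j [{}G [{}ij {}sG ->]]]; split.
  have [M hM] := rapidly_bounded 0 sG.
  exists 0, M => n x; rewrite expr0 mulr1 normrM mulrC.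
  have r0 : 0 <= inv_rate n :> R by rewrite ltW// inv_rate_gt0.
  rewrite (ger0_norm (exprn_ge0 _ r0)); apply: ler_pM => //; first exact: exprn_ge0.
  by apply: ler_wiXn2l => //; exact: inv_rate_le1.
exists (fun n x => inv_rate n ^+ j.+1 * derive1 G (inv_rate n * x)).
  exists j.+1, (derive1 G); split => //; first exact: leqW.
  exact: schwartzR_derive1.
by move=> n x; apply: is_derive_dilate => y; exact: schwartzR_is_derive.
Qed.

Lemma schwartzR_lipschitz f : schwartzR f ->
  exists M : R, 0 <= M /\ forall x, `|f x - f 0| <= M * `|x|.
Proof.
move=> sf; have [M hM] := rapidly_bounded 0 (schwartzR_derive1 sf).
exists M; split; first exact: le_trans (hM 0).
have df x : is_derive x (1 : R) f (derive1 f x) by exact: schwartzR_is_derive.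
have cf : continuous f by exact: schwartzR_continuous.
move=> x; have [x0|x0] := leP 0 x.
  have [c _ ->] := MVT_segment x0 (fun y _ => df y) (continuous_subspaceT cf).
  by rewrite subr0 normrM ler_wpM2r.
have [c _] := MVT_segment (ltW x0) (fun y _ => df y) (continuous_subspaceT cf).
by rewrite distrC sub0r => ->; rewrite normrM normrN ler_wpM2r.
Qed.

Lemma slowly_chi : slowly unit_rate chi.
Proof.
have := @slowly_dilate _ 0 0 (leqnn 0) schwartzR_chi0.
have -> : (fun n => (inv_rate n : R) ^+ 0) = unit_rate by [].
by congr smooth_in; apply/funext => n; apply/funext => x; rewrite expr0 mul1r.
Qed.

(** The function itself is O(|x| / (n + 1)) by the Lipschitz bound at 0, and its derivatives carry
    the factor 1 / (n + 1) explicitly. The undifferentiated function is therefore a case of its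
    own. *)
Lemma slowly_chiB1 : slowly inv_rate (fun n x => chi n x - 1).
Proof.
exists (fun F => F = (fun n x => chi n x - 1) \/ slowly inv_rate F); first by left.
move=> F0 [->|sF0]; last first.
  split; first exact: smooth_in_bd sF0.
  by have [F' sF' dF] := smooth_inP sF0; exists F' => //; right.
have b0 : bump (1 : R) 0 != 0 by rewrite gt_eqF// bump_gt0.
split.
  have [M [M0 hM]] := schwartzR_lipschitz schwartzR_chi0.
  exists 1, M => n x; rewrite expr1 /chi.
  have := hM (inv_rate n * x); rewrite mulVf// normrM.
  rewrite (ger0_norm (ltW (inv_rate_gt0 n))) mulrA => /le_trans; apply.
  by rewrite -mulrA !ler_wpM2l ?(ltW (inv_rate_gt0 n))// lerDr.
have sc' := schwartzR_derive1 schwartzR_chi0.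
exists (fun n x => inv_rate n ^+ 1 * derive1 (fun x => (bump (1 : R) 0)^-1 * bump (1 : R) x) (inv_rate n * x)).
  right; have := slowly_dilate (leqnn 1) sc'.
  by congr smooth_in; congr slow; apply/funext => n; rewrite expr1.
move=> n x.
have d := is_derive_dilate n 0 x (fun y => schwartzR_is_derive y schwartzR_chi0).
have := is_deriveB d (is_derive_cst (1 : R) x 1).
rewrite subr0; congr is_derive.
apply/funext => y; rewrite !fctE.
by rewrite expr0 mul1r.
Qed.

Lemma cvg_chi x : chi n x @[n --> \oo] --> (1 : R).
Proof.
have b0 : bump (1 : R) 0 != 0 by rewrite gt_eqF// bump_gt0.
rewrite -(mulVf b0); apply: cvgMr.
apply: (@cvg_comp _ _ _ (fun n => inv_rate n * x) (bump (1 : R)) _ (nbhs (0 : R))).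
  by rewrite -(mul0r x); apply: cvgMl; exact: cvg_inv_rate.
have sb : schwartzR (bump (1 : R)) by exact: (rapidly_bump ler01).
exact: schwartzR_continuous sb 0.
Qed.

Lemma chi_bounded : exists M : R, 0 <= M /\ forall n x, chi n x <= M.
Proof.
exists (bump (1 : R) 0)^-1; split; first by rewrite invr_ge0 bump_ge0.
by move=> n x; rewrite /chi ler_piMr ?invr_ge0 ?bump_ge0// bump_le.
Qed.

Lemma inv_rate_ge0 n : 0 <= inv_rate n :> R.
Proof. by rewrite ltW// inv_rate_gt0. Qed.

Definition cutoff u n x := u x * chi n x.

Lemma rapidly_cutoff u : schwartzR u -> rapidly unit_rate (cutoff u).
Proof. by move=> su; apply: rapidlyM1 => //; exact: slowly_chi. Qed.

Lemma rapidly_cutoffB u : schwartzR u ->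
  rapidly inv_rate (fun n x => cutoff u n x - u x).
Proof.
move=> su; have := rapidlyM (fun=> ler01) inv_rate_ge0 su slowly_chiB1.
congr smooth_in; first by congr rapid; apply/funext => n; rewrite mul1r.
by apply/funext => n; apply/funext => x; rewrite mulrBr mulr1.
Qed.

(** With c the cutoff of u, bilinearity makes the difference equal to
    [corr (c - u) c + corr u (c - u)], and each term inherits the rate of c - u. *)
Lemma rapidly_corr_cutoff u : schwartzR u ->
  rapidly inv_rate (fun n x => corr (cutoff u n) (cutoff u n) x - corr u u x).
Proof.
move=> su; have rc := rapidly_cutoff su; have rB := rapidly_cutoffB su.
have one0 (n : nat) : 0 <= unit_rate n :> R by [].
have h1 := rapidly_corr inv_rate_ge0 one0 rB rc.
have h2 := rapidly_corr one0 inv_rate_ge0 su rB.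
have e1 : (fun n : nat => inv_rate n * 1) = @inv_rate R.
  by apply/funext => n; rewrite mulr1.
have e2 : (fun n : nat => 1 * inv_rate n) = @inv_rate R.
  by apply/funext => n; rewrite mul1r.
rewrite e1 in h1; rewrite e2 in h2.
have := rapidlyD h1 h2; congr smooth_in; apply/funext => n; apply/funext => x.
have [Mc hMc] := rapidly_bounded n rc; have [Mu hMu] := rapidly_bounded 0 su.
have [MB hMB] := rapidly_bounded n rB.
have cc : continuous (cutoff u n) by exact: (smooth_in_continuous (n := n) rc).
have cu := schwartzR_continuous su.
have cB : continuous (fun x => cutoff u n x - u x).
  exact: (smooth_in_continuous (n := n) rB).
have ic : mu.-integrable setT (EFin \o cutoff u n) by exact: rapidly_integrable rc.
have iB : mu.-integrable setT (EFin \o (fun x => cutoff u n x - u x)).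
  exact: (rapidly_integrable n inv_rate_ge0 rB).
have iu := schwartzR_integrable su.
rewrite /corr -RintegralD//; [|exact: integrable_corr hMB ic|exact: integrable_corr hMu iB].
rewrite -RintegralB//; [|exact: integrable_corr hMc ic|exact: integrable_corr hMu iu].
by apply: eq_Rintegral => t _; ring.
Qed.

End correlation.

(** * Lattice sums of band-limited functions *)

Section lattice_sums.
Context {R : realType}.
Local Open Scope classical_set_scope.
Local Notation mu := (@lebesgue_measure R).
Implicit Types (u : R -> R).

Definition dirichlet T (x : R) : R := 1 + \sum_(t < T) 2 * cos (t.+1%:R * x).

Lemma dirichlet_telescope T (x : R) :
  (1 - cos x) * dirichlet T x = cos (T%:R * x) - cos (T.+1%:R * x).
Proof.
elim: T => [|T IH]; first by rewrite /dirichlet big_ord0 mul0r cos0 mul1r addr0 mulr1.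
rewrite /dirichlet big_ord_recr/= addrA mulrDr -/(dirichlet T x) IH.
have e1 : cos (T%:R * x) = cos (T.+1%:R * x) * cos x + sin (T.+1%:R * x) * sin x.
  by rewrite -cosB; congr cos; rewrite -natr1; ring.
have e2 : cos (T.+2%:R * x) = cos (T.+1%:R * x) * cos x - sin (T.+1%:R * x) * sin x.
  by rewrite -cosD; congr cos; rewrite -(natr1 T.+1); ring.
rewrite e1 e2; ring.
Qed.

(** The closed form of the Fejer kernel, without its normalisation: the sum of Dirichlet kernels is
    at most 2 / (1 - cos x), uniformly in N, when cos x < 1. *)
Lemma fejer_telescope N (x : R) :
  (1 - cos x) * \sum_(T < N) dirichlet T x = 1 - cos (N%:R * x).
Proof.
elim: N => [|N IH]; first by rewrite big_ord0 mulr0 mul0r cos0 subrr.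
by rewrite big_ord_recr/= mulrDr IH dirichlet_telescope; ring.
Qed.

(** By Cesaro the averages tend to L as well, whereas bounded sums force them to 0. *)
Lemma bounded_sums_cvg0 (s : nat -> R) (L B : R) : s @ \oo --> L ->
  (forall N, `|\sum_(T < N) s T| <= B) -> L = 0.
Proof.
move=> sL sB.
have B0 : 0 <= B by exact: le_trans (sB 0).
have h := cesaro sL.
apply: (cvg_unique _ h) => //.
apply/cvgrPdist_le => e e0; near=> n.
rewrite sub0r normrN /arithmetic_mean/= normrM ger0_norm ?invr_ge0//.
rewrite /series/= big_mkord ler_pdivrMl//; apply: le_trans (sB _) _.
rewrite -ler_pdivrMr//; apply: le_trans (_ : n%:R <= _); last by rewrite ler_nat.
near: n; exact: nbhs_infty_ger.
Unshelve. all: end_near. Qed.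

Lemma cos_gap (rho x : R) : 0 < rho -> rho <= x -> x <= 2 * pi - rho ->
  1 - cos rho <= 1 - cos x.
Proof.
move=> r0 rx xr; rewrite lerD2l lerN2.
have [xp|px] := leP x pi.
  by rewrite leNgt; apply/negP => h; move: h; rewrite ltr_cos// ?in_itv/=; lra.
rewrite -[cos x]cosN -(cosD2pi (- x)).
rewrite leNgt; apply/negP => h; move: h; rewrite ltr_cos ?in_itv/=; lra.
Qed.

Lemma schwartzR_summable u : schwartzR u ->
  exists B : R, forall T, \sum_(t < T) `|u t.+1%:R| <= B.
Proof.
move=> su; have [M hM] := (smooth_in_bd su) 2.
(* The majorants |M| / ((t + 1) (t + 2)) telescope to exactly this value, which gives the induction
   its form. *)
exists `|M| => T; apply: (@le_trans _ _ (`|M| * (1 - T.+1%:R^-1))); last first.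
  by rewrite ler_piMr// gerBl invr_ge0.
elim: T => [|T IH]; first by rewrite big_ord0 invr1 subrr mulr0.
rewrite big_ord_recr/=.
have step : `|u T.+1%:R| <= `|M| * (T.+1%:R^-1 - T.+2%:R^-1).
  have := hM 0 T.+1%:R; rewrite mulr1 [`|T.+1%:R|]ger0_norm// [1 + _]addrC natr1 => h.
  have T1 : 0 < T.+1%:R :> R by rewrite ltr0n.
  have T2 : 0 < T.+2%:R :> R by rewrite ltr0n.
  have -> : T.+1%:R^-1 - T.+2%:R^-1 = (T.+1%:R * T.+2%:R)^-1 :> R.
    have e : T.+2%:R = T.+1%:R + 1 :> R by rewrite natr1.
    move: T1 T2; rewrite e; move: (T.+1%:R : R) => a a0 a1.
    by field; rewrite !gt_eqF.
  rewrite ler_pdivlMr ?mulr_gt0//.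
  apply: (@le_trans _ _ (`|u T.+1%:R| * T.+2%:R ^+ 2)).
    by rewrite ler_wpM2l// expr2 ler_pM2r// ler_nat.
  exact: le_trans h (ler_norm _).
by have := lerD IH step; rewrite -mulrDr; congr (_ <= _ * _); ring.
Qed.

(* For even u, the sum of u(t) e^(itk) over the integers |t| <= T. *)
Definition lattice_partial_sum u (k : R) T : R :=
  u 0 + \sum_(t < T) 2 * (u t.+1%:R * cos (t.+1%:R * k)).

(* The Cesaro sums of the partial sums are integrals of the Fejer kernel, which
   is bounded away from the support of costr u. *)
Lemma lattice_partial_sum_cvg0 u (rho k : R) : schwartzR u ->
  (forall x, u (- x) = u x) -> 0 < rho -> 2 * rho <= pi ->
  (forall s, rho < `|s| -> costr u s = 0) -> 2 * rho <= `|k| <= pi ->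
  lattice_partial_sum u k @ \oo --> (0 : R).
Proof.
move=> su eu rho0 rhopi supp /andP[rk kpi].
have su' := schwartzR_costr su.
have c0 := @inversion_const_gt0 R.
have eu' x : costr u (- x) = costr u x by exact: costr_even.
have i0 := schwartzR_integrable su'.
(* Inversion at t, with the phase of k absorbed into the cosine; the sine part vanishes because
   [costr u] is even. *)
have uE t : u t * cos (t * k) =
    inversion_const^-1 * \int[mu]_l (costr u l * cos (t * (l - k))).
  have ic := integrable_cosM t i0; have is' := integrable_sinM t i0.
  rewrite (_ : \int[mu]_l _ = \int[mu]_l (cos (t * k) * (costr u l * cos (l * t)) +
     sin (t * k) * (costr u l * sin (l * t)))); last first.
    by apply: eq_Rintegral => l _; rewrite mulrBr cosB [l * t]mulrC; ring.
  rewrite RintegralD//; [|exact: integrable_funZ..].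
  rewrite (RintegralZl _ measurableT ic) (RintegralZl _ measurableT is').
  rewrite -/(sintr _ t) (sintr_even _ su' eu') mulr0 addr0 -/(costr _ t).
  by rewrite costrK// mulrCA mulKf ?gt_eqF// mulrC.
have iD (g : R -> R) (M : R) : continuous g -> (forall x, `|g x| <= M) ->
    mu.-integrable setT (EFin \o (fun l => costr u l * g (l - k))).
  move=> cg gM; apply: (integrable_funM (M := M) measurableT i0) => [|l]; last exact: gM.
  apply: continuous_measurableR => l; apply: (continuous_comp (f := fun l => l - k)).
    by apply: cvgB; [exact: cvg_id|exact: cvg_cst].
  exact: cg.
have ct (t : R) : continuous (fun x : R => cos (t * x)).
  move=> x; apply: (continuous_comp (f := fun x => t * x)); last exact: continuous_cos.
  by apply: cvgMr; exact: cvg_id.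
have sE T : lattice_partial_sum u k T =
    inversion_const^-1 * \int[mu]_l (costr u l * dirichlet T (l - k)) /\
    mu.-integrable setT (EFin \o (fun l => costr u l * dirichlet T (l - k))).
  elim: T => [|T [IH iT]].
    rewrite /lattice_partial_sum big_ord0 addr0 /dirichlet; split.
      have := uE 0; rewrite mul0r cos0 mulr1 => ->; congr (_ * _).
      by apply: eq_Rintegral => l _; rewrite big_ord0 addr0 mul0r cos0.
    by move: i0; congr (_.-integrable _ _); apply/funext => l /=; rewrite big_ord0 addr0 mulr1.
  have iC : mu.-integrable setT (EFin \o (fun l => costr u l * cos (T.+1%:R * (l - k)))).
    exact: (iD (fun x => cos (T.+1%:R * x)) 1 (ct _) (fun x => norm_cos_le1 _)).
  have dE : (fun l => costr u l * dirichlet T.+1 (l - k)) =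
      (fun l => costr u l * dirichlet T (l - k) + 2 * (costr u l * cos (T.+1%:R * (l - k)))).
    by apply/funext => l; rewrite /dirichlet big_ord_recr/= addrA; ring.
  rewrite dE; split; last exact/integrable_funD/integrable_funZ.
  rewrite RintegralD//; last exact: integrable_funZ.
  rewrite (RintegralZl _ measurableT iC) mulrDr -IH mulrCA -uE.
  by rewrite /lattice_partial_sum big_ord_recr/= addrA.
(* The 2 bounds 1 - cos(N x), and 1 - cos rho is a lower bound of 1 - cos(l - k) for l in the
   band. *)
pose B := inversion_const^-1 * (2 / (1 - cos rho) * \int[mu]_l `|costr u l|).
have crho : 0 < 1 - cos rho.
  rewrite subr_gt0 -cos0 ltr_cos ?in_itv/= ?lexx ?pi_ge0//; lra.
have bound N : `|\sum_(T < N) lattice_partial_sum u k T| <= B.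
  have [-> iN] : \sum_(T < N) lattice_partial_sum u k T =
      inversion_const^-1 * \int[mu]_l (costr u l * \sum_(T < N) dirichlet T (l - k)) /\
      mu.-integrable setT (EFin \o (fun l => costr u l * \sum_(T < N) dirichlet T (l - k))).
    elim: N => [|N [IH iN]].
      rewrite big_ord0; split.
        by rewrite Rintegral_eq0 ?mulr0// => l _; rewrite big_ord0 mulr0.
      have := integrable_funZ measurableT 0 i0; congr (_.-integrable _ _).
      by apply/funext => l /=; rewrite big_ord0 mulr0 mul0r.
    have [sN iDN] := sE N.
    have dE : (fun l => costr u l * \sum_(T < N.+1) dirichlet T (l - k)) =
      (fun l => costr u l * \sum_(T < N) dirichlet T (l - k) + costr u l * dirichlet N (l - k)).
      by apply/funext => l; rewrite big_ord_recr/= mulrDr.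
    rewrite dE; split; last exact: integrable_funD.
    by rewrite big_ord_recr/= IH sN RintegralD// mulrDr.
  have ci0 : 0 <= (@inversion_const R)^-1 by rewrite invr_ge0 ltW.
  rewrite normrM (ger0_norm ci0) ler_wpM2l//.
  apply: le_trans (le_normr_Rintegral measurableT iN) _.
  rewrite -(RintegralZl _ measurableT (integrable_norm i0))//.
  apply: le_Rintegral => //; first exact: integrable_norm.
    exact/integrable_funZ/integrable_norm.
  move=> l _ /=; have [lr|rl] := ltP rho `|l|; first by rewrite supp// mul0r normr0 mulr0.
  rewrite normrM mulrC ler_wpM2r//.
  (* From |l| <= rho and 2 rho <= |k| <= pi, the distance |l - k| lies between rho and pi + rho, and
     pi + rho <= 2 pi - rho. *)
  have gap : 1 - cos rho <= 1 - cos (l - k).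
    have [kl|lk] := leP 0 (l - k).
      apply: cos_gap => //.
        have := lerB_dist k l; rewrite distrC (ger0_norm kl); lra.
      by have := ler_normB l k; rewrite (ger0_norm kl); lra.
    rewrite -[cos (l - k)]cosN; apply: cos_gap => //.
      have := lerB_dist k l; rewrite distrC (ltr0_norm lk); lra.
    by have := ler_normB l k; rewrite (ltr0_norm lk); lra.
  have gap0 : 0 < 1 - cos (l - k) by exact: lt_le_trans gap.
  have := fejer_telescope N (l - k).
  move/(congr1 (fun x => x / (1 - cos (l - k)))); rewrite mulrAC mulfV ?gt_eqF// mul1r => ->.
  rewrite normrM normfV (gtr0_norm gap0).
  apply: ler_pM; [by []|by rewrite invr_ge0 ltW| |by rewrite lef_pV2].
    by have := cos_le1 (N%:R * (l - k)); have := cos_geN1 (N%:R * (l - k)); rewrite ler_norml; lra.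
(* Bounded Cesaro sums identify the limit but do not provide it; its existence comes from absolute
   summability. *)
have cv : cvgn (lattice_partial_sum u k).
  have [D hD] := schwartzR_summable su.
  apply: is_cvgD; first exact: is_cvg_cst.
  rewrite (_ : (fun T => _) = series (fun t => 2 * (u t.+1%:R * cos (t.+1%:R * k)))); last first.
    by apply/funext => T; rewrite /series/= big_mkord.
  apply: normed_cvg; apply: nondecreasing_is_cvgn.
    by apply: nondecreasing_series => n *; exact: normr_ge0.
  exists (2 * D) => _ [T _ <-].
  rewrite /normed_series_of /series/= big_mkord; apply: (@le_trans _ _ (2 * \sum_(t < T) `|u t.+1%:R|)).
    rewrite mulr_sumr; apply: ler_sum => t _; rewrite !normrM ger0_norm// ler_wpM2l//.
    by rewrite ler_piMr// norm_cos_le1.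
  by rewrite ler_wpM2l.
have /cvg_ex[L hL] := cv.
by rewrite -(bounded_sums_cvg0 hL bound).
Qed.

Lemma lattice_partial_sum_bounded u : schwartzR u ->
  exists B : R, forall k T, `|lattice_partial_sum u k T| <= B.
Proof.
move=> su; have [D hD] := schwartzR_summable su.
exists (`|u 0| + 2 * D) => k T.
apply: le_trans (ler_normD _ _) _; rewrite lerD2l.
apply: le_trans (ler_norm_sum _ _ _) _.
apply: (@le_trans _ _ (2 * \sum_(t < T) `|u t.+1%:R|)); last by rewrite ler_wpM2l.
rewrite mulr_sumr; apply: ler_sum => t _; rewrite !normrM ger0_norm// ler_wpM2l//.
by rewrite ler_piMr// norm_cos_le1.
Qed.

End lattice_sums.

(** * Products of one-variable functions *)

Section product_functions.
Context {R : realType} (n : nat).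
Local Open Scope classical_set_scope.
Local Open Scope complex_scope.
Implicit Types (a b : 'I_n -> R -> R) (x : 'rV[R]_n).

Definition prodf a x : R := \prod_i a i (x ord0 i).

Definition smooth1 (f : R -> R) : Prop := forall k (t : R), derivable (f^`(k)) t 1.

Lemma smooth_in_smooth1 bd (F : nat -> R -> R) m : smooth_in bd F -> smooth1 (F m).
Proof.
move=> sF k x.
exact: (smooth_in_derivable (n := m) (x := x) (smooth_in_derive1n k sF)).
Qed.

Lemma smooth1_derive1n f k : smooth1 f -> smooth1 (f^`(k)).
Proof.
move=> sf j x; rewrite /derive1n -iterD; exact: sf.
Qed.

Definition derive_at a (s : seq 'I_n) (i : 'I_n) : R -> R := (a i)^`(count_mem i s).

Lemma smooth1_derive_at a s : (forall i, smooth1 (a i)) ->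
  forall i, smooth1 (derive_at a s i).
Proof. by move=> sa i; exact: smooth1_derive1n. Qed.

Lemma differentiable_prodf a x : (forall i, smooth1 (a i)) ->
  differentiable (prodf a) x.
Proof.
move=> sa; rewrite /prodf; elim: (index_enum _) => [|i s IH].
  under eq_fun do rewrite big_nil.
  exact: differentiable_cst.
under eq_fun do rewrite big_cons.
apply: differentiableM => //.
apply: (@differentiable_comp _ _ _ _ (fun y : 'rV[R]_n => y ord0 i) (a i)).
  exact: differentiable_coord.
apply/derivable1_diffP; exact: (sa i 0).
Qed.

Lemma derive_prodf a (j : 'I_n) x : (forall i, smooth1 (a i)) ->
  'D_(delta_mx ord0 j) (prodf a) x = prodf (derive_at a [:: j]) x.
Proof.
move=> sa; rewrite /derive.
pose c := \prod_(i | i != j) a i (x ord0 i).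
rewrite (_ : (fun h => _) = (fun h : R => c * (h^-1 *:
    ((a j \o shift (x ord0 j)) (h *: (1 : R)) - a j (x ord0 j))))); last first.
  apply/funext => h; rewrite /= /prodf (bigD1 j)//= [X in _ - X](bigD1 j)//=.
  rewrite !mxE !eqxx mulr1 [h%:A]mulr1.
  rewrite (eq_bigr (fun i => a i (x ord0 i))) -/c.
    by rewrite -/c /GRing.scale/=; ring.
  by move=> i ij; rewrite !mxE eqxx (negbTE ij) mulr0 add0r.
apply: cvg_lim => //.
rewrite /prodf (bigD1 j)//= /derive_at/= eqxx /=.
rewrite (eq_bigr (fun i => a i (x ord0 i))) -/c; last first.
  by move=> i ij; rewrite eq_sym (negbTE ij).
rewrite mulrC; apply: cvgMr.
rewrite derive1E; exact: (sa j 0 (x ord0 j)).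
Qed.

Lemma pderiv_prodf a s : (forall i, smooth1 (a i)) ->
  pderiv s (prodf a) = prodf (derive_at a s).
Proof.
move=> sa; elim: s => [|j s IH] /=; first by congr prodf; apply/funext.
rewrite IH; apply/funext => x; rewrite derive_prodf; last exact: smooth1_derive_at.
congr (prodf _ x); apply/funext => i; rewrite /derive_at/= addn0.
by rewrite /derive1n -iterD.
Qed.

Lemma rsmooth_prodf a : (forall i, smooth1 (a i)) -> rsmooth (prodf a).
Proof.
move=> sa s x; rewrite pderiv_prodf//; apply: differentiable_prodf.
exact: smooth1_derive_at.
Qed.

Lemma pderiv_cst (c : R) s : pderiv s (cst c : 'rV[R]_n -> R) = cst (if s is [::] then c else 0).
Proof.
elim: s => [//|i s IH] /=; rewrite IH; apply/funext => x.
exact: derive_cst.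
Qed.

Lemma rsmooth_cst (c : R) : rsmooth (cst c : 'rV[R]_n -> R).
Proof. by move=> s x; rewrite pderiv_cst; exact: differentiable_cst. Qed.

Lemma pderivB (f g : 'rV[R]_n -> R) s : rsmooth f -> rsmooth g ->
  pderiv s (fun x => f x - g x) = (fun x => pderiv s f x - pderiv s g x).
Proof.
move=> sf sg; elim: s => [//|i s IH] /=; rewrite IH; apply/funext => x.
by rewrite (@deriveB _ _ _ (pderiv s f) (pderiv s g))//; exact: diff_derivable.
Qed.

Lemma rsmoothB (f g : 'rV[R]_n -> R) : rsmooth f -> rsmooth g ->
  rsmooth (fun x => f x - g x).
Proof.
move=> sf sg s x; rewrite pderivB//.
exact: (@differentiableB _ _ _ (pderiv s f) (pderiv s g)).
Qed.

Lemma smooth_real (f : 'rV[R]_n -> R) : rsmooth f -> smooth (fun x => (f x)%:C).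
Proof. by move=> sf; split => //; exact: (rsmooth_cst 0). Qed.

Lemma schwartz_bound_real (f : 'rV[R]_n -> R) N M : 0 <= M ->
  (forall (s : seq 'I_n) x, (size s <= N)%N ->
    (1 + enorm x) ^+ N * `|pderiv s f x| <= M) ->
  schwartz_bound N (fun x => (f x)%:C) M.
Proof.
move=> M0 h s x sN; split; first exact: h.
have -> : (fun y => complex.Im (f y)%:C) = cst 0 by [].
by rewrite pderiv_cst /=; case: s {sN} => [|? ?] /=; rewrite normr0 mulr0.
Qed.

Lemma enorm_ge0 x : 0 <= enorm x.
Proof. exact: sqrtr_ge0. Qed.

Lemma enorm_le_sum x : enorm x <= \sum_i `|x ord0 i|.
Proof.
have s0 : 0 <= \sum_i `|x ord0 i| by apply: sumr_ge0.
rewrite /enorm -[leRHS]ger0_norm// -sqrtr_sqr ler_wsqrtr//.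
rewrite /dot; elim: (index_enum _) => [|i s IH]; first by rewrite !big_nil expr0n.
rewrite !big_cons sqrrD -!expr2 real_normK ?num_real//.
rewrite [leRHS]addrAC -addrA lerD2l; apply: le_trans IH _.
by rewrite lerDl mulrn_wge0// mulr_ge0// sumr_ge0.
Qed.

(** Replaces the Euclidean weight by a product weight, so that multivariate Schwartz bounds factor
    over the coordinates. *)
Lemma onePenorm_le_prod x : 1 + enorm x <= \prod_i (1 + `|x ord0 i|).
Proof.
apply: (@le_trans _ _ (1 + \sum_i `|x ord0 i|)); first by rewrite lerD2l enorm_le_sum.
suff: 1 + \sum_i `|x ord0 i| <= \prod_i (1 + `|x ord0 i|) /\ 1 <= \prod_i (1 + `|x ord0 i|) by case.
elim: (index_enum _) => [|i s [IH1 IH2]]; first by rewrite !big_nil addr0.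
rewrite !big_cons; have := normr_ge0 (x ord0 i) => i0; split; last nra.
by rewrite mulrDl mul1r addrCA addrC; apply: lerD => //; nra.
Qed.

(** A difference of products is telescoped factor by factor. Errors are measured relative to the
    majorants [P i], so that the weights come out as a single product. *)
Lemma normr_prodB_le (p q P : 'I_n -> R) (e : R) : 0 <= e ->
  (forall i, `|p i| <= P i) -> (forall i, `|q i| <= P i) ->
  (forall i, `|p i - q i| <= e * P i) ->
  `|\prod_i p i - \prod_i q i| <= n%:R * e * \prod_i P i.
Proof.
move=> e0 pP qP pq.
have P0 i : 0 <= P i by exact: le_trans (pP i).
suff : `|\prod_i p i - \prod_i q i| <= (size (index_enum 'I_n))%:R * e * \prod_i P i /\
    `|\prod_i q i| <= \prod_i P i.
  by rewrite [size _](_ : _ = n) => [[]|]; last by rewrite /index_enum -enumT size_enum_ord.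
elim: (index_enum _) => [|i s [IH1 IH2]].
  by rewrite !big_nil subrr normr0 !mul0r normr1.
rewrite !big_cons; split; last by rewrite normrM ler_pM.
have -> : p i * \prod_(j <- s) p j - q i * \prod_(j <- s) q j =
  p i * (\prod_(j <- s) p j - \prod_(j <- s) q j) + (p i - q i) * \prod_(j <- s) q j by ring.
apply: le_trans (ler_normD _ _) _; rewrite !normrM /= -natr1.
apply: (@le_trans _ _ (P i * ((size s)%:R * e * \prod_(j <- s) P j) + (e * P i) * \prod_(j <- s) P j)).
  by apply: lerD; apply: ler_pM.
by rewrite le_eqVlt; apply/orP; left; apply/eqP; ring.
Qed.

(** [schwartz_bound] asks for one constant valid for all orders up to N, while [smooth_in] provides
    one for each order. *)
Lemma rapidly_derive1n_bound w (F : nat -> R -> R) N K : (forall n, 0 <= w n) ->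
  rapidly w F -> exists M : R, 0 <= M /\ forall k m t, (k <= K)%N ->
    `|(F m)^`(k) t| * (1 + `|t|) ^+ N <= M * w m.
Proof.
move=> w0 rF; elim: K => [|K [M [M0 hM]]].
  have [M hM] := smooth_in_bd rF N; exists `|M|; split => // k m t.
  rewrite leqn0 => /eqP ->; apply: le_trans (hM m t) _.
  by rewrite ler_wpM2r// ler_norm.
have [M' hM'] := smooth_in_bd (smooth_in_derive1n K.+1 rF) N.
exists (M + `|M'|); split; first exact: addr_ge0.
move=> k m t; rewrite leq_eqVlt => /orP[/eqP ->|kK]; rewrite mulrDl.
  apply: le_trans (hM' m t) _; apply: ler_wpDl; first exact: mulr_ge0.
  by rewrite ler_wpM2r// ler_norm.
by apply: le_trans (hM k m t kK) _; rewrite lerDl mulr_ge0.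
Qed.

Lemma derive1nB (f g : R -> R) k : smooth1 f -> smooth1 g ->
  derive1n k (fun t => f t - g t) = (fun t => derive1n k f t - derive1n k g t).
Proof.
move=> sf sg; elim: k => [//|k IH].
have d h : smooth1 h -> forall t : R, is_derive t (1 : R) (h^`(k)) (derive1n k.+1 h t).
  by move=> sh t; rewrite derive1nS derive1E; apply: derivableP; exact: sh.
rewrite derive1nS IH; apply: is_derive_derive1 => t.
exact: is_deriveB (d f sf t) (d g sg t).
Qed.

Lemma count_mem_le (s : seq 'I_n) i N : (size s <= N)%N -> (count_mem i s <= N)%N.
Proof. by apply: leq_trans; exact: count_size. Qed.

Lemma schwartz_prodf_weight (g : 'I_n -> R -> R) (P : R) x N :
  (forall i t, `|g i t| * (1 + `|t|) ^+ N <= P) ->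
  (1 + enorm x) ^+ N * `|\prod_i g i (x ord0 i)| <= P ^+ n.
Proof.
move=> gP; rewrite normr_prod.
have h : (1 + enorm x) ^+ N <= (\prod_i (1 + `|x ord0 i|)) ^+ N.
  apply: lerXn2r; rewrite ?nnegrE ?addr_ge0 ?enorm_ge0//.
    by apply: prodr_ge0 => i _; rewrite addr_ge0.
  exact: onePenorm_le_prod.
apply: le_trans (ler_wpM2r _ h) _; first by apply: prodr_ge0.
rewrite -prodrXl mulrC -big_split/=.
rewrite -[X in P ^+ X](card_ord n) -prodr_const; apply: ler_prod => i _.
by rewrite gP andbT mulr_ge0// exprn_ge0// addr_ge0.
Qed.

Lemma schwartz_prodf (f : R -> R) : schwartzR f ->
  schwartz (fun x => (prodf (fun=> f) x)%:C).
Proof.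
move=> sf; have s1 : smooth1 f := smooth_in_smooth1 (m := 0) sf.
split; first by apply: smooth_real; exact: rsmooth_prodf.
move=> N; have [M [M0 hM]] := rapidly_derive1n_bound N N (fun=> ler01) sf.
exists (M ^+ n); apply: schwartz_bound_real; first exact: exprn_ge0.
move=> s x sN; rewrite pderiv_prodf//.
apply: schwartz_prodf_weight => i t.
by have := hM (count_mem i s) 0 t (count_mem_le i sN); rewrite mulr1.
Qed.

Lemma schwartz_bound_prodfB (F : nat -> R -> R) (g : R -> R) N :
  rapidly unit_rate F -> schwartzR g ->
  rapidly inv_rate (fun m t => F m t - g t) ->
  exists M : R, forall m,
    schwartz_bound N (fun x => (prodf (fun=> F m) x - prodf (fun=> g) x)%:C)
      (M * inv_rate m).
Proof.
move=> rF sg rB.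
have [M1 [M10 h1]] := rapidly_derive1n_bound N N (fun=> ler01) rF.
have [M2 [M20 h2]] := rapidly_derive1n_bound N N (fun=> ler01) sg.
have [M3 [M30 h3]] := rapidly_derive1n_bound N N (@inv_rate_ge0 R) rB.
(* A common majorant for both products. The summand 1 ensures 1 <= [M], so the differences are also
   at most [M3 * inv_rate m] times the majorants [M * W i]. *)
pose M := M1 + M2 + M3 + 1.
exists (n%:R * M3 * M ^+ n) => m.
have sF : smooth1 (F m) by exact: smooth_in_smooth1 rF.
have sg1 : smooth1 g := smooth_in_smooth1 (m := 0) sg.
have r0 := @inv_rate_ge0 R m.
have M0 : 0 <= M by rewrite !addr_ge0.
apply: schwartz_bound_real; first by rewrite !mulr_ge0 ?exprn_ge0.
move=> s x sN; rewrite pderivB; [|exact: rsmooth_prodf..].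
rewrite !pderiv_prodf// /prodf.
pose W i := (1 + `|x ord0 i|) ^- N.
have W0 i : 0 < W i by rewrite invr_gt0 onePnormX_gt0.
have key (y c : R) i : `|y| * (1 + `|x ord0 i|) ^+ N <= c -> `|y| <= c * W i.
  by rewrite /W ler_pdivlMr// onePnormX_gt0.
have cm i : (count_mem i s <= N)%N by exact: count_mem_le.
have M1M : M1 <= M by rewrite /M; lra.
have M2M : M2 <= M by rewrite /M; lra.
have M1' : 1 <= M by rewrite /M; lra.
have := @normr_prodB_le (fun i => derive_at (fun=> F m) s i (x ord0 i))
  (fun i => derive_at (fun=> g) s i (x ord0 i)) (fun i => M * W i) (M3 * inv_rate m)
  (mulr_ge0 M30 r0).
have H1 i : `|derive_at (fun=> F m) s i (x ord0 i)| <= M * W i.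
  by apply: key; apply: le_trans (h1 _ m _ (cm i)) _; rewrite mulr1.
have H2 i : `|derive_at (fun=> g) s i (x ord0 i)| <= M * W i.
  by apply: key; apply: le_trans (h2 _ 0 _ (cm i)) _; rewrite mulr1.
have H3 i : `|derive_at (fun=> F m) s i (x ord0 i) - derive_at (fun=> g) s i (x ord0 i)| <=
    M3 * inv_rate m * (M * W i).
  rewrite mulrA; apply: key; have := h3 _ m (x ord0 i) (cm i).
  rewrite derive1nB// => /le_trans; apply.
  by rewrite ler_peMr// mulr_ge0.
move=> /(_ H1 H2 H3) => /(ler_wpM2l (exprn_ge0 N (addr_ge0 ler01 (enorm_ge0 x)))) /le_trans; apply.
rewrite big_split/= prodr_const card_ord.
have hW : (1 + enorm x) ^+ N * \prod_i W i <= 1.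
  rewrite /W prodfV prodrXl ler_pdivrMr ?mul1r; last first.
    by rewrite exprn_gt0//; apply: prodr_gt0 => i _; rewrite ltr_pwDl.
  apply: lerXn2r; rewrite ?nnegrE ?addr_ge0 ?enorm_ge0//.
    by apply: prodr_ge0 => i _; rewrite addr_ge0.
  exact: onePenorm_le_prod.
rewrite [leLHS](_ : _ = (n%:R * M3 * M ^+ n * inv_rate m) * ((1 + enorm x) ^+ N * \prod_i W i)); last ring.
by rewrite ler_piMr// !mulr_ge0 ?exprn_ge0.
Qed.

Lemma compact_support_prodf (f : R -> R) (r : R) : (forall t, r < `|t| -> f t = 0) ->
  (0 < n)%N -> compact (closure [set x | (prodf (fun=> f) x)%:C != 0]).
Proof.
move=> f0 n0.
have cb : compact [set x : 'rV[R]_n | forall i, `[- r, r]%classic (x ord0 i)].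
  by apply: (@rV_compact _ _ (fun=> `[- r, r]%classic)) => i; exact: segment_compact.
have clb : closed [set x : 'rV[R]_n | forall i, `[- r, r]%classic (x ord0 i)].
  apply: compact_closed => //; exact: norm_hausdorff.
apply: subclosed_compact cb _; first exact: closed_closure.
rewrite [X in _ `<=` X]((closure_id _).1 clb); apply: closure_subset => x /= h i.
rewrite /= in_itv/= -ler_norml leNgt; apply/negP => ri; move: h.
by rewrite /prodf (bigD1 i)//= f0// mul0r eqxx.
Qed.

Lemma test_function_prodf (f : R -> R) (r : R) : smooth1 f ->
  (forall t, r < `|t| -> f t = 0) -> (0 < n)%N ->
  test_function (fun x => (prodf (fun=> f) x)%:C).
Proof.
move=> sf f0 n0; split; last exact: compact_support_prodf f0 n0.
by apply: smooth_real; exact: rsmooth_prodf.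
Qed.

Lemma measurable_prodf (a : 'I_n -> R -> R) : (forall i, measurable_fun setT (a i)) ->
  measurable_fun setT (prodf a).
Proof.
move=> ma; apply: measurable_prod => i _.
by apply: (measurableT_comp (ma i)); exact: measurable_coor.
Qed.

End product_functions.

(** * Integrals, transforms and correlations of products over the coordinates *)

Section product_integrals.
Context {R : realType}.
Local Open Scope classical_set_scope.
Local Open Scope complex_scope.
Local Notation mu := (@lebesgue_measure R).

Lemma row_cons_ord0 n (p : measurableTypeR R * 'rV[R]_n) :
  row_cons p ord0 ord0 = p.1.
Proof. by have /(congr1 fst) := row_consK p. Qed.

Lemma row_cons_lift n (p : measurableTypeR R * 'rV[R]_n) (i : 'I_n) :
  row_cons p ord0 (lift ord0 i) = p.2 ord0 i.
Proof.
have /(congr1 snd)/(congr1 (fun v : 'rV[R]_n => v ord0 i)) := row_consK p.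
by rewrite mxE => <-; congr (row_cons p _ _); exact/val_inj.
Qed.

Lemma Rintegral_lebesgue_rowS n (g : 'rV[R]_n.+1 -> R) : measurable_fun setT g ->
  (mu \x lebesgue_row R n)%E.-integrable setT (EFin \o (g \o @row_cons R n)) ->
  (lebesgue_row R n.+1).-integrable setT (EFin \o g) /\
  \int[lebesgue_row R n.+1]_x g x =
    \int[(mu \x lebesgue_row R n)%E]_p g (row_cons p).
Proof.
move=> mg ig; split.
  apply: (@integrable_pushforward _ _ _ _ _ (@row_cons R n) (@measurable_row_cons R n)) => //.
  exact/measurable_EFinP.
rewrite /Rintegral; congr fine.
rewrite (@integral_pushforward _ _ _ _ _ (@row_cons R n) (@measurable_row_cons R n))//.
exact/measurable_EFinP.
Qed.

Lemma Rintegral_lebesgue_row0 (g : 'rV[R]_0 -> R) :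
  (lebesgue_row R 0).-integrable setT (EFin \o g) /\
  \int[lebesgue_row R 0]_x g x = g 0.
Proof.
have mg : measurable_fun setT g.
  move=> _ Y mY; rewrite setTI.
  have [g0|g0] := pselect (Y (g 0)).
    rewrite (_ : _ @^-1` _ = setT)//; apply/seteqP; split => // x _ /=.
    by rewrite [x]thinmx0.
  rewrite (_ : _ @^-1` _ = set0)//; apply/seteqP; split => // x /=.
  by rewrite [x]thinmx0.
have e (h : 'rV[R]_0 -> \bar R) : measurable_fun setT h ->
    (\int[lebesgue_row R 0]_x h x = h (0%R : 'rV[R]_0))%E.
  by move=> mh; rewrite /= integral_dirac// diracE mem_set// mul1e.
split; last by rewrite /Rintegral e//; exact/measurable_EFinP.
apply/integrableP; split; first exact/measurable_EFinP.
rewrite e ?ltry//; apply: measurableT_comp => //; exact/measurable_EFinP.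
Qed.

(* The two integrals are proved together by induction on the dimension, through
   the addition formulas. *)
Lemma Rintegral_prodf_cos n (f th : 'I_n -> R -> R) :
  (forall i, mu.-integrable setT (EFin \o f i)) ->
  (forall i, measurable_fun setT (th i)) ->
  (forall i, \int[mu]_t (f i t * sin (th i t)) = 0) ->
  let C := fun x : 'rV[R]_n => prodf f x * cos (\sum_i th i (x ord0 i)) in
  let S := fun x : 'rV[R]_n => prodf f x * sin (\sum_i th i (x ord0 i)) in
  [/\ (lebesgue_row R n).-integrable setT (EFin \o C),
      (lebesgue_row R n).-integrable setT (EFin \o S),
      \int[lebesgue_row R n]_x C x = \prod_i \int[mu]_t (f i t * cos (th i t)) &
      \int[lebesgue_row R n]_x S x = 0].
Proof.
elim: n f th => [|n IH] f th itf mth s0 C S.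
  have [iC eC] := Rintegral_lebesgue_row0 C; have [iS eS] := Rintegral_lebesgue_row0 S.
  split => //.
    by rewrite eC /C /prodf !big_ord0 cos0 mulr1.
  by rewrite eS /S /prodf !big_ord0 sin0 mulr0.
pose f' i := f (lift ord0 i); pose th' i := th (lift ord0 i).
have [iC iS eC eS] := IH f' th' (fun i => itf _) (fun i => mth _) (fun i => s0 _).
set C' := (fun x => _) in iC eC; set S' := (fun x => _) in iS eS.
have mcos : measurable_fun setT (@cos R) := continuous_measurableR (@continuous_cos R).
have msin : measurable_fun setT (@sin R) := continuous_measurableR (@continuous_sin R).
have mf i : measurable_fun setT (f i) := integrable_measurableR (itf i).
pose fc t := f ord0 t * cos (th ord0 t); pose fs t := f ord0 t * sin (th ord0 t).
have ifc : mu.-integrable setT (EFin \o fc).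
  apply: (integrable_funM (M := 1) measurableT (itf ord0)); first exact: measurableT_comp mcos (mth ord0).
  by move=> t; exact: norm_cos_le1.
have ifs : mu.-integrable setT (EFin \o fs).
  apply: (integrable_funM (M := 1) measurableT (itf ord0)); first exact: measurableT_comp msin (mth ord0).
  by move=> t; exact: norm_sin_le1.
have pw p : prodf f (row_cons p) = f ord0 p.1 * prodf f' p.2.
  rewrite /prodf big_ord_recl row_cons_ord0; congr (_ * _).
  by apply: eq_bigr => i _; rewrite row_cons_lift.
have sw p : \sum_i th i (row_cons p ord0 i) = th ord0 p.1 + \sum_i th' i (p.2 ord0 i).
  rewrite big_ord_recl row_cons_ord0; congr (_ + _).
  by apply: eq_bigr => i _; rewrite row_cons_lift.
have mK : measurable_fun setT (fun z : measurableTypeR R * 'rV[R]_n => 1 : R).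
  exact: measurable_cst.
have bd (x : measurableTypeR R) (y : 'rV[R]_n) : `|1 : R| <= 1 by rewrite normr1.
have prod_int (a : R -> R) (b : 'rV[R]_n -> R) :
    mu.-integrable setT (EFin \o a) ->
    (lebesgue_row R n).-integrable setT (EFin \o b) ->
    (mu \x lebesgue_row R n)%E.-integrable setT (EFin \o (fun p => a p.1 * b p.2)) /\
    \int[(mu \x lebesgue_row R n)%E]_p (a p.1 * b p.2) =
      \int[mu]_t a t * \int[lebesgue_row R n]_x b x.
  move=> ia ib.
  have h1 := integrable_prod_kernel (K := fun _ _ => 1) ia ib mK bd.
  have h2 := Rintegral_prod_kernel1 (K := fun _ _ => 1) ia ib mK bd.
  have e : (fun p : R * 'rV[R]_n => a p.1 * (b p.2 * 1)) = (fun p => a p.1 * b p.2).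
    by apply/funext => p; rewrite mulr1.
  rewrite e in h1 h2; split => //; rewrite h2.
  under [X in \int[_]_x (_ * X)]eq_Rintegral do rewrite mulr1.
  by rewrite RintegralZr.
have mx (g : 'I_n.+1 -> R -> R) : (forall i, measurable_fun setT (g i)) ->
    measurable_fun setT (fun x : 'rV[R]_n.+1 => \sum_i g i (x ord0 i)).
  move=> mg; apply: measurable_sum => i.
  by apply: (measurableT_comp (mg i)); exact: measurable_coor.
have mC : measurable_fun setT C.
  apply: measurable_funM; first exact: measurable_prodf.
  exact: measurableT_comp mcos (mx _ mth).
have mS : measurable_fun setT S.
  apply: measurable_funM; first exact: measurable_prodf.
  exact: measurableT_comp msin (mx _ mth).
have [icC ecC] := prod_int _ _ ifc iC; have [isS esS] := prod_int _ _ ifs iS.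
have [icS ecS] := prod_int _ _ ifc iS; have [isC esC] := prod_int _ _ ifs iC.
have CE : C \o @row_cons R n = fun p => fc p.1 * C' p.2 - fs p.1 * S' p.2.
  by apply/funext => p; rewrite /C /= pw sw cosD /fc /fs /C' /S'; ring.
have SE : S \o @row_cons R n = fun p => fs p.1 * C' p.2 + fc p.1 * S' p.2.
  by apply/funext => p; rewrite /S /= pw sw sinD /fc /fs /C' /S'; ring.
have [|iC1 eC1] := Rintegral_lebesgue_rowS mC.
  by rewrite CE; exact: integrable_funB.
have [|iS1 eS1] := Rintegral_lebesgue_rowS mS.
  by rewrite SE; exact: integrable_funD.
split => //.
- rewrite eC1 [LHS](_ : _ = \int[(mu \x lebesgue_row R n)%E]_p (fc p.1 * C' p.2 - fs p.1 * S' p.2)).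
    by rewrite RintegralB// ecC esS eC eS mulr0 subr0 big_ord_recl.
  by apply: eq_Rintegral => p _; rewrite -[LHS]/((C \o @row_cons R n) p) CE.
- rewrite eS1 [LHS](_ : _ = \int[(mu \x lebesgue_row R n)%E]_p (fs p.1 * C' p.2 + fc p.1 * S' p.2)).
    by rewrite RintegralD// ecS esC eS mulr0 addr0 {1}/fs s0 mul0r.
  by apply: eq_Rintegral => p _; rewrite -[LHS]/((S \o @row_cons R n) p) SE.
Qed.

Lemma Rintegral_prodf n (f : 'I_n -> R -> R) :
  (forall i, mu.-integrable setT (EFin \o f i)) ->
  (lebesgue_row R n).-integrable setT (EFin \o prodf f) /\
  \int[lebesgue_row R n]_x prodf f x = \prod_i \int[mu]_t f i t.
Proof.
move=> itf.
have m0 (i : 'I_n) : measurable_fun setT (fun _ : R => 0 : R) by exact: measurable_cst.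
have s0 (i : 'I_n) : \int[mu]_t (f i t * sin 0) = 0.
  by apply: Rintegral_eq0 => t _; rewrite sin0 mulr0.
have [iC _ eC _] := @Rintegral_prodf_cos n f (fun _ _ => 0) itf m0 s0.
have e : (fun x : 'rV[R]_n => prodf f x * cos (\sum_(i < n) 0)) = prodf f.
  by apply/funext => x; rewrite big1// cos0 mulr1.
rewrite e in iC; split => //.
rewrite [LHS](_ : _ = \int[lebesgue_row R n]_x (prodf f x * cos (\sum_(i < n) 0))).
  rewrite eC; apply: eq_bigr => i _; apply: eq_Rintegral => t _.
  by rewrite cos0 mulr1.
by apply: eq_Rintegral => x _; rewrite big1// cos0 mulr1.
Qed.

Lemma dotC n (x y : 'rV[R]_n) : dot x y = dot y x.
Proof. by apply: eq_bigr => i _; rewrite mulrC. Qed.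

Lemma fourier_prodf n (f : R -> R) (x : 'rV[R]_n) : schwartzR f ->
  (forall t, f (- t) = f t) ->
  fourier (fun k => (prodf (fun=> f) k)%:C) x = (prodf (fun=> costr f) x)%:C.
Proof.
move=> sf ef.
have itf := schwartzR_integrable sf.
have mth (i : 'I_n) : measurable_fun setT (fun t : R => t * x ord0 i).
  by apply: measurable_funM => //.
have [_ _ eC eS] := @Rintegral_prodf_cos n (fun=> f) (fun i t => t * x ord0 i)
  (fun=> itf) mth (fun i => sintr_even (x ord0 i) sf ef).
rewrite /fourier /cintegral /prodf -eC.
congr (_ +i* _).
  apply: eq_Rintegral => k _ /=.
  by rewrite mul0r subr0 cosN dotC.
rewrite -[RHS]oppr0 -[in RHS]eS -mulN1r -RintegralZl//.
  by apply: eq_Rintegral => k _ /=; rewrite mul0r addr0 sinN mulrN mulN1r dotC.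
by have [_ ->] := @Rintegral_prodf_cos n (fun=> f) (fun i t => t * x ord0 i)
  (fun=> itf) mth (fun i => sintr_even (x ord0 i) sf ef).
Qed.

Lemma cross_correlation_prodf n (f : R -> R) (x : 'rV[R]_n) :
  schwartzR f ->
  cross_correlation (fun k => (prodf (fun=> f) k)%:C) (fun k => (prodf (fun=> f) k)%:C) x
    = (prodf (fun=> corr f f) x)%:C.
Proof.
move=> sf; have [M hM] := rapidly_bounded 0 sf.
have [_ e] := @Rintegral_prodf n (fun i t => f (x ord0 i + t) * f t)
  (fun i => integrable_corr (x ord0 i) (schwartzR_continuous sf) hM (schwartzR_integrable sf)).
rewrite /cross_correlation /cintegral; congr (_ +i* _).
  rewrite [RHS](_ : _ = \prod_i \int[mu]_t (f (x ord0 i + t) * f t))// -e; apply: eq_Rintegral => t _ /=.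
  rewrite oppr0 mulr0 subr0 /prodf -big_split/=.
  by apply: eq_bigr => i _; rewrite mxE.
by apply: Rintegral_eq0 => t _ /=; rewrite mul0r oppr0 mulr0 addr0.
Qed.

End product_integrals.

(** * Linear statistics with vanishing variance *)

Section point_process_integrals.
Context {R : realType} dX (X : measurableType dX) dT (T : measurableType dT).
Local Open Scope classical_set_scope.
Local Open Scope complex_scope.
Variables (P : probability T R) (Xi : R.-ker T ~> X).

Lemma cintegral_real d (Y : measurableType d) (m : {measure set Y -> \bar R})
    (D : set Y) (f : Y -> R) :
  cintegral m D (fun x => (f x)%:C) = (\int[m]_(x in D) f x)%:C.
Proof. by rewrite /cintegral; congr (_ +i* _); apply: Rintegral_eq0. Qed.

Lemma ccov_real (Y : T -> R) :
  ccov P (fun w => (Y w)%:C) (fun w => (Y w)%:C) =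
  (\int[P]_w ((Y w - \int[P]_w Y w) ^+ 2))%:C.
Proof.
rewrite /ccov /= cintegral_real -[RHS]cintegral_real; apply: (congr1 (cintegral P setT)).
apply/funext => w; rewrite (Rintegral_eq0 _ _ (f := fun=> 0))// subr0 oppr0.
by apply/eqP; rewrite eq_complex/= !subr0 !mulr0 !mul0r subr0 addr0 -expr2 !eqxx.
Qed.

Variable mu : {measure set X -> \bar R}.
Variable rho : R.
Hypothesis rho0 : 0 <= rho.
Hypothesis intensity : has_intensity P Xi mu rho.

Let mXi U : measurable U -> measurable_fun setT (Xi ^~ U).
Proof. exact: measurable_kernel. Qed.

Import HBNNSimple.

Let campbell_nnsfun (h : {nnsfun X >-> R}) :
  (\int[P]_w \int[Xi w]_x (h x)%:E = rho%:E * \int[mu]_x (h x)%:E)%E.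
Proof.
have E (m : {measure set X -> \bar R}) :
    (\int[m]_x (h x)%:E = \sum_(r \in range h) r%:E * m (h @^-1` [set r]))%E.
  by rewrite integralT_nnsfun sintegralE.
have pos (m : {measure set X -> \bar R}) (r : R) :
    (0 <= r%:E * m (h @^-1` [set r]))%E.
  have [r0|r0] := leP 0 r; first by rewrite mule_ge0.
  by rewrite preimage_nnfun0// measure0 mule0.
rewrite E; under eq_integral do rewrite E.
rewrite ge0_integral_fsum//; last first.
  by move=> r; apply: measurable_funeM; exact: mXi.
rewrite ge0_mule_fsumr; last first.
  by move=> r; exact: pos.
apply: eq_fsbigr => r _.
have mr : measurable (h @^-1` [set r]) by [].
have [r0|r0] := leP 0 r.
  by rewrite ge0_integralZl//; [rewrite intensity// muleCA|exact: mXi].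
rewrite preimage_nnfun0// measure0 !mule0.
by apply: integral0_eq => w _; rewrite measure0 mule0.
Qed.

Lemma campbell (f : X -> \bar R) : (forall x, 0 <= f x)%E -> measurable_fun setT f ->
  (\int[P]_w \int[Xi w]_x f x = rho%:E * \int[mu]_x f x)%E.
Proof.
move=> f0 mf; pose f_ := nnsfun_approx measurableT mf.
have mf_ n : measurable_fun setT (EFin \o f_ n) by exact/measurable_EFinP.
have f_0 n x : (0 <= (EFin \o f_ n) x)%E by rewrite lee_fin.
have ndf_ x : {homo (fun n => (EFin \o f_ n) x) : a b / (a <= b)%N >-> (a <= b)%E}.
  by move=> a b ab; rewrite lee_fin; exact/lefP/nd_nnsfun_approx.
have lim_ (m : {measure set X -> \bar R}) :
    (\int[m]_x f x = limn (fun n => \int[m]_x (EFin \o f_ n) x))%E.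
  rewrite -monotone_convergence//; apply: eq_integral => x _.
  by apply/esym/cvg_lim => //; exact: cvg_nnsfun_approx.
transitivity (\int[P]_w limn (fun n => \int[Xi w]_x (EFin \o f_ n) x))%E.
  by apply: eq_integral => w _; exact: lim_.
rewrite monotone_convergence//; first last.
- move=> w _ a b ab; apply: ge0_le_integral => //.
  by move=> x _; exact: ndf_.
- by move=> n w _; exact: integral_ge0.
- by move=> n; exact: measurable_fun_integral_kernel.
under eq_fun do rewrite campbell_nnsfun.
rewrite lim_ limeMl//.
apply: ereal_nondecreasing_is_cvgn => a b ab; apply: ge0_le_integral => //.
- by move=> x _; exact: f_0.
- exact: mf_.
- exact: mf_.
- by move=> x _; exact: ndf_.
Qed.

(** The truncations are bounded and supported in [K n], which makes each truncated integral finite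
    with finite variance. Domination by [M * phi] serves the passage to the limit, for the means and
    for each configuration. *)
Variables (phi : X -> R) (phi_ : nat -> X -> R) (M : R) (K : nat -> set X).
Hypotheses (mphi : measurable_fun setT phi) (mphi_ : forall n, measurable_fun setT (phi_ n)).
Hypotheses (phi_ge0 : forall x, 0 <= phi x) (phi__ge0 : forall n x, 0 <= phi_ n x).
Hypotheses (phi_le : forall n x, phi_ n x <= M * phi x)
  (phi_cvg : forall x, phi_ ^~ x @ \oo --> phi x).
Hypothesis iphi : mu.-integrable setT (EFin \o phi).
Hypothesis phi_bd : forall n, exists C : R, forall x, phi_ n x <= C.
Hypothesis phi_supp : forall n x, ~ K n x -> phi_ n x = 0.
Hypothesis mK : forall n, measurable (K n).
Hypothesis finK : forall w n, (Xi w (K n) < +oo)%E.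
Hypothesis sqrK : forall n, (\int[P]_w (Xi w (K n) ^+ 2) < +oo)%E.

Let Y n w := \int[Xi w]_x phi_ n x.
Let m := rho * \int[mu]_x phi x.

Let Y_ge0 n w : 0 <= Y n w. Proof. exact: Rintegral_ge0. Qed.

Let phi_bound n : exists C : R, 0 <= C /\ forall x, phi_ n x <= C * \1_(K n) x.
Proof.
have [C hC] := phi_bd n; exists `|C|; split => // x; rewrite indicE.
have [Kx|Kx] := boolP (x \in K n).
  by rewrite mulr1 (le_trans (hC x))// ler_norm.
by rewrite mulr0 phi_supp//; move/negP: Kx; rewrite inE.
Qed.

Let indicK_integrable n w : (Xi w).-integrable setT (EFin \o (\1_(K n) : X -> R)).
Proof.
apply/integrableP; split; first exact/measurable_EFinP.
under eq_integral do rewrite /= ger0_norm//.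
by rewrite integral_indic// setIT.
Qed.

Let phi__integrable n w : (Xi w).-integrable setT (EFin \o phi_ n).
Proof.
have [C [C0 hC]] := phi_bound n.
apply: (@le_integrable _ _ _ _ setT measurableT _ (EFin \o (fun x => C * \1_(K n) x))).
- exact/measurable_EFinP.
- move=> x _; rewrite /= lee_fin ger0_norm// ger0_norm ?mulr_ge0//.
- exact: integrable_funZ.
Qed.

Let YE n w : (\int[Xi w]_x (phi_ n x)%:E = (Y n w)%:E)%E.
Proof. by rewrite /Y /Rintegral fineK//; exact: (integrable_fin_num measurableT (phi__integrable n w)). Qed.

Let mY n : measurable_fun setT (Y n).
Proof.
apply/measurable_EFinP.
rewrite (_ : EFin \o Y n = fun w => \int[Xi w]_x (phi_ n x)%:E)%E; last first.
  by apply/funext => w; rewrite YE.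
apply: measurable_fun_integral_kernel => //.
  by move=> x; rewrite lee_fin.
exact/measurable_EFinP.
Qed.

Let Y_le n : exists C : R, 0 <= C /\ forall w, Y n w <= C * fine (Xi w (K n)).
Proof.
have [C [C0 hC]] := phi_bound n; exists C; split => // w.
have i1 := indicK_integrable n w.
apply: (@le_trans _ _ (\int[Xi w]_x (C * \1_(K n) x))).
  by apply: le_Rintegral => //; exact: integrable_funZ.
by rewrite RintegralZl//; rewrite /Rintegral integral_indic// setIT lexx.
Qed.

Let iY n : P.-integrable setT (EFin \o Y n).
Proof.
apply/integrableP; split; first exact/measurable_EFinP.
under eq_integral do rewrite /= ger0_norm// -YE.
rewrite campbell//; last exact/measurable_EFinP.
  have : (\int[mu]_x (phi_ n x)%:E <= \int[mu]_x (M * phi x)%:E)%E.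
    apply: ge0_le_integral => //; try exact/measurable_EFinP.
    - by move=> x _; rewrite lee_fin.
    - by apply/measurable_EFinP; exact: measurable_funM.
    - by move=> x _; rewrite lee_fin.
  move=> le; rewrite lte_mul_pinfty//.
  apply: le_lt_trans le _.
  exact: (integrable_lty measurableT (integrable_funZ measurableT M iphi)).
by move=> x; rewrite lee_fin.
Qed.

Let EY n : \int[P]_w Y n w = rho * \int[mu]_x phi_ n x.
Proof.
rewrite {1}/Rintegral; under eq_integral do rewrite -YE.
rewrite campbell//; last exact/measurable_EFinP.
  rewrite fineM//.
  have : mu.-integrable setT (EFin \o phi_ n).
    apply: (@le_integrable _ _ _ _ setT measurableT _ (EFin \o (fun x => M * phi x))).
    - exact/measurable_EFinP.
    - by move=> x _; rewrite /= lee_fin ger0_norm// (le_trans (phi_le n x))// ler_norm.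
    - exact: integrable_funZ.
  exact: integrable_fin_num.
by move=> x; rewrite lee_fin.
Qed.

Let cvg_EY : \int[P]_w Y n w @[n --> \oo] --> m.
Proof.
under eq_fun do rewrite EY.
apply: cvgMr; apply: (@Rintegral_dominated_cvg _ _ _ mu setT measurableT _ _ (fun x => M * phi x)) => //.
- exact: integrable_funZ.
- by move=> n x; rewrite ger0_norm.
Qed.

Let iY2 n : P.-integrable setT (EFin \o (fun w => (Y n w - \int[P]_w Y n w) ^+ 2)).
Proof.
have [C [C0 hC]] := Y_le n.
set a := \int[P]_w Y n w.
have mXK : measurable_fun setT (fun w => fine (Xi w (K n))).
  by apply: measurableT_comp => //; exact: mXi.
have iX2 : P.-integrable setT (EFin \o (fun w => fine (Xi w (K n)) ^+ 2)).
  apply/integrableP; split.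
    by apply/measurable_EFinP; exact: measurable_funX.
  apply: le_lt_trans (sqrK n); apply: ge0_le_integral => //.
  - by apply: measurableT_comp => //; apply/measurable_EFinP; exact: measurable_funX.
  - by apply: emeasurable_funM; exact: mXi.
  - move=> w _; rewrite /= ger0_norm ?sqr_ge0// EFin_expe fineK// ge0_fin_numE.
      exact: finK.
    by [].
(* From (Y - a)^2 <= 2 Y^2 + 2 a^2 and Y <= C times the number of points in [K n]. *)
apply: (@le_integrable _ _ _ _ setT measurableT _
   (EFin \o (fun w => 2 * C ^+ 2 * fine (Xi w (K n)) ^+ 2 + 2 * a ^+ 2))).
- apply/measurable_EFinP; apply: measurable_funX; exact: measurable_funB.
- move=> w _; rewrite /= lee_fin ger0_norm ?sqr_ge0//.
  apply: le_trans (ler_norm _).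
  have h1 : Y n w ^+ 2 <= (C * fine (Xi w (K n))) ^+ 2.
    by apply: lerXn2r; [exact: Y_ge0|rewrite nnegrE mulr_ge0// fine_ge0|exact: hC].
  by have := sqr_ge0 (Y n w + a); rewrite exprMn in h1; nra.
- apply: integrable_funD => //; first exact: integrable_funZ.
  exact: finite_measure_integrable_cst.
Qed.

(* The integrals of the truncations phi_ n converge to that of phi for almost
   every configuration, and their variances vanish in the limit: by Fatou's
   lemma the limit has zero variance. *)
Lemma ae_integral_constant :
  complex.Re (ccov P (fun w => cintegral (Xi w) setT (fun x => (phi_ n x)%:C))
    (fun w => cintegral (Xi w) setT (fun x => (phi_ n x)%:C))) @[n --> \oo] --> (0 : R) ->
  {ae P, forall w, (\int[Xi w]_x (phi x)%:E = m%:E)%E}.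
Proof.
move=> var0.
have v0 : \int[P]_w ((Y n w - \int[P]_w Y n w) ^+ 2) @[n --> \oo] --> (0 : R).
  move: var0; rewrite (_ : (fun n => complex.Re _) =
    (fun n => \int[P]_w ((Y n w - \int[P]_w Y n w) ^+ 2)))//.
  apply/funext => n.
  rewrite (_ : (fun w => cintegral (Xi w) _ _) = (fun w => (Y n w)%:C)).
    by rewrite ccov_real.
  by apply/funext => w; rewrite cintegral_real.
have mphiE : measurable_fun setT (EFin \o phi) by exact/measurable_EFinP.
have phiE0 x : (0 <= (EFin \o phi) x)%E by rewrite lee_fin.
have mI : measurable_fun setT (fun w => \int[Xi w]_x (phi x)%:E)%E.
  exact: measurable_fun_integral_kernel.
(* By Campbell's formula the integral of phi has a finite mean, hence is finite almost surely. This
   allows dominated convergence inside a fixed configuration. *)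
have finI : {ae P, forall w, setT w -> (\int[Xi w]_x (phi x)%:E \is a fin_num)%E}.
  apply: integrable_ae => //; apply/integrableP; split => //.
  rewrite (eq_integral (fun w => \int[Xi w]_x (phi x)%:E)%E); last first.
    by move=> w _ /=; apply: gee0_abs; apply: integral_ge0 => x _; exact: phiE0.
  rewrite campbell// lte_mul_pinfty//.
  exact: (integrable_lty measurableT iphi).
pose Z n w := ((Y n w - \int[P]_w Y n w) ^+ 2)%:E.
have mZ n : measurable_fun setT (Z n).
  apply/measurable_EFinP; apply: measurable_funX; exact: measurable_funB.
have Z0 n w : setT w -> (0 <= Z n w)%E by rewrite lee_fin sqr_ge0.
have fat := fatou P measurableT mZ Z0.
have lim0 : limn_einf (fun n => \int[P]_w Z n w)%E = 0%E.
  have c : (fun n => \int[P]_w Z n w)%E @ \oo --> 0%E.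
    rewrite (_ : (fun n => _) = (fun n => (\int[P]_w ((Y n w - \int[P]_w Y n w) ^+ 2))%:E)); last first.
      by apply/funext => n; rewrite /Rintegral fineK//; exact: (integrable_fin_num measurableT (iY2 n)).
    by apply: cvg_EFin; [exact: nearW|exact: v0].
  by rewrite is_cvg_limn_einfE; [exact: cvg_lim c|apply/cvg_ex; exists 0%E].
rewrite lim0 in fat.
have mL : measurable_fun setT (fun w => limn_einf (Z ^~ w)).
  rewrite (_ : (fun w => _) = (fun w => - limn_esup (fun n => - Z n w))%E); last first.
    by apply/funext => w; rewrite -[RHS]oppeK -limn_esupN.
  apply: measurableT_comp => //; apply: measurable_fun_limn_esup => n.
  exact: measurableT_comp.
have L0 w : (0 <= limn_einf (Z ^~ w))%E.
  rewrite limn_einf_lim; apply: lime_ge; first exact: is_cvg_einfs.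
  by apply: nearW => n; apply: le_ereal_inf_tmp => _ [k _ <-]; exact: Z0.
have Lae : {ae P, forall w, setT w -> limn_einf (Z ^~ w) = 0%E}.
  apply/(ae_eq_integral_abs _ measurableT mL)/eqP; rewrite eq_le integral_ge0// andbT.
  by under eq_integral do rewrite gee0_abs//.
near=> w.
have fw : (\int[Xi w]_x (phi x)%:E \is a fin_num)%E by near: w; apply: filterS finI => w; apply.
have Lw : limn_einf (Z ^~ w) = 0%E by near: w; apply: filterS Lae => w; apply.
have ipw : (Xi w).-integrable setT (EFin \o phi).
  apply/integrableP; split => //; under eq_integral do rewrite gee0_abs//.
  by rewrite -ge0_fin_numE// integral_ge0.
have cY : Y n w @[n --> \oo] --> \int[Xi w]_x phi x.
  apply: (@Rintegral_dominated_cvg _ _ _ (Xi w) setT measurableT _ _ (fun x => M * phi x)) => //.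
  - exact: integrable_funZ.
  - by move=> n x; rewrite ger0_norm.
have cZ : Z ^~ w @ \oo --> ((\int[Xi w]_x phi x - m) ^+ 2)%:E.
  apply: cvg_EFin; first exact: nearW.
  rewrite !expr2; have h : Y n w - \int[P]_w Y n w @[n --> \oo] --> \int[Xi w]_x phi x - m.
    exact: cvgB.
  exact: (cvgM h h).
move: Lw; rewrite is_cvg_limn_einfE; last by apply/cvg_ex; eexists; exact: cZ.
rewrite (cvg_lim _ cZ)// => -[/eqP]; rewrite sqrf_eq0 subr_eq0 => /eqP <-.
by rewrite /Rintegral fineK.
Unshelve. all: end_near. Qed.

End point_process_integrals.

(** * Void probabilities from almost surely constant integrals *)

Section empty_sets.
Context {R : realType} dX (X : measurableType dX) dT (T : measurableType dT).
Local Open Scope classical_set_scope.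
Variables (P : probability T R) (Xi : R.-ker T ~> X).

(** If [B] is empty, it is a null set of the counting measure [Xi w], so phi <= e psi holds almost
    everywhere for [Xi w]. Integration then gives a <= e b, contrary to the last hypothesis. *)
Lemma empty_set_null (B : set X) (phi psi : X -> R) (a b e : R) : measurable B ->
  measurable_fun setT phi -> measurable_fun setT psi ->
  (forall x, 0 <= phi x) -> (forall x, 0 <= psi x) -> 0 <= e ->
  {ae P, forall w, (\int[Xi w]_x (phi x)%:E = a%:E)%E} ->
  {ae P, forall w, (\int[Xi w]_x (psi x)%:E = b%:E)%E} ->
  (forall x, ~ B x -> phi x <= e * psi x) -> e * b < a ->
  P [set w | Xi w B = 0%E] = 0%E.
Proof.
move=> mB mphi mpsi phi0 psi0 e0 aephi aepsi le ba.
have mE : measurable [set w | Xi w B = 0%E].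
  rewrite (_ : [set w | _] = (Xi ^~ B) @^-1` [set 0%E])//.
  rewrite -[X in measurable X]setTI; apply: (measurable_kernel Xi B mB) => //.
apply/(measure_negligible mE).
have h : {ae P, forall w, ~ [set w | Xi w B = 0%E] w}.
  near=> w => /= wB.
  have ew : (\int[Xi w]_x (phi x)%:E = a%:E)%E by near: w.
  have ew' : (\int[Xi w]_x (psi x)%:E = b%:E)%E by near: w.
  have : (\int[Xi w]_x (phi x)%:E <= e%:E * \int[Xi w]_x (psi x)%:E)%E.
    rewrite -ge0_integralZl//; last 2 first.
    - exact/measurable_EFinP.
    - by move=> x _; rewrite lee_fin.
    apply: ae_ge0_le_integral => //.
    - by move=> x _; rewrite lee_fin.
    - exact/measurable_EFinP.
    - by move=> x _; rewrite -EFinM lee_fin mulr_ge0.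
    - by apply: measurable_funeM; exact/measurable_EFinP.
    - exists B; split => // x /= h; apply: contrapT => nB; apply: h => _.
      by rewrite -EFinM lee_fin le.
  by rewrite ew ew' -EFinM lee_fin leNgt ba.
by case: h => N [mN N0 sN]; exists N; split => // w /= wB; apply: sN => /=; exact.
Unshelve. all: end_near. Qed.

Lemma empty_set_translate (add : X -> X -> X) (t : X) (B : set X) :
  measurable B -> translation_invariant P Xi add ->
  P [set w | Xi w B = 0%E] = P [set w | Xi w (add t @^-1` B) = 0%E].
Proof.
move=> mB /(_ t [set m | m B = 0%E]) /= <-//.
apply: sub_sigma_algebra; exists B, [set 0%E]; split => //.
Qed.

End empty_sets.

(** * Band-limited windows and voids *)

Section band_limited_windows.
Context {R : realType}.
Local Open Scope classical_set_scope.
Local Notation mu := (@lebesgue_measure R).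
Implicit Types (f : R -> R) (r : R).

Definition band_limited r f : Prop :=
  [/\ schwartzR f, forall t, f (- t) = f t, forall t, 0 <= f t &
      forall s, r < `|s| -> costr f s = 0].

(** The half width r / 2 compensates for the doubling of the band by the square. *)
Definition window r (t : R) : R := costr (bump (r / 2)) t ^+ 2.

Definition heavy_window r (t : R) : R := (1 + t ^+ 2) * window r t.

Lemma schwartzR_bump r : 0 <= r -> schwartzR (bump r).
Proof. exact: rapidly_bump. Qed.

Lemma band_limited_window r : 0 < r -> band_limited r (window r).
Proof.
move=> r0; have sb : schwartzR (bump (r / 2)) by apply: schwartzR_bump; rewrite divr_ge0// ltW.
split.
- by apply: schwartzR_sqr; exact: schwartzR_costr.
- by move=> t; rewrite /window costr_even.
- by move=> t; rewrite sqr_ge0.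
- move=> s rs; apply: (@costr_sqr_support _ (bump (r / 2)) (r / 2)) => //.
  + exact: bump_even.
  + by move=> k; exact: bump_support.
  + by rewrite mulrC divfK// ltW.
Qed.

Lemma band_limited_heavy_window r : 0 < r -> band_limited r (heavy_window r).
Proof.
move=> r0; have [su eu u0 cu] := band_limited_window r0; split.
- rewrite (_ : heavy_window r = fun t => window r t + t * (t * window r t)).
    by apply: schwartzRD => //; apply: schwartzR_mulid; exact: schwartzR_mulid.
  by apply/funext => t; rewrite /heavy_window; ring.
- by move=> t; rewrite /heavy_window eu sqrrN.
- by move=> t; rewrite mulr_ge0// addr_ge0// sqr_ge0.
- by move=> s rs; exact: costr_oneDsqr_support su cu rs.
Qed.

Lemma window0_gt0 r : 0 < r -> 0 < window r 0.
Proof.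
move=> r0; have r20 : 0 < r / 2 by rewrite divr_gt0.
rewrite /window exprn_gt0// /costr.
rewrite (_ : (fun k => _) = bump (r / 2)).
  apply: schwartzR_ge0_integral_gt0; [exact/schwartzR_bump/ltW|move=> x; exact: bump_ge0|exact: bump_gt0].
by apply/funext => k; rewrite mulr0 cos0 mulr1.
Qed.

Lemma Rintegral_window_gt0 r : 0 < r -> 0 < \int[mu]_t window r t.
Proof.
move=> r0; have [su _ u0 _] := band_limited_window r0.
by apply: schwartzR_ge0_integral_gt0 => //; exact: window0_gt0.
Qed.

(** A single large coordinate gains the whole factor 1 + L^2; on the others
    [window r <= heavy_window r] is enough. *)
Lemma prodf_window_le n r L (x : 'rV[R]_n) : 0 < r -> 0 <= L -> (exists i, L <= `|x ord0 i|) ->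
  prodf (fun=> window r) x <= (1 + L ^+ 2)^-1 * prodf (fun=> heavy_window r) x.
Proof.
move=> r0 L0 [i Li].
have [_ _ u0 _] := band_limited_window r0.
have le1 t : window r t <= heavy_window r t.
  by rewrite /heavy_window ler_peMl// lerDl sqr_ge0.
have L1 : 0 < 1 + L ^+ 2 by rewrite ltr_pwDl// sqr_ge0.
rewrite /prodf mulrC ler_pdivlMr// mulrC (bigD1 i)//= [leRHS](bigD1 i)//= mulrA.
apply: ler_pM.
- by rewrite mulr_ge0// ltW.
- by apply: prodr_ge0 => j _.
- rewrite /heavy_window ler_wpM2r// lerD2l -[leRHS]real_normK ?num_real//.
  by rewrite lerXn2r// nnegrE.
- by apply: ler_prod => j _; rewrite u0 le1.
Qed.

Lemma measurable_enorm n : measurable_fun setT (@enorm R n).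
Proof.
apply: measurableT_comp => //.
  by apply: continuous_measurableR; exact: sqrt_continuous.
rewrite /dot; apply: measurable_sum => i.
by apply: measurable_funM; exact: measurable_coor.
Qed.

Section void.
Context dX (X : measurableType dX) dT (T : measurableType dT).
Variables (P : probability T R) (Xi : R.-ker T ~> X) (n : nat).
Variables (iota : X -> 'rV[R]_n) (add : X -> X -> X) (r A B : R).
Hypothesis r0 : 0 < r.
Hypothesis miota : measurable_fun setT iota.
Hypothesis addE : forall x y, iota (add x y) - iota x = iota y.
Hypothesis trans : translation_invariant P Xi add.
Hypothesis aeA : {ae P, forall w, (\int[Xi w]_x (prodf (fun=> window r) (iota x))%:E = A%:E)%E}.
Hypothesis aeB : {ae P, forall w, (\int[Xi w]_x (prodf (fun=> heavy_window r) (iota x))%:E = B%:E)%E}.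
Hypothesis A0 : 0 < A.

(* By translation invariance the void can be centered at iota = 0; outside a
   large ball the window is at most a small multiple of the heavy window. *)
Lemma void_radius : exists2 r0 : R, 0 < r0 &
  forall x, P [set w | Xi w (eball iota x r0) = 0%E] = 0%E.
Proof.
have [su _ u0 _] := band_limited_window r0.
have [sv _ v0 _] := band_limited_heavy_window r0.
(* Chosen so that B < (1 + L^2) A: indeed A L = A + |B|, and L <= L^2 because 1 <= L. *)
pose L := 1 + `|B| / A.
have L0 : 0 < L by rewrite ltr_pwDl// divr_ge0// ltW.
have L2 : 0 < 1 + L ^+ 2 by rewrite ltr_pwDl// sqr_ge0.
(* If all coordinates are less than L in absolute value, the Euclidean norm is at most n L. The
   additional 1 makes the comparison strict, so a point outside the ball has a coordinate of size at
   least L. *)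
exists (n%:R * L + 1); first by rewrite ltr_wpDl// mulr_ge0// ltW.
set rad := _ + 1 => x.
have mball : measurable (eball iota x rad).
  rewrite (_ : eball iota x rad = (fun y => enorm (iota y - iota x)) @^-1` `]-oo, rad[%classic); last first.
    by apply/seteqP; split => y /=; rewrite in_itv.
  rewrite -[X in measurable X]setTI; apply: measurableT_comp => //; first exact: measurable_enorm.
  apply: measurable_rowP => j.
  rewrite (_ : (fun _ => _) = (fun y => iota y ord0 j - iota x ord0 j)); last first.
    by apply/funext => y; rewrite !mxE.
  apply: measurable_funB => //; exact: measurableT_comp (measurable_coor _) miota.
rewrite (@empty_set_translate _ _ _ _ _ P Xi add x)//.
rewrite (_ : add x @^-1` _ = [set y | enorm (iota y) < rad]); last first.
  by apply/seteqP; split => y /=; rewrite /eball/= addE.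
apply: (@empty_set_null _ _ _ _ _ P Xi _ (fun x => prodf (fun=> window r) (iota x))
  (fun x => prodf (fun=> heavy_window r) (iota x)) A B (1 + L ^+ 2)^-1) => //.
- rewrite -[X in measurable X]setTI.
  rewrite (_ : [set y | _] = (fun y => enorm (iota y)) @^-1` `]-oo, rad[%classic); last first.
    by apply/seteqP; split => y /=; rewrite in_itv.
  by apply: measurableT_comp => //; [exact: measurable_enorm].
- apply: measurableT_comp miota; apply: measurable_prodf => i.
  exact: schwartzR_measurable.
- apply: measurableT_comp miota; apply: measurable_prodf => i.
  exact: schwartzR_measurable.
- by move=> y; apply: prodr_ge0 => i _.
- by move=> y; apply: prodr_ge0 => i _.
- by rewrite invr_ge0 ltW.
- move=> y /= /negP; rewrite -leNgt => rady; apply: prodf_window_le => //; first exact: ltW.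
  apply: contrapT => /forallNP h.
  have : enorm (iota y) <= n%:R * L.
    apply: le_trans (enorm_le_sum _) _; rewrite -[n in leRHS]card_ord -sum1_card natr_sum mulr_suml.
    by apply: ler_sum => i _; rewrite mul1r ltW// ltNge; apply/negP; exact: h.
  by rewrite leNgt; apply/negP; rewrite negbK (lt_le_trans _ rady)// ltrDl.
- rewrite mulrC ltr_pdivrMr// mulrC.
  have h1 : A * (`|B| / A) = `|B| by rewrite mulrC divfK// gt_eqF.
  have h2 := ler_norm B; have h3 : 0 <= `|B| / A by rewrite divr_ge0// ltW.
  have h4 : A + `|B| = A * L by rewrite mulrDr mulr1 h1.
  have h5 : A * L <= A * L ^+ 2.
    by rewrite ler_pM2l// expr2 ler_pMl// /L lerDl.
    rewrite mulrDl mul1r [_ * A]mulrC; apply: le_lt_trans h2 _.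
  apply: (lt_le_trans (y := A + `|B|)); first by rewrite ltrDr.
  by rewrite h4; apply: le_trans h5 _; rewrite lerDr ltW.
Qed.

End void.

End band_limited_windows.

(** * The continuous case *)

Section continuous_space.
Context {R : realType} (n : nat) dT (T : measurableType dT).
Local Open Scope classical_set_scope.
Local Open Scope complex_scope.
Local Notation mu := (@lebesgue_measure R).
Variables (P : probability T R) (Xi : R.-ker T ~> 'rV[R]_n) (rho : R).
Hypotheses (n0 : (0 < n)%N) (rho0 : 0 < rho).
Hypotheses (pp : point_process P Xi id)
  (intensity : has_intensity P Xi (lebesgue_row R n) rho).
Variables (beta : ('rV[R]_n -> R[i]) -> R[i]) (S : {measure set 'rV[R]_n -> \bar R}).
Hypotheses (cov : is_covariance_functional P Xi beta) (structure : is_structure_function beta S).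

Variables (U : set 'rV[R]_n) (r : R) (f : R -> R).
Hypotheses (mU : measurable U) (U0 : S U = 0%E).
Hypothesis boxU : forall k : 'rV[R]_n, (forall i, `|k ord0 i| <= r) -> U k.
Hypothesis bf : band_limited r f.

(* corr f f is, up to a constant, the transform of (costr f)^2, whose product
   over the coordinates vanishes where S has mass. *)
Lemma covariance_functional_window : beta (fun x => (prodf (fun=> corr f f) x)%:C) = 0.
Proof.
have [sf ef f0 cf] := bf.
pose g (k : R) := (@inversion_const R)^-1 * costr f k ^+ 2.
have sg : schwartzR g by apply/schwartzRZ/schwartzR_sqr/schwartzR_costr.
have eg k : g (- k) = g k by rewrite /g costr_even.
rewrite (_ : (fun x => _) = fourier (fun k : 'rV[R]_n => (prodf (fun=> g) k)%:C)); last first.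
  apply/funext => x; rewrite fourier_prodf//; congr (_%:C); apply: eq_bigr => i _.
  rewrite corr_self// /costr /g -RintegralZl//.
    by apply: eq_Rintegral => k _; rewrite mulrA.
  apply: integrable_cosM; apply: schwartzR_integrable.
  by apply/schwartzR_sqr/schwartzR_costr.
rewrite -(structure.2 _ (schwartz_prodf n sg)) cintegral_real.
rewrite /Rintegral (ae_eq_integral (cst 0%E)) ?integral_cst//.
- by rewrite mul0e.
- apply/measurable_EFinP; apply: measurable_prodf => i.
  exact: schwartzR_measurable.
- exists U; split => // k /= h; apply: contrapT => Uk; apply: h => _.
  have [i ri] : exists i, r < `|k ord0 i|.
    apply: contrapT => /forallNP h; apply: Uk; apply: boxU => i.
    by rewrite leNgt; apply/negP.
  by rewrite /prodf (bigD1 i)//= /g cf// expr0n/= mulr0 mul0r.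
Qed.

Let phi (x : 'rV[R]_n) := prodf (fun=> f) x.
Let phi_ m (x : 'rV[R]_n) := prodf (fun=> cutoff f m) x.

Let test_phi_ m : test_function (fun x => (phi_ m x)%:C).
Proof.
have [sf _ _ _] := bf.
apply: (@test_function_prodf _ _ _ m.+1%:R) => //.
  exact: smooth_in_smooth1 (rapidly_cutoff sf).
by move=> t mt; rewrite /cutoff chi_support ?mulr0// ltW.
Qed.

(** The variance of a truncation is [beta] at its autocorrelation. Subtracting the autocorrelation
    of [f], where [beta] vanishes, leaves a Schwartz function whose bounds are O(1 / (m + 1)), and
    [beta] is controlled by finitely many of them. *)
Lemma window_variance_cvg0 :
  complex.Re (ccov P (fun w => cintegral (Xi w) setT (fun x => (phi_ m x)%:C))
    (fun w => cintegral (Xi w) setT (fun x => (phi_ m x)%:C))) @[m --> \oo] --> (0 : R).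
Proof.
have [sf ef f0 cf] := bf.
have [[betaD [N [C betaB]]] betacov] := cov.
have scut m := rapidly_schwartzR m (rapidly_cutoff sf).
have rcut := rapidly_cutoff sf.
pose a_ m x := prodf (n := n) (fun=> corr (cutoff f m) (cutoff f m)) x.
pose a x := prodf (n := n) (fun=> corr f f) x.
have rcc : rapidly unit_rate (fun m => corr (cutoff f m) (cutoff f m)).
  have := rapidly_corr (fun=> ler01) (fun=> ler01) rcut rcut.
  by rewrite (_ : (fun n => 1 * 1) = unit_rate)//; apply/funext => m; rewrite mulr1.
have sc : schwartzR (corr f f).
  have := rapidly_corr (fun=> ler01) (fun=> ler01) sf sf.
  by rewrite (_ : (fun n => 1 * 1) = unit_rate)//; apply/funext => m; rewrite mulr1.
have sa_ m : schwartz (fun x => (a_ m x)%:C) by apply: schwartz_prodf; exact: rapidly_schwartzR rcc.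
have sa : schwartz (fun x => (a x)%:C) by exact: schwartz_prodf.
have bd N' := @schwartz_bound_prodfB R n _ _ N' rcc sc (rapidly_corr_cutoff sf).
have sB m : schwartz (fun x => (a_ m x - a x)%:C).
  split; last by move=> N'; have [M hM] := bd N'; exists (M * inv_rate m); exact: hM.
  apply: smooth_real; apply: rsmoothB; apply: rsmooth_prodf => i.
    exact: smooth_in_smooth1 rcc.
  exact: smooth_in_smooth1 0 sc.
have [M hM] := bd N.
have covE m : ccov P (fun w => cintegral (Xi w) setT (fun x => (phi_ m x)%:C))
    (fun w => cintegral (Xi w) setT (fun x => (phi_ m x)%:C)) = beta (fun x => (a_ m x - a x)%:C).
  rewrite betacov// (_ : cross_correlation _ _ = fun x => (a_ m x)%:C); last first.
    by apply/funext => x; rewrite cross_correlation_prodf.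
  rewrite (_ : (fun x => (a_ m x - a x)%:C) = (fun x => (-1) * (a x)%:C + (a_ m x)%:C)).
    by rewrite betaD// covariance_functional_window mulr0 add0r.
  by apply/funext => x; rewrite rmorphB mulN1r addrC.
have le m : `|complex.Re (beta (fun x => (a_ m x - a x)%:C))| <= C * M * inv_rate m.
  rewrite -lecR -mulrA; apply: le_trans (betaB _ _ (sB m) (hM m)).
  exact: normc_ge_Re.
under eq_fun do rewrite covE.
apply/cvgr0Pnorm_le => e e0; near=> m; apply: le_trans (le m) _.
near: m.
have : (C * M) * inv_rate m @[m --> \oo] --> C * M * (0 : R).
  by apply: cvgMr; exact: cvg_inv_rate.
rewrite mulr0 => /cvgr0Pnorm_le /(_ _ e0); apply: filterS => m.
exact/le_trans/ler_norm.
Unshelve. all: end_near. Qed.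

Lemma ae_window_integral :
  {ae P, forall w, (\int[Xi w]_x (prodf (fun=> f) x)%:E = (rho * (\int[mu]_t f t) ^+ n)%:E)%E}.
Proof.
have [sf ef f0 cf] := bf.
have [M [M0 hM]] := @chi_bounded R.
have [iprod eprod] := @Rintegral_prodf R n (fun=> f) (fun=> schwartzR_integrable sf).
rewrite -[n in _ ^+ n]card_ord -prodr_const -eprod.
(* A ball containing the cube |x_i| <= m + 1, outside which the truncation [phi_ m] vanishes. *)
pose K m := [set x : 'rV[R]_n | enorm x <= n%:R * m.+1%:R].
have mK m : measurable (K m).
  rewrite (_ : K m = @enorm R n @^-1` `]-oo, n%:R * m.+1%:R]%classic); last first.
    by apply/seteqP; split => y /=; rewrite in_itv.
  by rewrite -[X in measurable X]setTI; exact: measurable_enorm.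
have bK m : ebounded id (K m) by exists (n%:R * m.+1%:R) => x.
have cut0 m t : 0 <= cutoff f m t by rewrite mulr_ge0 ?chi_ge0.
apply: (@ae_integral_constant _ _ _ _ _ P Xi _ rho (ltW rho0) intensity phi phi_ (M ^+ n) K).
- apply: measurable_prodf => i; exact: schwartzR_measurable.
- move=> m; apply: measurable_prodf => i.
  by apply: schwartzR_measurable; exact: rapidly_schwartzR (rapidly_cutoff sf).
- by move=> x; apply: prodr_ge0.
- by move=> m x; apply: prodr_ge0.
- move=> m x; rewrite -[n in _ ^+ n]card_ord -prodr_const -big_split/=.
  by apply: ler_prod => i _; rewrite cut0/= /cutoff mulrC ler_wpM2r.
- move=> x; apply: cvg_big => [|i _]; first exact: mul_continuous.
  rewrite -[f _]mulr1; apply: cvgMr; exact: cvg_chi.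
- exact: iprod.
- move=> m; have [D hD] := rapidly_bounded m (rapidly_cutoff sf).
  exists (D ^+ n) => x; rewrite -[n in _ ^+ n]card_ord -prodr_const.
  by apply: ler_prod => i _; rewrite cut0/= (le_trans _ (hD (x ord0 i)))// ler_norm.
- move=> m x Kx; have [i mi] : exists i, m.+1%:R <= `|x ord0 i|.
    apply: contrapT => /forallNP h; apply: Kx.
    apply: le_trans (enorm_le_sum _) _; rewrite -[n in leRHS]card_ord -sum1_card natr_sum mulr_suml.
    by apply: ler_sum => i _; rewrite mul1r ltW// ltNge; apply/negP; exact: h.
  by rewrite /phi_ /prodf (bigD1 i)//= /cutoff chi_support// mulr0 mul0r.
- exact: mK.
- by move=> w m; have [k ->] := pp.1 w _ (mK m) (bK m); rewrite ltry.
- by move=> m; exact: pp.2 (mK m) (bK m).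
- exact: window_variance_cvg0.
Qed.

End continuous_space.

(** * Characters of the lattice *)

Section lattice_fourier.
Context {R : realType}.
Local Open Scope classical_set_scope.
Local Open Scope complex_scope.
Local Notation mu := (@lebesgue_measure R).

Lemma ReD (x y : R[i]) : complex.Re (x + y) = complex.Re x + complex.Re y.
Proof. by case: x y => a b [c d]. Qed.

Lemma Re_sum (I : Type) (s : seq I) (F : I -> R[i]) :
  complex.Re (\sum_(i <- s) F i) = \sum_(i <- s) complex.Re (F i).
Proof. by apply: (big_morph (@complex.Re R) ReD). Qed.

Lemma ImD (x y : R[i]) : complex.Im (x + y) = complex.Im x + complex.Im y.
Proof. by case: x y => a b [c d]. Qed.

Lemma Im_sum (I : Type) (s : seq I) (F : I -> R[i]) :
  complex.Im (\sum_(i <- s) F i) = \sum_(i <- s) complex.Im (F i).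
Proof. by apply: (big_morph (@complex.Im R) ImD). Qed.

Lemma expiD (s t : R) : expi (s + t) = expi s * expi t.
Proof. by rewrite /expi cosD sinD; simpc; congr (_ +i* _); rewrite addrC. Qed.

Lemma expi0 : expi 0 = 1 :> R[i].
Proof. by rewrite /expi cos0 sin0. Qed.

Lemma expi_sum (I : Type) (s : seq I) (F : I -> R) :
  expi (\sum_(i <- s) F i) = \prod_(i <- s) expi (F i).
Proof. by apply: (big_morph (@expi R) expiD expi0). Qed.

Lemma expi_2pi_int (z : int) : expi (z%:~R * (2 * pi)) = 1 :> R[i].
Proof.
have e2 : expi (2 * pi) = 1 :> R[i] by rewrite /expi mulr_natl cos2pi sin2pi.
elim/int_ind: z => [|m IH|m IH]; first by rewrite mul0r expi0.
- by rewrite intS rmorphD mulrDl mul1r expiD e2 IH mulr1.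
- have : expi ((- (m%:Z + 1)%R)%:~R * (2 * pi) + 2 * pi) = 1 :> R[i].
    by rewrite -[X in _ + X]mul1r -mulrDl -IH; congr (expi (_ * _)); rewrite !rmorphN/= !rmorphD/=; ring.
  have -> : m.+1%:Z = (m%:Z + 1)%R by lia.
  by rewrite expiD e2 mulr1.
Qed.

Lemma Rintegral_FTC2 (f F : R -> R) (a b : R) : a < b -> continuous f ->
  (forall t, is_derive t (1 : R) F (f t)) ->
  \int[mu]_(t in `[a, b[) f t = F b - F a.
Proof.
move=> ab cf dF.
have cF : continuous F.
  by move=> t; apply: differentiable_continuous; apply/derivable1_diffP; case: (dF t).
have cfi : {within `[a, b], continuous f} by exact: continuous_subspaceT.
have itf : mu.-integrable `[a, b] (EFin \o f).
  by apply: continuous_compact_integrable => //; exact: segment_compact.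
rewrite Rintegral_itv_bndo_bndc; last first.
  by apply: integrableS itf => //; apply: subset_itvl; rewrite bnd_simp.
rewrite /Rintegral (@continuous_FTC2 _ f F a b)//.
- split.
  + by move=> t _; case: (dF t).
  + by apply: cvg_at_right_filter; exact: cF.
  + by apply: cvg_at_left_filter; exact: cF.
- by move=> t _; rewrite derive1E; case: (dF t).
Qed.

Lemma Rintegral_cos_period (z : int) :
  \int[mu]_(t in `[- pi, pi[) cos (z%:~R * t) = (2 * pi) * (z == 0)%:R.
Proof.
have pi0 := @pi_gt0 R.
have lt : - pi < pi :> R by rewrite gtrN.
have [->|z0] := eqVneq z 0.
  have dF t : is_derive t (1 : R) id (cos (0%:~R * t)) by rewrite mul0r cos0; exact: is_derive_id.
  rewrite (Rintegral_FTC2 lt _ dF); first by rewrite mulr1; ring.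
  by move=> t; rewrite (_ : (fun _ => _) = cst 1); [exact: cvg_cst|apply/funext => s; rewrite mul0r cos0].
have zR : z%:~R != 0 :> R by rewrite intr_eq0.
have dF t : is_derive t (1 : R) (fun t => z%:~R^-1 * sin (z%:~R * t)) (cos (z%:~R * t)).
  have := is_derive_mul (is_derive_cst (z%:~R^-1 : R) t 1) (is_derive_sinM z%:~R t).
  by rewrite mul0r add0r mulKf.
rewrite (Rintegral_FTC2 lt _ dF).
- have [_ es] : expi (z%:~R * pi) = expi (z%:~R * - pi) :> R[i].
    rewrite -[RHS]mulr1 -(expi_2pi_int z) -expiD; congr expi; ring.
  by rewrite es subrr mulr0.
- by move=> t; under eq_fun do rewrite mulrC; exact: continuous_cosM.
Qed.

Lemma Rintegral_sin_period (z : int) :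
  \int[mu]_(t in `[- pi, pi[) sin (z%:~R * t) = 0.
Proof.
have [->|z0] := eqVneq z 0.
  by apply: Rintegral_eq0 => t _; rewrite mul0r sin0.
have lt : - pi < pi :> R by have := @pi_gt0 R; lra.
have zR : z%:~R != 0 :> R by rewrite intr_eq0.
have dF t : is_derive t (1 : R) (fun t => - z%:~R^-1 * cos (z%:~R * t)) (sin (z%:~R * t)).
  have := is_derive_mul (is_derive_cst (- z%:~R^-1 : R) t 1) (is_derive_cosM z%:~R t).
  by rewrite mul0r add0r mulrN mulNr opprK mulKf.
rewrite (Rintegral_FTC2 lt _ dF).
- have [es _] : expi (z%:~R * pi) = expi (z%:~R * - pi) :> R[i].
    rewrite -[RHS]mulr1 -(expi_2pi_int z) -expiD; congr expi; ring.
  by rewrite es subrr.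
- by move=> t; under eq_fun do rewrite mulrC; exact: continuous_sinM.
Qed.

(** The real and imaginary parts of e^(i<y, k>) span this family, which is stable under partial
    derivatives. *)
Definition trig n (y : 'rV[R]_n) (a b : R) (k : 'rV[R]_n) : R :=
  a * cos (dot y k) + b * sin (dot y k).

Lemma differentiable_trig n (y : 'rV[R]_n) a b k : differentiable (trig y a b) k.
Proof.
have ddot : differentiable (dot y) k.
  rewrite /dot; elim: (index_enum _) => [|i s IH].
    by under eq_fun do rewrite big_nil; exact: differentiable_cst.
  under eq_fun do rewrite big_cons.
  apply: differentiableD => //; apply: differentiableM => //; exact: differentiable_coord.
apply: differentiableD; apply: differentiableM => //; apply: differentiable_comp => //;
  by apply/derivable1_diffP.
Qed.

Lemma measurable_cos_dot n (y : 'rV[R]_n) : measurable_fun setT (fun k : 'rV[R]_n => cos (dot y k)).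
Proof.
apply: measurableT_comp; first exact: continuous_measurableR (@continuous_cos R).
by apply: measurable_sum => i; apply: measurable_funM => //; exact: measurable_coor.
Qed.

Lemma derive_trig n (y : 'rV[R]_n) a b i k :
  'D_(delta_mx ord0 i) (trig y a b) k = trig y (b * y ord0 i) (- a * y ord0 i) k.
Proof.
set c := y ord0 i; set s := dot y k.
have E h : trig y a b (h *: delta_mx ord0 i + k) = a * cos (c * h + s) + b * sin (c * h + s).
  rewrite /trig; suff -> : dot y (h *: delta_mx ord0 i + k) = c * h + s by [].
  rewrite /dot (bigD1 i)//= /s /dot [in RHS](bigD1 i)//= !mxE !eqxx mulr1 mulrDr -addrA.
  congr (_ + (_ + _)); apply: eq_bigr => j ji.
  by rewrite !mxE eqxx (negbTE ji) mulr0 add0r.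
have d : is_derive (0 : R) (1 : R) (fun h => a * cos (c * h + s) + b * sin (c * h + s))
    (a * (c * - sin (c * 0 + s)) + b * (c * cos (c * 0 + s))).
  apply: is_deriveD.
    have := is_derive_mul (is_derive_cst a (0 : R) 1)
      (is_derive_comp_affine (a := c) (b := s) (is_derive_cos (c * 0 + s))).
    by rewrite mul0r add0r.
  have := is_derive_mul (is_derive_cst b (0 : R) 1)
    (is_derive_comp_affine (a := c) (b := s) (is_derive_sin (c * 0 + s))).
  by rewrite mul0r add0r.
rewrite (_ : trig y _ _ k = a * (c * - sin (c * 0 + s)) + b * (c * cos (c * 0 + s))); last first.
  by rewrite mulr0 add0r /trig -/s; ring.
rewrite -[RHS](@derive_val _ _ _ _ _ _ _ d) /derive.
apply: (congr1 (fun g : R -> R => lim (g h @[h --> 0^']))); apply/funext => h /=.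
have E0 := E 0; rewrite scale0r add0r in E0.
by rewrite E E0 /GRing.scale/= mulr1 addr0.
Qed.

Lemma pderiv_trig n (y : 'rV[R]_n) s : forall a b, exists c d, pderiv s (trig y a b) = trig y c d.
Proof.
elim: s => [|i s IH] a b /=; first by exists a, b.
have [c [d ->]] := IH a b; exists (d * y ord0 i), (- c * y ord0 i).
by apply/funext => k; rewrite derive_trig.
Qed.

Lemma rsmooth_trig n (y : 'rV[R]_n) a b : rsmooth (trig y a b).
Proof.
by move=> s k; have [c [d ->]] := pderiv_trig y s a b; exact: differentiable_trig.
Qed.

Lemma smooth_expi n (y : 'rV[R]_n) : smooth (fun k => expi (dot y k)).
Proof.
split.
  rewrite (_ : (fun _ => _) = trig y 1 0); first exact: rsmooth_trig.
  by apply/funext => k; rewrite /trig mul1r mul0r addr0.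
rewrite (_ : (fun _ => _) = trig y 0 1); first exact: rsmooth_trig.
by apply/funext => k; rewrite /trig mul1r mul0r add0r.
Qed.

Variable n : nat.
Implicit Types (x y : 'rV[int]_n).

Lemma torus_periodic_expi y : torus_periodic (fun k => expi (dot (introw R y) k)).
Proof.
move=> m k.
have -> : dot (introw R y) (k + (2 * pi) *: introw R m) =
    dot (introw R y) k + (\sum_i y ord0 i * m ord0 i)%:~R * (2 * pi).
  rewrite /dot rmorph_sum mulr_suml -big_split/=; apply: eq_bigr => i _.
  by rewrite !mxE rmorphM/=; ring.
by rewrite expiD expi_2pi_int mulr1.
Qed.

(** Orthogonality of characters. With the cell encoded by a product of indicators of [-pi, pi[, the
    integral factors through [Rintegral_prodf_cos]. *)
Lemma torus_fourier_expi y x :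
  torus_fourier (fun k => expi (dot (introw R y) k)) x = ((2 * pi) ^+ n * (x == y)%:R)%:C.
Proof.
pose I : set R := `[- pi, pi[%classic.
pose f (t : R) : R := \1_I t.
pose th i (t : R) := ((y - x) ord0 i)%:~R * t.
have mI : measurable I by exact: measurable_itv.
have itf : mu.-integrable setT (EFin \o f).
  apply/integrableP; split; first exact/measurable_EFinP/measurable_indic.
  under eq_integral do rewrite /= ger0_norm//.
  have finI : (lebesgue_measure I < +oo)%E.
    by rewrite /I lebesgue_measure_itv/= ifT ?ltry// lte_fin; have := @pi_gt0 R; lra.
  by rewrite integral_indic// setIT.
have mth i : measurable_fun setT (th i) by apply: measurable_funM.
have rest (h : R -> R) : \int[mu]_t (f t * h t) = \int[mu]_(t in I) h t.
  rewrite [RHS]Rintegral_mkcond; apply: eq_Rintegral => t _.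
  by rewrite /f indicE patchE; case: ifP => _; rewrite ?mul1r ?mul0r.
have s0 i : \int[mu]_t (f t * sin (th i t)) = 0 by rewrite rest Rintegral_sin_period.
have [_ _ eC eS] := @Rintegral_prodf_cos R n (fun=> f) th (fun=> itf) mth s0.
have e k : expi (dot (introw R y) k) * expi (- dot (introw R x) k) =
    expi (\sum_i th i (k ord0 i)).
  rewrite -expiD; congr expi; rewrite /dot -sumrN -big_split/=; apply: eq_bigr => i _.
  by rewrite /th !mxE rmorphB/=; ring.
have cell (h : 'rV[R]_n -> R) : \int[lebesgue_row R n]_(k in @torus_cell R n) h k =
    \int[lebesgue_row R n]_k (prodf (fun=> f) k * h k).
  rewrite Rintegral_mkcond; apply: eq_Rintegral => k _; rewrite patchE.
  have [kc|kc] := boolP (k \in _).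
    rewrite /prodf big1 ?mul1r// => i _; rewrite /f indicE mem_set//.
    by move/set_mem: kc => /(_ i).
  have [i ki] : exists i, ~ I (k ord0 i).
    apply: contrapT => /forallNP h'; move/negP: kc; apply; apply/mem_set => i.
    by have /contrapT := h' i; rewrite /I/= in_itv.
  by rewrite /prodf (bigD1 i)//= /f indicE memNset// !mul0r.
rewrite /torus_fourier /cintegral.
under eq_Rintegral do rewrite e.
under [X in _ +i* X]eq_Rintegral do rewrite e.
rewrite /= !cell eS eC; congr (_ +i* _).
under eq_bigr do rewrite rest Rintegral_cos_period.
rewrite big_split/= prodr_const card_ord; congr (_ * _).
have [->|xy] := eqVneq x y; first by rewrite big1// => i _; rewrite !mxE subrr eqxx.
have [i xyi] : exists i, (y - x) ord0 i != 0.
  apply/existsP; rewrite -negb_forall; apply: contra xy => /forallP h.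
  by apply/eqP/rowP => i; have := h i; rewrite !mxE subr_eq0 => /eqP ->.
by rewrite (bigD1 i)//= (negbTE xyi) mul0r.
Qed.

End lattice_fourier.

(** * Sums over lattice boxes *)

Section boxes.
Local Open Scope classical_set_scope.
Variables n N : nat.

(* Enumeration of the points of [-N, N]^n. *)
Definition box_point (g : {ffun 'I_n -> 'I_N.*2.+1}) : 'rV[int]_n :=
  \row_i ((g i)%:Z - N%:Z).

Lemma box_point_inj : injective box_point.
Proof.
move=> g h /rowP e; apply/ffunP => i; have := e i; rewrite !mxE => /addIr[] ei.
exact: val_inj.
Qed.

Lemma box_point_le g i : `|box_point g ord0 i| <= N%:Z.
Proof.
rewrite mxE; move: (nat_of_ord (g i)) (ltn_ord (g i)) => j.
by rewrite ltnS -addnn ler_norml => h; lia.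
Qed.

Lemma box_pointP (x : 'rV[int]_n) : (forall i, `|x ord0 i| <= N%:Z) ->
  exists g, box_point g = x.
Proof.
move=> xN; exists [ffun i => inord (absz (x ord0 i + N%:Z))].
apply/rowP => i; rewrite mxE ffunE.
have := xN i; rewrite ler_norml => /andP[h1 h2].
rewrite inordK; last by rewrite ltnS -addnn; lia.
rewrite -[x 0 i]/(x ord0 i); move: (x ord0 i) h1 h2 => z h1 h2; rewrite gez0_abs; lia.
Qed.

Lemma fsbig_box (V : nmodType) (G : 'rV[int]_n -> V) :
  (forall x : 'rV[int]_n, ~ (forall i, `|x ord0 i| <= N%:Z) -> G x = 0) ->
  \sum_(x \in [set: 'rV[int]_n]) G x = \sum_g G (box_point g).
Proof.
move=> G0.
rewrite -(@fsbig_widen _ _ _ _ (range box_point)); last 2 first.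
- by [].
- move=> x [_ xr]; apply: G0 => xN; apply: xr.
  by have [g <-] := box_pointP xN; exists g.
rewrite (@reindex_fsbig _ _ _ _ _ box_point setT); last first.
  by split => [g _|g h _ _|x [g _ <-]]; [exists g|exact: box_point_inj|exists g].
rewrite [RHS]fsbig_seq ?index_enum_uniq//; apply: eq_fsbigl.
by apply/seteqP; split => g //= _; rewrite mem_index_enum.
Qed.

Lemma sum_symmetric (V : zmodType) (F : int -> V) M :
  \sum_(j < M.*2.+1) F (j%:Z - M%:Z) = F 0 + \sum_(t < M) (F t.+1%:Z + F (- t.+1%:Z)).
Proof.
elim: M => [|M IH]; first by rewrite big_ord_recl !big_ord0 subr0.
rewrite doubleS big_ord_recl big_ord_recr/=.
rewrite (eq_bigr (fun j : 'I_M.*2.+1 => F (j%:Z - M%:Z))); last first.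
  by move=> j _; congr F; rewrite /fintype.bump/=; lia.
rewrite {}IH big_ord_recr/= addrCA [RHS]addrA; congr (_ + _).
by rewrite addrC /fintype.bump leq0n sub0r; congr (F _ + _); lia.
Qed.

End boxes.

Section box_sums.
Context {R : realType}.
Local Open Scope classical_set_scope.
Local Open Scope complex_scope.

(** Distributivity turns the sum over the box into a product of one-dimensional sums. Evenness of f
    pairs t with -t, which makes each of them real. *)
Lemma box_expi_sum n N (f : R -> R) (k : 'rV[R]_n) : (forall t, f (- t) = f t) ->
  \sum_(g : {ffun 'I_n -> 'I_N.*2.+1}) (prodf (fun=> f) (introw R (box_point g)))%:C
     * expi (dot (introw R (box_point g)) k) =
  (prodf (fun=> fun t => lattice_partial_sum f t N) k)%:C.
Proof.
move=> ef; pose F i (t : int) : R[i] := (f t%:~R)%:C * expi (t%:~R * k ord0 i).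
rewrite /prodf rmorph_prod/=.
transitivity (\prod_i \sum_(j < N.*2.+1) F i (j%:Z - N%:Z)).
  rewrite bigA_distr_bigA/=; apply: eq_bigr => g _.
  rewrite rmorph_prod/= /dot expi_sum -big_split/=; apply: eq_bigr => i _.
  by rewrite /F !mxE.
apply: eq_bigr => i _; rewrite sum_symmetric /lattice_partial_sum rmorphD/=; rewrite rmorph_sum/=.
congr (_ + _); first by rewrite /F mul0r expi0 mulr1.
apply: eq_bigr => t _; rewrite /F rmorphN/= mulNr ef -mulrDr.
rewrite /expi cosN sinN !rmorphM/= mulrCA; congr (_ * _).
by apply/eqP; rewrite eq_complex/=; apply/andP; split; apply/eqP; ring.
Qed.

End box_sums.

(** * The lattice case *)

Section lattice_space.
Context {R : realType} (n : nat) dT (T : measurableType dT).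
Local Open Scope classical_set_scope.
Local Open Scope complex_scope.
Local Notation counting := (@counting 'rV[int]_n R).

Lemma measurable_fun_row_int d (Y : measurableType d) (g : 'rV[int]_n -> Y) :
  measurable_fun setT g.
Proof. by move=> _ B _; exact: measurable_row_int. Qed.

Lemma counting_set1 (x : 'rV[int]_n) : counting [set x] = 1%E.
Proof.
have h : finite_set [set x] := finite_set1 x.
by rewrite /counting_measure.counting asboolT// fset_set1 finmap.cardfs1.
Qed.

Lemma integral_counting_indic (x : 'rV[int]_n) :
  (\int[counting]_y (\1_[set x] y)%:E = 1)%E.
Proof.
rewrite integral_indic//; last exact: measurable_row_int.
by rewrite setIT; exact: counting_set1.
Qed.

Section box_functions.
Variable f : R -> R.
Hypotheses (sf : schwartzR f) (ef : forall t, f (- t) = f t) (f0 : forall t, 0 <= f t).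

Definition lattice_fun (x : 'rV[int]_n) : R := prodf (fun=> f) (introw R x).

Definition in_box N (x : 'rV[int]_n) : bool := [forall i, `|x ord0 i| <= N%:Z].

Definition box_fun N (x : 'rV[int]_n) : R := lattice_fun x * (in_box N x)%:R.

Lemma lattice_fun_ge0 x : 0 <= lattice_fun x.
Proof. exact: prodr_ge0. Qed.

Lemma box_fun_ge0 N x : 0 <= box_fun N x.
Proof. by rewrite mulr_ge0// lattice_fun_ge0. Qed.

Lemma box_fun_le N x : box_fun N x <= lattice_fun x.
Proof. by rewrite /box_fun; case: in_box; rewrite ?mulr1// mulr0 lattice_fun_ge0. Qed.

Lemma in_box_box_point N (g : {ffun 'I_n -> 'I_N.*2.+1}) : in_box N (box_point g).
Proof. by apply/forallP => i; exact: box_point_le. Qed.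

Lemma box_fun_box_point N (g : {ffun 'I_n -> 'I_N.*2.+1}) :
  box_fun N (box_point g) = lattice_fun (box_point g).
Proof. by rewrite /box_fun in_box_box_point mulr1. Qed.

Lemma box_fun_out N (x : 'rV[int]_n) : ~ (forall i, `|x ord0 i| <= N%:Z) -> box_fun N x = 0.
Proof.
move=> h; rewrite /box_fun (_ : in_box N x = false) ?mulr0//.
by apply/negP => /forallP.
Qed.

Lemma box_fun_sum N x :
  box_fun N x = \sum_(g : {ffun 'I_n -> 'I_N.*2.+1}) lattice_fun (box_point g) * \1_[set box_point g] x.
Proof.
have [xN|xN] := boolP (in_box N x); last first.
  rewrite /box_fun (negbTE xN) mulr0 big1// => g _; rewrite indicE memNset ?mulr0//= => xg.
  by move: xN; rewrite xg in_box_box_point.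
have [g <-] := box_pointP (fun i => forallP xN i).
rewrite (bigD1 g)//= big1 ?addr0.
  by rewrite box_fun_box_point indicE mem_set// mulr1.
move=> h hg; rewrite indicE memNset ?mulr0//= => /box_point_inj gh.
by move: hg; rewrite gh eqxx.
Qed.

Lemma cvg_box_fun x : box_fun ^~ x @ \oo --> lattice_fun x.
Proof.
apply: (@cvg_near_cst _ _ _ _ _ _ _).
exists (\sum_i absz (x ord0 i))%N => // N /= xN.
rewrite /box_fun (_ : in_box N x) ?mulr1//; apply/forallP => i.
have : (absz (x ord0 i) <= N)%N.
  by apply: leq_trans xN; rewrite (bigD1 i)//= leq_addr.
by rewrite -lez_nat; lia.
Qed.

Lemma integral_box_fun N : (\int[counting]_x (box_fun N x)%:E =
  (\sum_(g : {ffun 'I_n -> 'I_N.*2.+1}) lattice_fun (box_point g))%:E)%E.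
Proof.
under eq_integral do rewrite box_fun_sum -sumEFin.
rewrite ge0_integral_sum//; first last.
- by move=> g x _; rewrite lee_fin mulr_ge0 ?lattice_fun_ge0// indicE.
- move=> g; exact: measurable_fun_row_int.
rewrite -sumEFin; apply: eq_bigr => g _; under eq_integral do rewrite EFinM.
rewrite ge0_integralZl//.
- by rewrite integral_counting_indic mule1.
- exact: measurable_fun_row_int.
- by rewrite lee_fin lattice_fun_ge0.
Qed.

(** At k = 0 all characters are 1, so [box_expi_sum] expresses this sum as the n-th power of a
    bounded one-dimensional sum. *)
Lemma sum_box_bounded : exists B : R, forall N,
  \sum_(g : {ffun 'I_n -> 'I_N.*2.+1}) lattice_fun (box_point g) <= B.
Proof.
have [B hB] := lattice_partial_sum_bounded sf.
exists (B ^+ n) => N.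
have := @box_expi_sum R n N f 0 ef.
have -> : prodf (fun=> fun t => lattice_partial_sum f t N) (0 : 'rV[R]_n) =
    lattice_partial_sum f 0 N ^+ n.
  by rewrite /prodf -[n in RHS]card_ord -prodr_const; apply: eq_bigr => i _; rewrite mxE.
rewrite (eq_bigr (fun g => (lattice_fun (box_point g))%:C)); last first.
  move=> g _; rewrite (_ : dot _ 0 = 0) ?expi0 ?mulr1//.
  by rewrite /dot big1// => i _; rewrite !mxE mulr0.
rewrite -rmorph_sum/= => /complexI ->.
apply: le_trans (ler_norm _) _; rewrite normrX lerXn2r ?nnegrE//.
exact: le_trans (hB 0 0%N).
Qed.

Lemma integrable_lattice_fun : counting.-integrable setT (EFin \o lattice_fun).
Proof.
have [B hB] := sum_box_bounded.
have mb N : measurable_fun setT (fun x => (box_fun N x)%:E) by exact: measurable_fun_row_int.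
have b0 N x : setT x -> (0 <= (box_fun N x)%:E)%E by rewrite lee_fin box_fun_ge0.
have nd x : setT x -> {homo (fun N => (box_fun N x)%:E) : a b / (a <= b)%N >-> (a <= b)%E}.
  move=> _ a b ab; rewrite lee_fin /box_fun ler_wpM2l ?lattice_fun_ge0// ler_nat.
  have [/forallP xa|] := boolP (in_box a x) => //.
  rewrite (_ : in_box b x)//; apply/forallP => i; apply: le_trans (xa i) _.
  by rewrite lez_nat.
apply/integrableP; split; first exact: measurable_fun_row_int.
under eq_integral do rewrite /= ger0_norm ?lattice_fun_ge0//.
rewrite (eq_integral (fun x => limn (fun N => (box_fun N x)%:E))); last first.
  move=> x _; apply/esym/cvg_lim => //; apply: cvg_EFin; first exact: nearW.
  exact: cvg_box_fun.
rewrite monotone_convergence//; apply: (@le_lt_trans _ _ B%:E); last by rewrite ltry.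
apply: lime_le.
  apply: ereal_nondecreasing_is_cvgn => a b ab; apply: ge0_le_integral => //.
  - by move=> x _; exact: b0.
  - by move=> x _; exact: nd.
by apply: nearW => N; rewrite integral_box_fun lee_fin.
Qed.

Lemma Rintegral_lattice_fun_gt0 : 0 < f 0 -> 0 < \int[counting]_x lattice_fun x.
Proof.
move=> f00; have i0 : counting.-integrable setT (EFin \o (\1_[set 0] : 'rV[int]_n -> R)).
  apply/integrableP; split; first exact: measurable_fun_row_int.
  under eq_integral do rewrite /= ger0_norm//.
  by rewrite integral_counting_indic ltry.
apply: (@lt_le_trans _ _ (\int[counting]_x (f 0 ^+ n * \1_[set 0] x))).
  rewrite RintegralZl// /Rintegral integral_counting_indic/= mulr1.
  by rewrite exprn_gt0.
apply: le_Rintegral => //; [exact: integrable_funZ|exact: integrable_lattice_fun|].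
move=> x _; rewrite indicE; have [/set_mem/= ->|_] := boolP (x \in _).
  rewrite mulr1 /lattice_fun /prodf -[n in leLHS]card_ord -prodr_const.
  by apply: ler_prod => i _; rewrite !mxE f0 lexx.
by rewrite mulr0 lattice_fun_ge0.
Qed.

End box_functions.

Variables (P : probability T R) (Xi : R.-ker T ~> 'rV[int]_n) (rho : R).
Hypotheses (rho0 : 0 < rho).
Hypotheses (pp : point_process P Xi (@introw R n)) (intensity : has_intensity P Xi counting rho).
Variables (beta : 'rV[int]_n -> R[i]) (S : {measure set 'rV[R]_n -> \bar R}).
Hypotheses (cov : is_covariance_functional_lattice P Xi beta)
  (structure : is_structure_function_lattice beta S).

Let finS : (S setT < +oo)%E. Proof. by case: structure. Qed.

(** The real part suffices, because [beta] enters the variance with real coefficients. *)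
Lemma Re_covariance_functional_lattice y :
  complex.Re (beta y) = ((2 * pi) ^+ n)^-1 * \int[S]_k cos (dot (introw R y) k).
Proof.
have [_ _ /(_ _ (smooth_expi _) (torus_periodic_expi y))] := structure.
move=> /(congr1 (@complex.Re R)) /= ->.
rewrite (_ : \int[counting]_x _ = (complex.Re (beta y) * (2 * pi) ^+ n) * \int[counting]_x \1_[set y] x).
  rewrite /Rintegral integral_counting_indic mulr1 mulrC mulfK//.
  by rewrite expf_neq0// mulf_neq0// gt_eqF// pi_gt0.
rewrite -RintegralZl//; last first.
  apply/integrableP; split; first exact: measurable_fun_row_int.
  under eq_integral do rewrite /= ger0_norm//.
  by rewrite integral_counting_indic ltry.
apply: eq_Rintegral => x _; rewrite torus_fourier_expi indicE.
have [->|xy] := eqVneq x y; first by rewrite mem_set//=; case: (beta y) => a b /=; ring.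
rewrite memNset/=; last by move=> e; rewrite e eqxx in xy.
by rewrite !mulr0.
Qed.

Variables (U : set 'rV[R]_n) (r : R) (f : R -> R).
Hypotheses (mU : measurable U) (U0 : S U = 0%E) (r0 : 0 < r) (rpi : 2 * r <= pi).
Hypothesis boxU : forall k : 'rV[R]_n, (forall i, `|k ord0 i| < 2 * r) -> U k.
Hypothesis bf : band_limited r f.

Let A N : 'rV[R]_n -> R := prodf (fun=> fun t => lattice_partial_sum f t N).

(* The functions e^(i<y, k>) are admissible in the duality between beta and S,
   and have a single nonzero Fourier coefficient. *)
Lemma lattice_variance N :
  complex.Re (ccov P (fun w => cintegral (Xi w) setT (fun x => (box_fun f N x)%:C))
    (fun w => cintegral (Xi w) setT (fun x => (box_fun f N x)%:C))) =
  ((2 * pi) ^+ n)^-1 * \int[S]_k (A N k ^+ 2).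
Proof.
have [sf ef f0 cf] := bf.
have fin : finite_set [set x | (box_fun f N x)%:C != 0].
  apply: (@sub_finite_set _ _ (range (@box_point n N))); last exact: finite_image.
  move=> x /= xn0; have [xN|] := boolP (in_box N x).
    by have [g <-] := box_pointP (fun i => forallP xN i); exists g.
  by move=> xN; move: xn0; rewrite /box_fun (negbTE xN) mulr0 eqxx.
rewrite cov// (@fsbig_box n N); last first.
  by move=> s sN; rewrite fsbig1// => t _; rewrite box_fun_out// !mul0r.
rewrite (eq_bigr (fun g => \sum_h (box_fun f N (box_point g))%:C *
    ((box_fun f N (@box_point n N h))%:C^*)%C * beta (box_point g - box_point h))); last first.
  move=> g _; rewrite (@fsbig_box n N)// => t tN.
  by rewrite (box_fun_out _ tN)//= oppr0 mulr0 mul0r.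
pose c g := lattice_fun f (@box_point n N g).
pose cg g k := cos (dot (introw R (@box_point n N g)) k).
pose sg g k := sin (dot (introw R (@box_point n N g)) k).
(* The sine sum vanishes, so its square can be added for free. The addition formula for the cosine
   then produces the differences of lattice points at which [beta] is evaluated. *)
have AE k : A N k ^+ 2 = \sum_g \sum_h (c g * c h * (cg g k * cg h k + sg g k * sg h k)).
  have e := @box_expi_sum R n N f k ef.
  have eR : \sum_g c g * cg g k = A N k.
    have := congr1 (@complex.Re R) e; rewrite Re_sum => h; apply: etrans h.
    by apply: eq_bigr => g _ /=; rewrite mul0r subr0.
  have eI : \sum_g c g * sg g k = 0.
    have := congr1 (@complex.Im R) e; rewrite Im_sum => h; apply: etrans h.
    by apply: eq_bigr => g _ /=; rewrite mul0r addr0.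
  transitivity ((\sum_g c g * cg g k) * (\sum_g c g * cg g k) +
      (\sum_g c g * sg g k) * (\sum_g c g * sg g k)).
    by rewrite eR eI mul0r addr0 expr2.
  rewrite !mulr_suml -big_split/=; apply: eq_bigr => g _.
  by rewrite !mulr_sumr -big_split/=; apply: eq_bigr => h _; ring.
have icos g h : S.-integrable setT (EFin \o (fun k =>
    c g * c h * cos (dot (introw R (@box_point n N g - box_point h)) k))).
  apply: integrable_funZ => //; apply: (@integrable_finite_measure _ _ _ _ _ 1) => //.
    exact: measurable_cos_dot.
  by move=> k; exact: norm_cos_le1.
have AE' k : A N k ^+ 2 = \sum_g \sum_h
    (c g * c h * cos (dot (introw R (@box_point n N g - box_point h)) k)).
  rewrite AE; apply: eq_bigr => g _; apply: eq_bigr => h _; congr (_ * _).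
  rewrite (_ : dot _ k = dot (introw R (box_point g)) k - dot (introw R (box_point h)) k).
    by rewrite cosB.
  rewrite /dot -sumrN -big_split/=; apply: eq_bigr => i _.
  by rewrite !mxE rmorphB/=; ring.
rewrite Re_sum; under eq_Rintegral do rewrite AE'.
have [_ ->] := Rintegral_sum_finite (index_enum _) (fun g =>
  (Rintegral_sum_finite (index_enum _) (icos g)).1).
rewrite mulr_sumr; apply: eq_bigr => g _.
have [_ ->] := Rintegral_sum_finite (index_enum _) (icos g).
rewrite Re_sum mulr_sumr; apply: eq_bigr => h _.
rewrite RintegralZl//; last first.
  apply: (@integrable_finite_measure _ _ _ _ _ 1) => //; first exact: measurable_cos_dot.
  by move=> k; exact: norm_cos_le1.
rewrite !box_fun_box_point -/(c g) -/(c h) mulrCA -Re_covariance_functional_lattice.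
by case: (beta _) => a b /=; ring.
Qed.

Lemma lattice_variance_cvg0 :
  complex.Re (ccov P (fun w => cintegral (Xi w) setT (fun x => (box_fun f N x)%:C))
    (fun w => cintegral (Xi w) setT (fun x => (box_fun f N x)%:C))) @[N --> \oo] --> (0 : R).
Proof.
have [sf ef f0 cf] := bf.
have [cell0 _ _] := structure.
under eq_fun do rewrite lattice_variance.
rewrite -(mulr0 ((2 * pi) ^+ n)^-1); apply: cvgMr.
have [B hB] := lattice_partial_sum_bounded sf.
have B0 : 0 <= B by exact: le_trans (hB 0 0%N).
have AB N k : `|A N k| <= B ^+ n.
  rewrite /A /prodf normr_prod -[n in leRHS]card_ord -prodr_const.
  by apply: ler_prod => i _; rewrite normr_ge0 hB.
have mA N : measurable_fun setT (A N).
  apply: measurable_prodf => i; apply: continuous_measurableR.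
  rewrite /lattice_partial_sum => t; apply: cvgD; first exact: cvg_cst.
  apply: cvg_big => [|j _]; first exact: add_continuous.
  apply: cvgMr; apply: cvgMr.
  by apply: continuous_comp; [exact: mulrl_continuous|exact: continuous_cos].
have mcell : measurable (@torus_cell R n).
  rewrite (_ : @torus_cell R n = \bigcap_(i in [set: 'I_n])
     ((fun k : 'rV[R]_n => k ord0 i) @^-1` `[- pi, pi[%classic)); last first.
    apply/seteqP; split => [k kc i _ /=|k kc i]; first by rewrite in_itv; exact: kc.
    by have := kc i I; rewrite /= in_itv.
  apply: fin_bigcap_measurable => // i _.
  by rewrite -[X in measurable X]setTI; apply: measurable_coor => //; exact: measurable_itv.
(* [S] is carried by this set, where some coordinate satisfies 2 r <= |k_i| <= pi. The factor of
   that coordinate tends to 0 while the others stay bounded. *)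
pose D := @torus_cell R n `\` U.
have mD : measurable D by exact: measurableD.
have e N : \int[S]_k (A N k ^+ 2) = \int[S]_k (A N k ^+ 2 * \1_D k).
  rewrite /Rintegral; congr fine; apply: ae_eq_integral => //.
  - by apply/measurable_EFinP; exact: measurable_funX.
  - apply/measurable_EFinP; apply: measurable_funM; first exact: measurable_funX.
    exact: measurable_indic.
  - exists (~` @torus_cell R n `|` U); split.
    + by apply: measurableU => //; exact: measurableC.
    + exact: null_set_setU (measurableC mcell) mU cell0 U0.
    + move=> k /= h; apply: contrapT => /not_orP[/contrapT kc kU]; apply: h => _.
      by rewrite indicE mem_set ?mulr1.
under eq_fun do rewrite e.
rewrite (_ : 0 = \int[S]_k (cst 0 k)); last by rewrite Rintegral_eq0.
apply: (@Rintegral_dominated_cvg _ _ _ S setT measurableT _ _ (cst ((B ^+ n) ^+ 2))).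
- move=> N; apply: measurable_funM; first exact: measurable_funX.
  exact: measurable_indic.
- move=> k; rewrite indicE; have [/set_mem[kc kU]|_] := boolP (k \in D); last first.
    by under eq_fun do rewrite mulr0; exact: cvg_cst.
  under eq_fun do rewrite mulr1.
  have [i ki] : exists i, 2 * r <= `|k ord0 i|.
    apply: contrapT => /forallNP h; apply: kU; apply: boxU => i.
    by rewrite ltNge; apply/negP; exact: h.
  have kpi : `|k ord0 i| <= pi by have /andP[h1 /ltW h2] := kc i; rewrite ler_norml h1.
  have a0 : lattice_partial_sum f (k ord0 i) @ \oo --> (0 : R).
    by apply: (@lattice_partial_sum_cvg0 _ _ r) => //; rewrite ki.
  have A0 : A N k @[N --> \oo] --> (0 : R).
    apply/cvgr0Pnorm_le => e1 e10.
    (* The remaining n - 1 factors are bounded by [B]; the summand 1 keeps the denominator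
       positive. *)
    have e20 : 0 < e1 / (1 + B ^+ n.-1) by rewrite divr_gt0// ltr_pwDl// exprn_ge0.
    move/cvgr0Pnorm_le: a0 => /(_ _ e20); apply: filterS => N hN.
    rewrite /A /prodf (bigD1 i)//= normrM normr_prod.
    apply: (@le_trans _ _ (e1 / (1 + B ^+ n.-1) * B ^+ n.-1)).
      apply: ler_pM => //; first by apply: prodr_ge0.
      rewrite (_ : B ^+ n.-1 = \prod_(j < n | j != i) B); last first.
        by rewrite prodr_const cardC1 card_ord.
      by apply: ler_prod => j _; rewrite normr_ge0 hB.
    rewrite mulrAC ler_pdivrMr ?ltr_pwDl ?exprn_ge0// ler_wpM2l ?(ltW e10)//.
    by rewrite lerDr.
  have h := cvgM A0 A0; rewrite mulr0 in h; exact: h.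
- apply: (@integrable_finite_measure _ _ _ _ _ ((B ^+ n) ^+ 2)) => // k.
  by rewrite ger0_norm// sqr_ge0.
- move=> N k; rewrite /= normrM normrX.
  apply: (@le_trans _ _ (`|A N k| ^+ 2)).
    by rewrite ler_piMr ?exprn_ge0// indicE; case: (_ \in _); rewrite ?normr0 ?normr1.
  by rewrite lerXn2r// nnegrE exprn_ge0.
Qed.

Lemma ae_lattice_integral :
  {ae P, forall w, (\int[Xi w]_x (lattice_fun f x)%:E = (rho * \int[counting]_x lattice_fun f x)%:E)%E}.
Proof.
have [sf ef f0 cf] := bf.
pose K N := [set x : 'rV[int]_n | in_box N x].
have mK N : measurable (K N) by exact: measurable_row_int.
have bK N : ebounded (@introw R n) (K N).
  exists (n%:R * N%:R) => x /forallP xN; apply: le_trans (enorm_le_sum _) _.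
  rewrite -[n in leRHS]card_ord -sum1_card natr_sum mulr_suml.
  apply: ler_sum => i _; rewrite mul1r mxE -intr_norm -[N%:R]/(N%:Z%:~R) ler_int.
  exact: xN.
have [C hC] := rapidly_bounded 0 sf.
apply: (@ae_integral_constant _ _ _ _ _ P Xi _ rho (ltW rho0) intensity _ (box_fun f) 1 K).
- exact: measurable_fun_row_int.
- by move=> N; exact: measurable_fun_row_int.
- exact: lattice_fun_ge0.
- exact: box_fun_ge0.
- by move=> N x; rewrite mul1r box_fun_le.
- exact: cvg_box_fun.
- exact: integrable_lattice_fun.
- move=> N; exists (C ^+ n) => x; apply: le_trans (box_fun_le _ _ _) _ => //.
  rewrite /lattice_fun /prodf -[n in _ ^+ n]card_ord -prodr_const.
  by apply: ler_prod => i _; rewrite f0/= (le_trans (ler_norm _)).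
- by move=> N x Kx; apply: box_fun_out => h; apply: Kx; apply/forallP.
- exact: mK.
- by move=> w N; have [k ->] := pp.1 w _ (mK N) (bK N); rewrite ltry.
- by move=> N; exact: pp.2 (mK N) (bK N).
- exact: lattice_variance_cvg0.
Qed.

End lattice_space.

(** * Choice of the band inside the neighbourhood of the origin *)

Lemma nbhs0_box (R : realType) n (U : set 'rV[R]_n) : nbhs (0 : 'rV[R]_n) U ->
  exists2 e : R, 0 < e & forall k : 'rV[R]_n, (forall i, `|k ord0 i| < e) -> U k.
Proof.
(* Balls of row vectors are taken entrywise, so they are boxes. *)
move=> /nbhs_ballP[e /= e0 eU]; exists e => // k ke; apply: eU; split => // i j.
by rewrite (ord1 i) mxE -ball_normE/= sub0r normrN ke.
Qed.

Theorem theorem1p1 (R : realType) (d : nat) (hd : (0 < d)%N)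
    (dT : measure_display) (T : measurableType dT) (P : probability T R)
    (rho : R) (hrho : 0 < rho) :
  (forall Xi : R.-ker T ~> 'rV[R]_d,
     point_process P Xi id ->
     translation_invariant P Xi +%R ->
     has_intensity P Xi (lebesgue_row R d) rho ->
     stealthy_hyperuniform P Xi ->
     exists2 r0 : R, 0 < r0 &
       forall x : 'rV[R]_d,
         P [set w | Xi w (eball id x r0) = 0%E] = 0%E) /\
  (forall Xi : R.-ker T ~> 'rV[int]_d,
     point_process P Xi (@introw R d) ->
     translation_invariant P Xi +%R ->
     has_intensity P Xi (@counting 'rV[int]_d R) rho ->
     stealthy_hyperuniform_lattice P Xi ->
     exists2 r0 : R, 0 < r0 &
       forall x : 'rV[int]_d,
         P [set w | Xi w (eball (@introw R d) x r0) = 0%E] = 0%E).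
Proof.
split => Xi pp trans intensity [beta [S [cov structure [U [mU nU U0]]]]].
- have [e e0 eU] : exists2 e : R, 0 < e & forall k : 'rV[R]_d, (forall i, `|k ord0 i| < e) -> U k.
    exact: nbhs0_box.
  (* The band |s| <= r is closed while the box inside [U] is open; halving [e] leaves room for
     this. *)
  pose r := e / 2; have r0 : 0 < r by rewrite divr_gt0.
  have boxU (k : 'rV[R]_d) : (forall i, `|k ord0 i| <= r) -> U k.
    move=> h; apply: eU => i; apply: le_lt_trans (h i) _.
    by rewrite /r ltr_pdivrMr// ltr_pMr// ltrDl.
  have ae f (bf : band_limited r f) := ae_window_integral hd hrho pp intensity cov structure mU U0 boxU bf.
  apply: (void_radius r0 _ _ trans (ae _ (band_limited_window r0)) (ae _ (band_limited_heavy_window r0))).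
  + by [].
  + by move=> x y; rewrite addrAC subrr add0r.
  + by rewrite mulr_gt0// exprn_gt0// Rintegral_window_gt0.
- have [e e0 eU] : exists2 e : R, 0 < e & forall k : 'rV[R]_d, (forall i, `|k ord0 i| < e) -> U k.
    exact: nbhs0_box.
  (* The Fejer argument needs a gap between the band |s| <= r and the frequencies outside [U], which
     have a coordinate of size at least 2 r. It also needs 2 r <= pi, to keep l - k away from the
     nonzero multiples of 2 pi. *)
  pose r := Num.min e pi / 2; have r0 : 0 < r by rewrite divr_gt0// lt_min e0 pi_gt0.
  have r2 : 2 * r = Num.min e pi by rewrite /r mulrC divfK.
  have rpi : 2 * r <= pi by rewrite r2 ge_min lexx orbT.
  have boxU (k : 'rV[R]_d) : (forall i, `|k ord0 i| < 2 * r) -> U k.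
    by move=> h; apply: eU => i; apply: lt_le_trans (h i) _; rewrite r2 ge_min lexx.
  have ae f (bf : band_limited r f) :=
    ae_lattice_integral hrho pp intensity cov structure mU U0 r0 rpi boxU bf.
  have bw := band_limited_window r0; have [sw ew w0 _] := bw.
  apply: (void_radius r0 _ _ trans (ae _ bw) (ae _ (band_limited_heavy_window r0))).
  + exact: measurable_fun_row_int.
  + by move=> x y; apply/rowP => i; rewrite !mxE rmorphD/=; ring.
  + rewrite mulr_gt0//; apply: Rintegral_lattice_fun_gt0 => //; exact: window0_gt0.
Qed.
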